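(* Let $d\ge1$, $1<q<\infty$, $\tfrac1{q'}=1-\tfrac1q$, $T>0$, $\delta\in[0,T)$. There is a constant $C_{d,q}$ depending only on $d,q$ such that the following holds. In the setting described in the context, assume all of (E1), (D0), (D2), (D1$_q$), (D4), (I), (S1)--(S4), (S2$_q$), (A1)--(A3) stated there. Fix $r>0$ and set $$R:=(1+r)\exp\big(\|G\|_{L^1}+\|G_\theta\|_{L^1}\big),\qquad \mathcal{E}_v:=\|v-v_\theta\|_{L^1([\delta,T]\times B_R)}.$$ Then for every $\lambda>0$ and $\eta>0$, $$\mathcal{L}^d\big(\{x\in B_r:\ |Z^\delta(T,x)-Z^\delta_\theta(T,x)|>\eta\}\big)\le\frac{1}{\log(1+\eta/\lambda)}\Big[\mathcal{C}_q+\frac{L_\theta}{\lambda}\mathcal{E}_v\Big],$$ where $$\mathcal{C}_q:=C_{d,q}\,(L+L_\theta)\,|B_R|^{1/q'}\int_\delta^T\|\nabla v(\cdot,s)\|_{L^q(B_{3R})}\,ds.$$ Choosing $\lambda=\sqrt{\mathcal{E}_v}$ gives, for $\mathcal{E}_v<\eta^2$, $$\mathcal{L}^d\big(\{x\in B_r:\ |Z^\delta(T,x)-Z^\delta_\theta(T,x)|>\eta\}\big)\le\frac{\mathcal{C}_q+L_\theta\sqrt{\mathcal{E}_v}}{\log\big(1+\eta\,\mathcal{E}_v^{-1/2}\big)},$$ whose right-hand side tends to $0$, logarithmically, as $\mathcal{E}_v\to0$ (the other constants being held fixed).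
   Context: Setting: $X$ is the solution of $dX_t=f(X_t,t)\,dt+\sigma(t)\,dW_t$ on $[0,T]$ ($W$ a $d$-dimensional Brownian motion), $X_0\sim p_0\mathcal{L}^d$, with marginal densities $p_t$; $s_\theta:\mathbb{R}^d\times[\delta,T]\to\mathbb{R}^d$ is a (learned) approximation of the score $\nabla\log p_t$; $$v(x,t)=f(x,t)-\tfrac12\sigma(t)^2\nabla\log p_t(x),\qquad v_\theta(x,t)=f(x,t)-\tfrac12\sigma(t)^2s_\theta(x,t).$$ $\mathcal{L}^d$ (also $|\cdot|$ on sets) is Lebesgue measure, $B_r$ the ball of radius $r$ centred at $0$, $[g]^\pm$ positive/negative parts ($[g]^-=\max(-g,0)$). Assumptions (those on $f$, $p_t$, $s_\theta$ are imposed on the time interval $[\delta,T]$): (E1) $\sigma\in L^\infty(0,T)$, $\epsilon\le\sigma\le\epsilon^{-1}$ a.e. for some $\epsilon>0$. (D0) $f\in L^2_{\mathrm{loc}}([\delta,T]\times\mathbb{R}^d)$. (D2) the distributional divergence of $f$ is absolutely continuous with density $\nabla\cdot f\in L^1([\delta,T];L^1_{\mathrm{loc}})$ and $[\nabla\cdot f]^-\in L^1([\delta,T];L^\infty)$. (D1$_q$) $f\in L^1([\delta,T];W^{1,q}_{\mathrm{loc}}(\mathbb{R}^d;\mathbb{R}^d))$. (D4) $|f(x,t)|\le C_f(t)(1+|x|)$ for a.e. $(x,t)$, $C_f\in L^1(\delta,T)$. (I) $p_0$ is a probability density in $L^1\cap L^\infty(\mathbb{R}^d)$, $\int|x|^2p_0<\infty$,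 $\int p_0\log p_0<\infty$. (S1) $p_t>0$ a.e. for each $t\in[\delta,T]$, $p\in L^\infty((\delta,T);L^1\cap L^\infty)$, $\sup_{\delta\le t\le T}\int|x|^2p_t<\infty$, $t\mapsto p_t\mathcal{L}^d$ narrowly continuous on $[\delta,T]$. (S2) $\nabla\log p_\cdot\in L^1((\delta,T);W^{1,1}_{\mathrm{loc}})$. (S3) $\|[\Delta\log p_t]^+\|_{L^\infty}\le\Lambda(t)$, $\Lambda\in L^1(\delta,T)$. (S4) $|\nabla\log p_t(x)|\le A(t)(1+|x|)$ for a.e. $x$, $A\in L^1(\delta,T)$. (S2$_q$) $\nabla^2\log p_\cdot\in L^1([\delta,T];L^q_{\mathrm{loc}})$. (A1) $s_\theta\in L^1([\delta,T];W^{1,q}_{\mathrm{loc}}(\mathbb{R}^d;\mathbb{R}^d))$. (A2) $[\nabla\cdot v_\theta]^-\in L^1([\delta,T];L^\infty)$. (A3) $|s_\theta(x,t)|\le A_\theta(t)(1+|x|)$, $A_\theta\in L^1(\delta,T)$. Linear growth rates: $G:=C_f+\tfrac12\epsilon^{-2}A$, $G_\theta:=C_f+\tfrac12\epsilon^{-2}A_\theta$, so that $|v|\le G(t)(1+|x|)$, $|v_\theta|\le G_\theta(t)(1+|x|)$; $\|G\|_{L^1}$, $\|G_\theta\|_{L^1}$ are norms in $L^1(\delta,T)$. Flows: $Z^\delta,Z^\delta_\theta:[\delta,T]\times\mathbb{R}^d\to\mathbb{R}^d$ are the regular Lagrangian flows of $v$, $v_\theta$ on $[\delta,T]$ normalised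 by $Z^\delta(\delta,x)=Z^\delta_\theta(\delta,x)=x$: for a.e. $x$, $t\mapsto Z^\delta(t,x)$ is absolutely continuous with $Z^\delta(t,x)=x+\int_\delta^tv(Z^\delta(s,x),s)\,ds$, and $Z^\delta(t,\cdot)_\#\mathcal{L}^d\le L\,\mathcal{L}^d$, with compressibility constant $L=\exp\int_\delta^T\big(\|[\nabla\cdot f(\cdot,t)]^-\|_{L^\infty}+\tfrac12\|\sigma\|_{L^\infty}^2\Lambda(t)\big)dt$; similarly for $Z^\delta_\theta$ with $v_\theta$ and $L_\theta=\exp\|[\nabla\cdot v_\theta]^-\|_{L^1([\delta,T];L^\infty)}$. These flows exist and are unique a.e. under the assumptions. *)

(* Defs.v *)
From HB Require Import structures.
From mathcomp Require Import all_boot all_order all_algebra.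
From mathcomp Require Import all_classical all_reals all_analysis.

Set Implicit Arguments.
Unset Strict Implicit.
Unset Printing Implicit Defensive.
Import Order.TTheory GRing.Theory Num.Theory.
Import numFieldNormedType.Exports.
Local Open Scope classical_set_scope.
Local Open Scope ring_scope.

Definition measure_matrix_display : measure_display -> measure_display.
Proof. exact. Qed.

Section measurable_matrix.
Context {d0 : measure_display} {T : measurableType d0} (m n : nat).

Definition mx_entry_sets : set (set 'M[T]_(m, n)) :=
  [set A | exists i j B, measurable B /\
     A = (fun M : 'M[T]_(m, n) => M i j) @^-1` B].

Let mx_set0 : <<s mx_entry_sets >> set0.
Proof. exact: sigma_algebra0. Qed.

Let mx_setC A : <<s mx_entry_sets >> A -> <<s mx_entry_sets >> (~` A).
Proof. exact: sigma_algebraC. Qed.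

Let mx_bigcup (F : (set 'M[T]_(m, n))^nat) :
  (forall i, <<s mx_entry_sets >> (F i)) ->
  <<s mx_entry_sets >> (\bigcup_i (F i)).
Proof. exact: sigma_algebra_bigcup. Qed.

HB.instance Definition _ := Pointed.on 'M[T]_(m, n).
HB.instance Definition _ := @isMeasurable.Build (measure_matrix_display d0)
  'M[T]_(m, n) <<s mx_entry_sets >> mx_set0 mx_setC mx_bigcup.

End measurable_matrix.

Section lebesgue_rV.
Context {R : realType}.
Local Open Scope ereal_scope.

Lemma measurable_mx_entry (m n : nat) (i : 'I_m) (j : 'I_n) :
  measurable_fun [set: 'M[R]_(m, n)] (fun M : 'M[R]_(m, n) => M i j).
Proof.
move=> _ B mB; rewrite setTI; apply: sub_sigma_algebra.
by exists i, j, B.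
Qed.

Lemma measurable_fun_mxP {d1 : measure_display} {T1 : measurableType d1}
    (m n : nat) (f : T1 -> 'M[R]_(m, n)) :
  measurable_fun [set: T1] f <->
  forall i j, measurable_fun [set: T1] (fun x => f x i j).
Proof.
split=> [mf i j|mf].
  exact: (measurableT_comp (@measurable_mx_entry m n i j) mf).
apply: (@measurability _ _ _ _ _ f (@mx_entry_sets _ R m n)) => //.
move=> _ [_ [i [j [B [mB ->]]]] <-].
exact: (mf i j measurableT B mB).
Qed.

Definition rcons0 (n : nat) (z : R * 'rV[R]_n) : 'rV[R]_n.+1 :=
  \row_i (if unlift ord0 i is Some k then z.2 ord0 k else z.1).

Definition runcons0 (n : nat) (x : 'rV[R]_n.+1) : R * 'rV[R]_n :=
  (x ord0 ord0, \row_k x ord0 (lift ord0 k)).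

Lemma rcons0K (n : nat) : cancel (@rcons0 n) (@runcons0 n).
Proof.
case=> a x; rewrite /runcons0; congr pair.
  by rewrite mxE unlift_none.
by apply/rowP => i; rewrite !mxE liftK.
Qed.

Lemma measurable_rcons0 (n : nat) : measurable_fun setT (@rcons0 n).
Proof.
apply/measurable_fun_mxP => i j.
rewrite /rcons0; under eq_fun do rewrite mxE.
case: unlift => [k|]; last exact: measurable_fst.
exact: (measurableT_comp (@measurable_mx_entry 1 n ord0 k) measurable_snd).
Qed.

Lemma measurable_runcons0 (n : nat) : measurable_fun setT (@runcons0 n).
Proof.
apply: measurable_fun_pair; first exact: measurable_mx_entry.
apply/measurable_fun_mxP => i j.
under eq_fun do rewrite mxE; exact: measurable_mx_entry.
Qed.

Section step.
Context (n : nat) (mu : {sigma_finite_measure set 'rV[R]_n -> \bar R}).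

Definition lebesgue_rV_step : set 'rV[R]_n.+1 -> \bar R :=
  pushforward (lebesgue_measure \x mu) (@rcons0 n).

Let step_measure : {measure set 'rV[R]_n.+1 -> \bar R} :=
  measure_function_pushforward__canonical__measure_function_Measure
    (lebesgue_measure \x mu)%E (@measurable_rcons0 n).

HB.instance Definition _ := @isMeasure.Build _ _ _ lebesgue_rV_step
  (measure0 step_measure) (measure_ge0 step_measure)
  (@measure_semi_sigma_additive _ _ _ step_measure).

Let step_sigma_finite : sigma_finite setT lebesgue_rV_step.
Proof.
have /sigma_finiteP[F [FT ndF Foo]] := sigma_finiteT (@lebesgue_measure R).
have /sigma_finiteP[G [GT ndG Goo]] := sigma_finiteT mu.
exists (fun k => @runcons0 n @^-1` (F k `*` G k)).
  rewrite -preimage_bigcup (_ : \bigcup_k (F k `*` G k) = setT) ?preimage_setT//.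
  apply/seteqP; split=> // -[t x] _.
  have [j _ Fj] : (\bigcup_k F k) t by rewrite -FT.
  have [k _ Gk] : (\bigcup_k G k) x by rewrite -GT.
  exists (maxn j k) => //; split => /=.
    by move: t Fj; exact/subsetPset/ndF/leq_maxl.
  by move: x Gk; exact/subsetPset/ndG/leq_maxr.
move=> k; have [mF Fk] := Foo k; have [mG Gk] := Goo k; split.
  by rewrite -[X in measurable X]setTI; apply: measurable_runcons0 => //;
    exact: measurableX.
rewrite /lebesgue_rV_step /pushforward -comp_preimage.
rewrite (_ : _ \o _ = id); last by apply/funext => z /=; rewrite rcons0K.
by rewrite preimage_id product_measure1E// lte_mul_pinfty// ge0_fin_numE.
Qed.

HB.instance Definition _ := Measure_isSigmaFinite.Build _ _ _ lebesgue_rV_step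
  step_sigma_finite.

End step.

Let unit_mass_sigma_finite :
  sigma_finite [set: 'rV[R]_0] (dirac (0%R : 'rV[R]_0) : set _ -> \bar R).
Proof.
exists (fun=> setT); first by rewrite bigcup_const.
by move=> _; split; [exact: measurableT|rewrite diracT ltry].
Qed.

Definition unit_mass : set 'rV[R]_0 -> \bar R := dirac (0%R : 'rV[R]_0).

HB.instance Definition _ := Measure.on unit_mass.

HB.instance Definition _ := Measure_isSigmaFinite.Build _ _ _ unit_mass
  unit_mass_sigma_finite.

(* Lebesgue measure on R^n: the unit mass when n = 0, and L^1 (x) L^n carried
   to row vectors of size n+1 otherwise; see lebesgue_rV_box. *)
Fixpoint lebesgue_rV (n : nat) : {sigma_finite_measure set 'rV[R]_n -> \bar R} :=
  if n is n'.+1 then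
    [the {sigma_finite_measure set _ -> \bar R} of
       lebesgue_rV_step (lebesgue_rV n')]
  else [the {sigma_finite_measure set _ -> \bar R} of unit_mass].

Lemma lebesgue_rV_box (n : nat) (a b : 'I_n -> R) : (forall i, (a i <= b i)%R) ->
  lebesgue_rV n [set x | forall i, x ord0 i \in `[a i, b i]%R] =
  \prod_(i < n) (b i - a i)%:E.
Proof.
elim: n a b => [|n IHn] a b ab.
  by rewrite big_ord0 /= /unit_mass diracE mem_set//= => -[].
rewrite big_ord_recl /= /lebesgue_rV_step /pushforward.
rewrite (_ : _ @^-1` _ = `[a ord0, b ord0]%classic `*`
    [set x : 'rV[R]_n | forall i, x ord0 i \in `[a (lift ord0 i), b (lift ord0 i)]%R]); last first.
  apply/seteqP; split=> -[t x] /= => [h|[h0 h1] i].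
    split=> [|i]; first by have := h ord0; rewrite mxE unlift_none.
    by have := h (lift ord0 i); rewrite mxE liftK.
  by rewrite mxE; case: unliftP => [k ->|->]; [exact: h1|exact: h0].
rewrite product_measure1E//=.
  rewrite -IHn// lebesgue_measure_itv/= lte_fin.
  have := ab ord0; rewrite le_eqVlt => /predU1P[->|->]//.
  by rewrite ltxx subrr.
rewrite (_ : [set _ | _] = \big[setI/setT]_(i < n)
    ((fun x : 'rV[R]_n => x ord0 i) @^-1` `[a (lift ord0 i), b (lift ord0 i)])).
  apply: bigsetI_measurable => i _; rewrite -[X in measurable X]setTI.
  exact: measurable_mx_entry.
rewrite -bigcap_seq; apply/seteqP; split=> x /= h i; first by move=> _; exact: h.
by apply: h; rewrite /= mem_index_enum.
Qed.

End lebesgue_rV.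

Notation leb1 := (@lebesgue_measure _).

(* Euclidean norm of a vector, Frobenius norm of a matrix; the norm `|_| of the
   library on matrices is the sup norm. *)
Definition enorm {R : realType} {m n : nat} (A : 'M[R]_(m, n)) : R :=
  Num.sqrt (\sum_i \sum_j A i j ^+ 2).

Definition eball {R : realType} {d : nat} (r : R) : set 'rV[R]_d :=
  [set x | enorm x < r].

Definition LpNorm {d0 : measure_display} {X : measurableType d0} {R : realType}
    (mu : {measure set X -> \bar R}) (p : \bar R) (D : set X) (g : X -> R)
    : \bar R :=
  Lnorm mu p (fun x => (g x * \1_D x)%:E).

Definition negpart {R : realType} {X : Type} (g : X -> R) (x : X) : R :=
  Num.max (- g x) 0.

Definition pospart {R : realType} {X : Type} (g : X -> R) (x : X) : R :=
  Num.max (g x) 0.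

Section weak_derivatives.
Context {R : realType} {d : nat}.
Local Notation E := 'rV[R]_d.
Implicit Types (phi u g : E -> R).

Definition partial (i : 'I_d) phi (x : E) : R := 'D_(delta_mx ord0 i) phi x.

Fixpoint Ck (k : nat) phi : Prop :=
  continuous phi /\
  (if k is k'.+1 then forall i : 'I_d,
     (forall x, derivable phi x (delta_mx ord0 i)) /\ Ck k' (partial i phi)
   else True).

Definition test_function phi :=
  (forall k, Ck k phi) /\
  (exists2 K : set E, compact K & forall x, ~ K x -> phi x = 0).

Definition loc_integrable u :=
  forall r : R, (lebesgue_rV d).-integrable (eball r) (EFin \o u).

Definition weak_partial (i : 'I_d) u g :=
  [/\ loc_integrable u, loc_integrable g &
   forall phi, test_function phi ->
     \int[lebesgue_rV d]_x (u x * partial i phi x) =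
     - \int[lebesgue_rV d]_x (g x * phi x)].

Definition weak_grad u (G : E -> E) :=
  forall i, weak_partial i u (fun x => G x ord0 i).

(* J x i j is the weak derivative of the i-th component in the j-th direction. *)
Definition weak_jacobian (u : E -> E) (J : E -> 'M[R]_d) :=
  forall i j, weak_partial j (fun x => u x ord0 i) (fun x => J x i j).

Definition weak_div (u : E -> E) g :=
  [/\ forall i, loc_integrable (fun x => u x ord0 i), loc_integrable g &
   forall phi, test_function phi ->
     \sum_i \int[lebesgue_rV d]_x (u x ord0 i * partial i phi x) =
     - \int[lebesgue_rV d]_x (g x * phi x)].

End weak_derivatives.

(* Time-dependent fields are curried, time first.  L^p classes in (x,t) are
   represented by functions that are jointly Borel on I x R^d, and properties of
   the slices u t are required for a.e. t. *)
Section time_dependent_fields.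
Context {R : realType} {d : nat} (I : set R).
Local Notation E := 'rV[R]_d.

Definition joint_measurable {d0 : measure_display} {Y : measurableType d0}
    (u : R -> E -> Y) :=
  measurable_fun (I `*` [set: E]) (fun z : R * E => u z.1 z.2).

Definition L1Lq_loc (q : \bar R) (g : R -> E -> R) :=
  forall r : R,
    (\int[leb1]_(t in I) LpNorm (lebesgue_rV d) q (eball r) (g t) < +oo)%E.

Definition jacobian_field (u : R -> E -> E) (Du : R -> E -> 'M[R]_d) :=
  joint_measurable Du /\
  {ae leb1, forall t, I t -> weak_jacobian (u t) (Du t)}.

Definition divergence_field (u : R -> E -> E) (g : R -> E -> R) :=
  joint_measurable g /\ {ae leb1, forall t, I t -> weak_div (u t) (g t)}.

Definition L1W1q_loc (q : R) (u : R -> E -> E) :=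
  [/\ joint_measurable u, L1Lq_loc q%:E (fun t x => enorm (u t x)) &
   exists2 Du, jacobian_field u Du &
     L1Lq_loc q%:E (fun t x => enorm (Du t x))].

Definition negpart_L1Linf (g : R -> E -> R) :=
  (\int[leb1]_(t in I)
     LpNorm (lebesgue_rV d) +oo [set: E] (negpart (g t)) < +oo)%E.

Definition linear_growth (c : R -> R) (u : R -> E -> E) :=
  leb1.-integrable I (EFin \o c) /\
  {ae (leb1 \x lebesgue_rV d)%E, forall z : R * E,
     I z.1 -> enorm (u z.1 z.2) <= c z.1 * (1 + enorm z.2)}.

Definition L2_loc (u : R -> E -> E) :=
  joint_measurable u /\
  forall r : R, (\int[leb1 \x lebesgue_rV d]_(z in I `*` eball r)
                   (enorm (u z.1 z.2) ^+ 2)%:E < +oo)%E.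

Definition vint (D : set R) (g : R -> E) : E :=
  \row_i \int[leb1]_(s in D) g s ord0 i.

End time_dependent_fields.

Definition drift {R : realType} {d : nat} (f : R -> 'rV[R]_d -> 'rV[R]_d)
    (sigma : R -> R) (s : R -> 'rV[R]_d -> 'rV[R]_d) (t : R) (x : 'rV[R]_d) :=
  f t x - (2^-1 * sigma t ^+ 2) *: s t x.

Section sde.
Context {R : realType} {d : nat} {dO : measure_display}
  {Omega : measurableType dO} (P : probability Omega R) (T : R).
Local Notation E := 'rV[R]_d.

Definition filtration (F : R -> set (set Omega)) :=
  [/\ forall t, sigma_algebra [set: Omega] (F t),
      forall t, F t `<=` measurable &
      forall s t, s <= t -> F s `<=` F t].

Definition adapted (F : R -> set (set Omega)) (Y : R -> Omega -> E) :=
  forall t, `[0, T]%classic t ->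
  forall B : set E, measurable B -> F t (Y t @^-1` B).

Definition continuous_paths (Y : R -> Omega -> E) :=
  {ae P, forall w, {within `[0, T], continuous (fun t => Y t w)}}.

Definition increment (W : R -> Omega -> E) (s t : R) (w : Omega) : E :=
  W t w - W s w.

Definition brownian_motion (F : R -> set (set Omega)) (W : R -> Omega -> E) :=
  [/\ adapted F W, continuous_paths W,
      {ae P, forall w, W 0 w = 0},
      forall s t, 0 <= s -> s < t -> t <= T ->
        forall (A : set Omega) (B : set E), F s A -> measurable B ->
        P (A `&` increment W s t @^-1` B) =
        (P A * P (increment W s t @^-1` B))%E &
      forall s t, 0 <= s -> s < t -> t <= T ->
        forall B : 'I_d -> set R, (forall i, measurable (B i)) ->
        P [set w | forall i, B i (increment W s t w ord0 i)] =
        (\prod_(i < d) normal_prob 0 (Num.sqrt (t - s)) (B i))%E].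

(* The step function sum_k c_k 1_{]a_k, b_k]} is the sequence of the
   (c_k, (a_k, b_k)). *)
Definition step_fun (s : seq (R * (R * R))) (u : R) : R :=
  \sum_(k <- s) k.1 * \1_(`]k.2.1, k.2.2]) u.

Definition step_integral (W : R -> Omega -> E) (s : seq (R * (R * R)))
    (w : Omega) : E :=
  \sum_(k <- s) k.1 *: increment W k.2.1 k.2.2 w.

(* M = int_0^t sigma dW.  As the integrand is deterministic this is the Wiener
   integral: the L^2(P)-limit of the integrals of step functions converging to
   sigma in L^2(0,t). *)
Definition wiener_integral (W : R -> Omega -> E) (sigma : R -> R) (t : R)
    (M : Omega -> E) :=
  measurable_fun [set: Omega] M /\
  exists s : nat -> seq (R * (R * R)),
    [/\ forall n, all (fun k => [&& 0 <= k.2.1, k.2.1 <= k.2.2 & k.2.2 <= t]) (s n),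
        (\int[leb1]_(u in `[0%R, t]) ((sigma u - step_fun (s n) u) ^+ 2)%:E)%E
          @[n --> \oo] --> 0%E &
        (\int[P]_w (enorm (M w - step_integral W (s n) w) ^+ 2)%:E)%E
          @[n --> \oo] --> 0%E].

Definition sde_solution (F : R -> set (set Omega)) (W : R -> Omega -> E)
    (f : R -> E -> E) (sigma : R -> R) (X : R -> Omega -> E) :=
  [/\ adapted F X, continuous_paths X &
   forall t, `[0, T]%classic t ->
   exists2 M, wiener_integral W sigma t M &
   {ae P, forall w,
     (forall i, leb1.-integrable `[0, t]
        (fun s => (f s (X s w) ord0 i)%:E)) /\
     X t w = X 0 w + vint `[0, t] (fun s => f s (X s w)) + M w}].

Definition density_of (mu : set E -> \bar R) (p : E -> R) :=
  [/\ measurable_fun [set: E] p, forall x, 0 <= p x &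
   forall B, measurable B ->
     mu B = (\int[lebesgue_rV d]_(x in B) (p x)%:E)%E].

Definition marginal_densities (X : R -> Omega -> E) (p : R -> E -> R) :=
  forall t, `[0, T]%classic t -> density_of (pushforward P (X t)) (p t).

End sde.

Section assumptions.
Context {R : realType} {d : nat}.
Local Notation E := 'rV[R]_d.
Implicit Types (I : set R) (p : R -> E -> R) (f s : R -> E -> E).

Definition diffusion_bounds (T eps : R) (sigma : R -> R) :=
  [/\ measurable_fun `[0, T] sigma,
      (LpNorm leb1 +oo `[0%R, T] sigma < +oo)%E, 0 < eps &
      {ae leb1, forall t, `[0, T]%classic t -> eps <= sigma t <= eps^-1}].

Definition divergence_control I f (divf : R -> E -> R) :=
  [/\ divergence_field I f divf, L1Lq_loc I 1%:E divf &
      negpart_L1Linf I divf].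

Definition initial_density (p0 : E -> R) :=
  [/\ measurable_fun [set: E] p0 /\ (forall x, 0 <= p0 x),
      (\int[lebesgue_rV d]_x (p0 x)%:E = 1)%E,
      (LpNorm (lebesgue_rV d) +oo [set: E] p0 < +oo)%E,
      (\int[lebesgue_rV d]_x (enorm x ^+ 2 * p0 x)%:E < +oo)%E &
      (\int[lebesgue_rV d]_x (p0 x * ln (p0 x))%:E < +oo)%E].

Definition narrowly_continuous I p :=
  forall phi : E -> R, continuous phi ->
  (exists M : R, forall x, `|phi x| <= M) ->
  {within I, continuous (fun t => \int[lebesgue_rV d]_x (phi x * p t x))}.

Definition density_regularity I p :=
  [/\ joint_measurable I p,
      forall t, I t -> {ae lebesgue_rV d, forall x, 0 < p t x},
      exists M : R, {ae leb1, forall t, I t ->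
        (LpNorm (lebesgue_rV d) 1%:E [set: E] (p t) +
         LpNorm (lebesgue_rV d) +oo [set: E] (p t) <= M%:E)%E},
      (ereal_sup [set \int[lebesgue_rV d]_x (enorm x ^+ 2 * p t x)%:E
                 | t in I] < +oo)%E &
      narrowly_continuous I p].

(* sc is nabla log p and H, its weak Jacobian, is nabla^2 log p. *)
Definition score_regularity I p (sc : R -> E -> E) (H : R -> E -> 'M[R]_d) :=
  [/\ joint_measurable I sc,
      {ae leb1, forall t, I t -> weak_grad (fun x => ln (p t x)) (sc t)},
      jacobian_field I sc H,
      L1Lq_loc I 1%:E (fun t x => enorm (sc t x)) &
      L1Lq_loc I 1%:E (fun t x => enorm (H t x))].

(* \tr (H t x) is the Laplacian of log p_t at x. *)
Definition laplacian_upper_bound I (H : R -> E -> 'M[R]_d) (Lambda : R -> R) :=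
  leb1.-integrable I (EFin \o Lambda) /\
  {ae leb1, forall t, I t ->
    (LpNorm (lebesgue_rV d) +oo [set: E] (pospart (fun x => \tr (H t x)))
     <= (Lambda t)%:E)%E}.

Definition score_growth I (sc : R -> E -> E) (A : R -> R) :=
  leb1.-integrable I (EFin \o A) /\
  {ae leb1, forall t, I t -> {ae lebesgue_rV d, forall x,
    enorm (sc t x) <= A t * (1 + enorm x)}}.

End assumptions.

Section flows.
Context {R : realType} {d : nat}.
Local Notation E := 'rV[R]_d.

Definition absolutely_continuous_on (a b : R) (g : R -> E) :=
  forall e : R, 0 < e -> exists2 del : R, 0 < del &
  forall s : seq (R * R),
    all (fun k => [&& a <= k.1, k.1 <= k.2 & k.2 <= b]) s ->
    pairwise (fun k l => k.2 <= l.1) s ->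
    \sum_(k <- s) (k.2 - k.1) < del ->
    \sum_(k <- s) enorm (g k.2 - g k.1) < e.

(* Regular Lagrangian flow of v on [a,b] with compressibility constant L.  The
   normalisation Z(a,x) = x is the integral equation at t = a. *)
Definition regular_lagrangian_flow (a b : R) (v : R -> E -> E) (L : R)
    (Z : R -> E -> E) :=
  [/\ forall t, `[a, b]%classic t -> measurable_fun [set: E] (Z t),
      {ae lebesgue_rV d, forall x,
        [/\ absolutely_continuous_on a b (fun t => Z t x),
            forall i, leb1.-integrable `[a, b]
              (fun s => (v s (Z s x) ord0 i)%:E) &
            forall t, `[a, b]%classic t ->
              Z t x = x + vint `[a, t] (fun s => v s (Z s x))]} &
      forall t, `[a, b]%classic t -> forall B : set E, measurable B ->
        (pushforward (lebesgue_rV d) (Z t) B <= L%:E * lebesgue_rV d B)%E].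

Definition compressibility (T : R) (I : set R) (sigma : R -> R)
    (divf : R -> E -> R) (Lambda : R -> R) : R :=
  expR (\int[leb1]_(t in I)
    (fine (LpNorm (lebesgue_rV d) +oo [set: E] (negpart (divf t))) +
     2^-1 * fine (LpNorm leb1 +oo `[0%R, T] sigma) ^+ 2 * Lambda t)).

Definition compressibility_learned (I : set R) (divvt : R -> E -> R) : R :=
  expR (\int[leb1]_(t in I)
    fine (LpNorm (lebesgue_rV d) +oo [set: E] (negpart (divvt t)))).

Definition L1norm (I : set R) (g : R -> R) : R := \int[leb1]_(t in I) `|g t|.

Definition growth_rate (eps : R) (Cf A : R -> R) (t : R) : R :=
  Cf t + 2^-1 * eps ^- 2 * A t.

Definition flow_radius (I : set R) (r : R) (G Gt : R -> R) : R :=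
  (1 + r) * expR (L1norm I G + L1norm I Gt).

Definition field_error (I : set R) (r : R) (v vt : R -> E -> E) : R :=
  \int[(leb1 \x lebesgue_rV d)%E]_(z in I `*` eball r) enorm (v z.1 z.2 - vt z.1 z.2).

(* Under the assumptions of the theorem the norms to which fine is applied here
   and in the constants above are finite, for a.e. time. *)
Definition gradient_term (C L Lt q q' : R) (I : set R) (r : R)
    (Dv : R -> E -> 'M[R]_d) : R :=
  C * (L + Lt) * fine (lebesgue_rV d (eball r)) `^ q'^-1 *
  \int[leb1]_(s in I)
    fine (LpNorm (lebesgue_rV d) q%:E (eball (3 * r)) (fun x => enorm (Dv s x))).

Definition bad_set (r T eta : R) (Z Zt : R -> E -> E) : set E :=
  eball r `&` [set x | eta < enorm (Z T x - Zt T x)].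

(* The bound of the stability estimate with lambda = sqrt e and field error e. *)
Definition log_rate (Cq Lt eta e : R) : R :=
  (Cq + Lt * Num.sqrt e) / ln (1 + eta * e `^ (- 2^-1)).

End flows.

(* Main.v *)
Require Import Defs.
From HB Require Import structures.
From mathcomp Require Import all_boot all_order all_algebra.
From mathcomp Require Import all_classical all_reals all_analysis.
From mathcomp Require Import measurable_realfun zify ring lra.
Import Order.TTheory GRing.Theory Num.Theory.
Import numFieldNormedType.Exports.
Local Open Scope classical_set_scope.
Local Open Scope ring_scope.
(** The method is that of Crippa and De Lellis.  Sobolev fields are Lipschitz in
    the Lusin sense: [|v x - v y| <= |x - y| (M x + M y)], where [M] is a maximal
    function of [|Dv|], and by the weak type inequality the integral of [M] over a
    ball is at most [C |B|^(1/q') |Dv|_q].  Along two trajectories issued from [x],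
    put [D t = |Z t x - Zt t x|].  Then
      [d/dt ln (1 + D / lambda) <= M (Z t x) + M (Zt t x)
                                    + |v - vt| (Zt t x) / lambda].
    Linear growth and Gronwall's inequality keep the trajectories starting in
    [B_r] inside [B_R].  Integrating in [x] over [B_r] and replacing [Z t x] and
    [Zt t x] by a space variable costs the compressibility constants, which bounds
    the integral of [ln (1 + D T / lambda)]; Markov's inequality concludes. *)

(** Weak derivatives are only tested against smooth functions, so everything starts from boxes:
    products of bumps approximate indicators of half-open boxes, and the averages of [u] over
    adjacent boxes differ by an integral of [|g|]. Walks from cube to cube compare averages at
    different points and scales; their limit is [u] because both have the same integrals over dyadic
    cubes.

    The maximal operator is not bounded on L^1, and [1 < q] enters there: the weak type (q, q) bound
    is summed over the levels [2^j a] with ratio [2^(1-q) < 1], and the best [a] produces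
    [|B|^(1/q')]. The radius [3 R] is that of a ball containing every cube used to compare two
    points of [B_R].

    [Dv] is an arbitrary measurable weak Jacobian of [v], and [fine] and real integrals have a
    default value at infinity. The gradient term and the field error are therefore proved finite,
    the former by uniqueness of weak derivatives, which expresses [Dv] through the Jacobians of [f]
    and of the score.

    A flow is only measurable in [x] at each fixed time; continuity of trajectories provides the
    jointly measurable version that Tonelli's theorem asks for. *)

Set Implicit Arguments.
Unset Strict Implicit.
Unset Printing Implicit Defensive.

(** * Test functions *)

Section smooth_functions.
Context {R : realType}.
Implicit Types (f g : R -> R) (k m : nat) (x : R).

(** Regularity of order [k] on the line. The derivative is an existential witness, so that closure
    under sums, products and affine changes of variable goes by induction on [k]. *)
Fixpoint smooth1 k f : Prop :=
  if k is k'.+1 then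
    exists2 f' : R -> R, (forall x, is_derive x 1 f (f' x)) & smooth1 k' f'
  else continuous f.

Lemma is_derive_continuous f f' :
  (forall x, is_derive x 1 f (f' x)) -> continuous f.
Proof.
move=> df x; apply: differentiable_continuous; apply/derivable1_diffP.
exact: (@ex_derive _ _ _ _ _ _ _ (df x)).
Qed.

Lemma smooth1_continuous k f : smooth1 k f -> continuous f.
Proof. by case: k => [//|k] [f' df _]; exact: is_derive_continuous df. Qed.

Lemma smooth1W k f : smooth1 k.+1 f -> smooth1 k f.
Proof.
elim: k f => [|k IHk] f [f' df sf]; first exact: is_derive_continuous df.
by exists f' => //; exact: IHk.
Qed.

Lemma smooth1D k f g :
  smooth1 k f -> smooth1 k g -> smooth1 k (fun x => f x + g x).
Proof.
elim: k f g => [|k IHk] f g /=.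
  by move=> cf cg x; apply: cvgD; [exact: cf|exact: cg].
move=> [f' df sf] [g' dg sg]; exists (fun x => f' x + g' x); last exact: IHk.
by move=> x; exact: is_deriveD.
Qed.

Lemma smooth1M k f g :
  smooth1 k f -> smooth1 k g -> smooth1 k (fun x => f x * g x).
Proof.
elim: k f g => [|k IHk] f g.
  by move=> /= cf cg x; apply: cvgM; [exact: cf|exact: cg].
move=> sf sg; have sf0 := smooth1W sf; have sg0 := smooth1W sg.
case: sf sg => [f' df sf] [g' dg sg].
exists (fun x => f x * g' x + g x * f' x).
  by move=> x; exact: (@is_deriveM _ _ f g).
by apply: smooth1D; exact: IHk.
Qed.

Lemma smooth1_cst k (c : R) : smooth1 k (cst c).
Proof.
elim: k c => [|k IHk] c /=; first by move=> x; exact: cvg_cst.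
by exists (cst 0) => // x; exact: is_derive_cst.
Qed.

Lemma smooth1_affine k f (a b : R) :
  smooth1 k f -> smooth1 k (fun x => f (a * x + b)).
Proof.
elim: k f => [|k IHk] f /=.
  move=> cf x; apply: (@continuous_comp _ _ _ (fun x => a * x + b)); last exact: cf.
  by apply: cvgD; [apply: cvgM; [exact: cvg_cst|exact: cvg_id]|exact: cvg_cst].
move=> [f' df sf]; exists (fun x => f' (a * x + b) * a); last first.
  by apply: smooth1M; [exact: IHk|exact: smooth1_cst].
move=> x; apply: (@is_derive1_comp _ f (fun x => a * x + b)).
apply: is_derive_eq.
by rewrite /GRing.scale /= mulr1 addr0.
Qed.

(* The span of the x^-m e^(-1/x) is stable under differentiation. *)
Definition flat m x : R := if 0 < x then x^-1 ^+ m * expR (- x^-1) else 0.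

Lemma flat_ge0 m x : 0 <= flat m x.
Proof.
rewrite /flat; case: ifPn => // x0.
by rewrite mulr_ge0 ?expR_ge0// exprn_ge0// invr_ge0 ltW.
Qed.

(** With [y = x^-1], the term of degree m+2 of the exponential series is below [expR y]. The
    exponent 2 on the right is what makes the difference quotient of [flat m] vanish at [0]. *)
Lemma flat_le_sqr m x : flat m x <= (m.+2)`!%:R * x ^+ 2.
Proof.
rewrite /flat; case: ifPn => x0; last first.
  by rewrite mulr_ge0// sqr_ge0.
have y0 : 0 < x^-1 by rewrite invr_gt0.
have := @expR_ge1Dxn R x^-1 m.+1 (ltW y0).
rewrite expRN => h.
have h2 : x^-1 ^+ m.+2 / (m.+2)`!%:R <= expR x^-1.
  by apply: le_trans h; rewrite lerDr.
rewrite ler_pdivrMr ?expR_gt0//.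
have xx : x^-1 ^+ m = x ^+ 2 * x^-1 ^+ m.+2.
  rewrite !exprS; move: (x^-1 ^+ m) => z; rewrite expr0.
  by field; rewrite gt_eqF.
rewrite xx (mulrC _%:R) -(mulrA (x ^+ 2)) ler_pM2l ?exprn_gt0// mulrC.
by rewrite -ler_pdivrMr// ltr0n fact_gt0.
Qed.

(** Away from [0] this is calculus on x^-m e^(-1/x); at [0] the difference quotient is at most a
    constant times [|h|] by [flat_le_sqr]. *)
Lemma is_derive_flat m x :
  is_derive x 1 (flat m) (flat m.+2 x - m%:R * flat m.+1 x).
Proof.
have [x0|x0|->] := ltgtP x 0.
- apply: (@near_eq_is_derive _ _ _ (cst 0)).
    near=> y; rewrite /flat ifF//; apply/negbTE; rewrite -leNgt ltW//.
    by near: y; exact: lt_nbhsl.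
  have xF : (0 < x) = false by apply/negbTE; rewrite -leNgt ltW.
  by rewrite /flat xF mulr0 subr0; exact: is_derive_cst.
- apply: (@near_eq_is_derive _ _ _ (fun y : R => y^-1 ^+ m * expR (- y^-1) : R)).
    by near=> y; rewrite /flat ifT//; near: y; exact: lt_nbhsr.
  have xn0 : x != 0 by rewrite gt_eqF.
  have dV : is_derive x 1 (fun y : R => y^-1) (- x ^- 2).
    apply: is_derive_eq; first exact: (@is_deriveV _ id).
    by rewrite /GRing.scale/= mulr1.
  have dX : is_derive x 1 (fun y : R => y^-1 ^+ m)
      (m%:R * x^-1 ^+ m.-1 * (- x ^- 2)).
    by have := is_deriveX m dV; rewrite exprfctE.
  have dE : is_derive x 1 (expR \o (fun y => - y^-1)) (expR (- x^-1) * x ^- 2).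
    by apply: is_derive1_comp; apply: is_derive_eq; rewrite opprK.
  have dP := @is_deriveM _ _ (fun y : R => y^-1 ^+ m) _ _ _ _ _ dX dE.
  apply: (@is_derive_eq _ _ _ _ _ _ _ _ dP).
  rewrite /flat x0 /GRing.scale/=; move: (expR _) => E.
  case: m {dX dP} => [|m] /=; rewrite !exprS; last move: (x^-1 ^+ m) => Y.
    by rewrite !expr0; field.
  by rewrite !expr0; field.
- rewrite {2 3}/flat !ltxx mulr0 subr0.
  have lim0 : h^-1 *: (flat m (h *: 1 + 0) - flat m 0) @[h --> 0^'] --> (0 : R).
    apply/cvgr0Pnorm_le => e e0.
    have e'0 : 0 < e / (m.+2)`!%:R by rewrite divr_gt0// ltr0n fact_gt0.
    near=> h.
    have h0 : h != 0 by near: h; exact: nbhs_dnbhs_neq.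
    have he : `|h| < e / (m.+2)`!%:R by near: h; exact: dnbhs0_lt.
    rewrite addr0 /GRing.scale/= mulr1 {2}/flat ltxx subr0 normrM normfV.
    rewrite ler_pdivrMl ?normr_gt0// (ger0_norm (flat_ge0 _ _)).
    apply: (le_trans (flat_le_sqr _ _)); rewrite -real_normK ?num_real// expr2.
    rewrite mulrCA ler_wpM2l// mulrC -ler_pdivlMr ?ltW// ltr0n fact_gt0//.
  apply: DeriveDef; first exact: (cvgP _ lim0).
  exact: (cvg_lim _ lim0).
Unshelve. all: by end_near. Qed.

Lemma smooth1_flat k m : smooth1 k (flat m).
Proof.
elim: k m => [|k IHk] m /=; first exact: is_derive_continuous (is_derive_flat m).
exists (fun x => flat m.+2 x - m%:R * flat m.+1 x); first exact: is_derive_flat.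
have -> : (fun x => flat m.+2 x - m%:R * flat m.+1 x) =
  (fun x => flat m.+2 x + cst (- m%:R) x * flat m.+1 x).
  by apply/funext => x; rewrite mulNr.
apply: smooth1D; first exact: IHk.
by apply: smooth1M; [exact: smooth1_cst|exact: IHk].
Qed.
End smooth_functions.

Section sbumps.
Context {R : realType}.
Implicit Types (a b s x y : R) (n k : nat).

Lemma flat0E y : flat 0 y = if 0 < y then expR (- y^-1) else 0.
Proof. by rewrite /flat expr0 mul1r. Qed.

Lemma flat0_le1 y : flat 0 y <= 1.
Proof.
rewrite flat0E; case: ifPn => // y0.
by rewrite -expR0 ler_expR oppr_le0 invr_ge0 ltW.
Qed.

Lemma flat0_cvg1 (u : nat -> R) : u n @[n --> \oo] --> +oo ->
  flat 0 (u n) @[n --> \oo] --> (1 : R).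
Proof.
move/cvgryPge => uoo; apply/cvgrPdist_le => e e0; near=> n.
have un : e^-1 <= u n by near: n; exact: uoo.
have u0 : 0 < u n by rewrite (lt_le_trans _ un)// invr_gt0.
rewrite flat0E u0 ger0_norm; last first.
  by rewrite subr_ge0 -expR0 ler_expR oppr_le0 invr_ge0 ltW.
have := @expR_ge1Dx R (- (u n)^-1).
have : (u n)^-1 <= e by rewrite -(invrK e) lef_pV2// posrE invr_gt0.
lra.
Unshelve. all: by end_near. Qed.

(* The shifts by 1/(n+1) make the limit as n grows the indicator of [a, b[ at
   every point, endpoints included. *)
Definition sbump n a b x : R :=
  flat 0 (n.+1%:R ^+ 2 * (x - a) + n.+1%:R) *
  flat 0 (n.+1%:R ^+ 2 * (b - x) - n.+1%:R).

Lemma smooth1_bump k n a b : smooth1 k (sbump n a b).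
Proof.
apply: smooth1M.
  rewrite (_ : (fun _ => _) = fun x =>
    flat 0 (n.+1%:R ^+ 2 * x + (n.+1%:R - n.+1%:R ^+ 2 * a))).
    exact/smooth1_affine/smooth1_flat.
  by apply/funext => x; congr (flat _ _); ring.
rewrite (_ : (fun _ => _) = fun x =>
    flat 0 (- n.+1%:R ^+ 2 * x + (n.+1%:R ^+ 2 * b - n.+1%:R))).
  exact/smooth1_affine/smooth1_flat.
by apply/funext => x; congr (flat _ _); ring.
Qed.

Lemma bump_ge0 n a b x : 0 <= sbump n a b x.
Proof. by rewrite mulr_ge0// flat_ge0. Qed.

Lemma bump_le1 n a b x : sbump n a b x <= 1.
Proof. by rewrite mulr_ile1 ?flat_ge0 ?flat0_le1. Qed.

Lemma bump_eq0l n a b x : x <= a - n.+1%:R^-1 -> sbump n a b x = 0.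
Proof.
move=> xa; rewrite /sbump flat0E ifF ?mul0r//; apply/negbTE; rewrite -leNgt.
have n0 : 0 < n.+1%:R :> R by rewrite ltr0n.
have : n.+1%:R ^+ 2 * (x - a) <= n.+1%:R ^+ 2 * - n.+1%:R^-1.
  by rewrite ler_pM2l ?exprn_gt0// lerBlDr addrC.
have nn : n.+1%:R ^+ 2 * n.+1%:R^-1 = n.+1%:R :> R by field; rewrite ?gt_eqF.
by rewrite mulrN nn -lerBrDr sub0r.
Qed.

Lemma bump_eq0r n a b x : b - n.+1%:R^-1 <= x -> sbump n a b x = 0.
Proof.
move=> xb; rewrite /sbump [X in _ * X]flat0E ifF ?mulr0//; apply/negbTE.
rewrite -leNgt.
have n0 : 0 < n.+1%:R :> R by rewrite ltr0n.
have : n.+1%:R ^+ 2 * (b - x) <= n.+1%:R ^+ 2 * n.+1%:R^-1.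
  by rewrite ler_pM2l ?exprn_gt0// lerBlDr addrC -lerBlDr.
have nn : n.+1%:R ^+ 2 * n.+1%:R^-1 = n.+1%:R :> R by field; rewrite ?gt_eqF.
by rewrite nn subr_le0.
Qed.

Lemma bump_le_indic n a b x : sbump n a b x <= \1_(`[a - 1, b]) x.
Proof.
rewrite indicE mem_setE in_itv/=.
have n1 : n.+1%:R^-1 <= 1 :> R by rewrite invf_le1 ?ltr0n// ler1n.
have n0 : 0 <= n.+1%:R^-1 :> R by rewrite invr_ge0.
have [xa|xa] := leP (a - 1) x; last first.
  by rewrite bump_eq0l// (le_trans (ltW xa))// lerD2l lerN2.
have [xb|xb] := leP x b; first exact: bump_le1.
by rewrite bump_eq0r// (le_trans _ (ltW xb))// gerBl.
Qed.

Lemma bump_cvg a b x : sbump n a b x @[n --> \oo] --> (\1_(`[a, b[) x : R).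
Proof.
have noo : forall A : R, \forall n \near \oo, A <= (n.+1%:R : R).
  move=> A; near=> n; apply: (@le_trans _ _ n%:R); last by rewrite ler_nat.
  by near: n; exact: nbhs_infty_ger.
rewrite indicE mem_setE in_itv/=.
have [xa|ax] := ltP x a => /=.
  apply: cvg_near_cst; near=> n; apply: bump_eq0l.
  have an : (a - x)^-1 <= n.+1%:R by near: n; exact: noo.
  have : n.+1%:R^-1 <= a - x.
    by rewrite -(invrK (a - x)) lef_pV2// posrE ?ltr0n// invr_gt0 subr_gt0.
  by rewrite !lerBrDr addrC.
have [xb|bx] := ltP x b => /=; last first.
  apply: cvg_near_cst; near=> n; apply: bump_eq0r.
  by rewrite (le_trans _ bx)// gerBl invr_ge0.
rewrite -[X in _ --> X]mulr1; apply: cvgM; apply: flat0_cvg1; apply/cvgryPge => A.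
  near=> n; apply: (@le_trans _ _ n.+1%:R); first by near: n; exact: noo.
  by rewrite lerDr mulr_ge0 ?exprn_ge0// subr_ge0.
near=> n; apply: (@le_trans _ _ n.+1%:R); first by near: n; exact: noo.
(* Then [n.+1%:R * (b - x) >= 2], so the subtracted [n.+1%:R] costs at most half of
   [n.+1%:R ^+ 2 * (b - x)]. *)
have bn : 2 * (b - x)^-1 <= n.+1%:R by near: n; exact: noo.
have : 2 <= n.+1%:R * (b - x) by rewrite -ler_pdivrMr// subr_gt0.
by have : 0 < n.+1%:R :> R by []; nra.
Unshelve. all: by end_near. Qed.

Lemma continuous_bump n a b : continuous (sbump n a b).
Proof. exact: (smooth1_continuous (smooth1_bump 0 n a b)). Qed.

Lemma measurable_bump n a b : measurable_fun setT (sbump n a b).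
Proof. by apply: measurable_realfun.continuous_measurable_fun; exact: continuous_bump. Qed.

Lemma bump_primitive n a b :
  exists F : R -> R, forall x, is_derive x 1 F (sbump n a b x).
Proof.
exists (fun x => \int[leb1]_(t in [set` Interval -oo%O (BRight x)]) sbump n a b t).
move=> x; have xu : x < x + 1 by rewrite ltrDl.
have ib : leb1.-integrable [set` Interval -oo%O (BRight (x + 1))]
    (EFin \o sbump n a b).
  apply: (@le_integrable _ _ R leb1 _ _ _ (EFin \o (\1_(`[a - 1, b]%classic) : R -> R))) => //.
  - by apply/measurable_EFinP; apply: measurable_funTS; exact: measurable_bump.
  - move=> t _ /=; rewrite lee_fin ger0_norm ?bump_ge0// ger0_norm//.
    exact: bump_le_indic.
  - by apply: (@integrableS _ _ _ _ setT) => //; exact: integrable_indic_itv.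
have [|dF FE] := continuous_FTC1 xu ib _ (@continuous_bump n a b x).
  by rewrite /Order.lt /=.
by apply: (DeriveDef dF); rewrite -derive1E; exact: FE.
Qed.

(** The tent is the integral of a bump over the window [[x - s, x]]. Translating the bump of [[a, a
    + s[] by [s] gives that of the next interval, hence the derivative; the mean value theorem
    writes [F x] as [s] times a value of the bump in the window, hence the height and the
    support. *)
Lemma tent n a s : 0 < s -> exists F : R -> R,
  [/\ forall k, smooth1 k F,
      forall x, is_derive x 1 F (sbump n a (a + s) x - sbump n (a + s) (a + s + s) x),
      forall x, `|F x| <= s &
      forall x, ~ (a - n.+1%:R^-1 <= x < a + s + s) -> F x = 0].
Proof.
move=> s0; have [P dP] := bump_primitive n a (a + s).
pose F x := P x - P (x - s).
have dF x : is_derive x 1 F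
    (sbump n a (a + s) x - sbump n (a + s) (a + s + s) x).
  apply: is_deriveB.
  have -> : sbump n (a + s) (a + s + s) x = sbump n a (a + s) (x - s) * 1.
    by rewrite /sbump mulr1; congr (flat _ _ * flat _ _); ring.
  apply: (@is_derive1_comp _ P (fun x => x - s)).
  exact: is_derive_shift.
have mvt x : exists2 c, x - s < c < x & F x = sbump n a (a + s) c * s.
  have xs : x - s < x by rewrite gtrBl.
  have cP : {within `[x - s, x], continuous P}.
    by apply: continuous_subspaceT; exact: (is_derive_continuous dP).
  have [c cx e] := MVT xs (fun y _ => dP y) cP.
  by exists c; [move: cx; rewrite in_itv|rewrite /F e; congr (_ * _); ring].
exists F; split => //.
- case=> [|k]; first exact: (is_derive_continuous dF).
  exists (fun x => sbump n a (a + s) x + cst (-1) x * sbump n (a + s) (a + s + s) x).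
    by move=> x; rewrite /cst mulN1r.
  apply: smooth1D; first exact: smooth1_bump.
  by apply: smooth1M; [exact: smooth1_cst|exact: smooth1_bump].
- move=> x; have [c _ ->] := mvt x.
  by rewrite normrM (ger0_norm (bump_ge0 _ _ _ _)) (gtr0_norm s0) ger_pMl// bump_le1.
move=> x xN; have [c /andP[c1 c2] ->] := mvt x.
have [xa|xa] := ltP x (a - n.+1%:R^-1); first by rewrite bump_eq0l ?mul0r// (le_trans (ltW c2))// ltW.
have [xb|xb] := ltP x (a + s + s); first by exfalso; apply: xN; rewrite xa.
rewrite bump_eq0r ?mul0r// (le_trans _ (ltW c1))// (@le_trans _ _ (a + s))//.
  by rewrite gerBl.
by rewrite lerBrDr.
Qed.
End sbumps.

(** * Euclidean norm of vectors and matrices *)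

Section euclidean_norm.
Context {R : realType} {m n : nat}.
Implicit Types A B : 'M[R]_(m, n).

Definition edot A B : R := \sum_i \sum_j A i j * B i j.

Lemma edotDl A B C : edot (A + B) C = edot A C + edot B C.
Proof.
rewrite /edot -big_split; apply: eq_bigr => i _; rewrite -big_split.
by apply: eq_bigr => j _; rewrite !mxE mulrDl.
Qed.

Lemma edotZl c A B : edot (c *: A) B = c * edot A B.
Proof.
rewrite /edot mulr_sumr; apply: eq_bigr => i _; rewrite mulr_sumr.
by apply: eq_bigr => j _; rewrite !mxE mulrA.
Qed.

Lemma edot0l B : edot 0 B = 0.
Proof. by rewrite /edot big1// => i _; rewrite big1// => j _; rewrite mxE mul0r. Qed.

Lemma edotC A B : edot A B = edot B A.
Proof. by apply: eq_bigr => i _; apply: eq_bigr => j _; rewrite mulrC. Qed.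

Lemma edot_ge0 A : 0 <= edot A A.
Proof. by apply: sumr_ge0 => i _; apply: sumr_ge0 => j _; rewrite -expr2 sqr_ge0. Qed.

Lemma enorm_edot A : enorm A = Num.sqrt (edot A A).
Proof.
by congr Num.sqrt; apply: eq_bigr => i _; apply: eq_bigr => j _; rewrite expr2.
Qed.

Lemma enorm_sqr A : enorm A ^+ 2 = edot A A.
Proof. by rewrite enorm_edot sqr_sqrtr// edot_ge0. Qed.

Lemma enorm_ge0 A : 0 <= enorm A.
Proof. by rewrite sqrtr_ge0. Qed.

Lemma enorm_entry A i j : `|A i j| <= enorm A.
Proof.
rewrite -(@ler_pXn2r _ 2)// ?nnegrE ?enorm_ge0// enorm_sqr real_normK ?num_real//.
rewrite /edot (bigD1 i)//= (bigD1 j)//= -expr2 -addrA lerDl addr_ge0//.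
  by apply: sumr_ge0 => k _; rewrite -expr2 sqr_ge0.
by apply: sumr_ge0 => k _; apply: sumr_ge0 => l _; rewrite -expr2 sqr_ge0.
Qed.

Lemma enorm_eq0 A : enorm A = 0 -> A = 0.
Proof.
move=> A0; apply/matrixP => i j; rewrite mxE; apply/eqP; rewrite -normr_le0.
by rewrite -A0 enorm_entry.
Qed.

Lemma enorm0 : enorm (0 : 'M[R]_(m, n)) = 0.
Proof.
rewrite enorm_edot /edot big1 ?sqrtr0// => i _; rewrite big1// => j _.
by rewrite mxE mul0r.
Qed.

(** Cauchy-Schwarz: expand the square of the difference of the two normalised matrices, which is
    nonnegative. *)
Lemma edot_le A B : edot A B <= enorm A * enorm B.
Proof.
have [/enorm_eq0 -> |A0] := eqVneq (enorm A) 0.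
  by rewrite enorm0 mul0r edot0l.
have a0 : 0 < enorm A by rewrite lt_neqAle eq_sym A0 enorm_ge0.
have [/enorm_eq0 -> |B0] := eqVneq (enorm B) 0.
  by rewrite enorm0 mulr0 edotC edot0l.
have b0 : 0 < enorm B by rewrite lt_neqAle eq_sym B0 enorm_ge0.
have := edot_ge0 ((enorm A)^-1 *: A + (- (enorm B)^-1) *: B).
rewrite edotDl !edotZl !(edotC _ (_ + _)) !edotDl !edotZl -!enorm_sqr (edotC B A).
move: (enorm A) (enorm B) A0 B0 a0 b0 (edot A B) => x y x0 y0 xp yp t h.
have E : x^-1 * (x^-1 * x ^+ 2 + - y^-1 * t) +
     - y^-1 * (x^-1 * t + - y^-1 * y ^+ 2) = 2 - 2 * t / (x * y).
  by field; rewrite x0 y0.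
rewrite E subr_ge0 ler_pdivrMr ?mulr_gt0// in h.
by rewrite ler_pM2l in h.
Qed.

Lemma enormD A B : enorm (A + B) <= enorm A + enorm B.
Proof.
rewrite -(@ler_pXn2r _ 2)// ?nnegrE ?addr_ge0 ?enorm_ge0//.
rewrite enorm_sqr edotDl !(edotC _ (_ + _)) !edotDl -!enorm_sqr (edotC B A).
have := edot_le A B; rewrite sqrrD; lra.
Qed.

Lemma enormZ c A : enorm (c *: A) = `|c| * enorm A.
Proof.
rewrite !enorm_edot edotZl edotC edotZl mulrA -expr2 sqrtrM ?sqr_ge0//.
by rewrite sqrtr_sqr.
Qed.

Lemma enormN A : enorm (- A) = enorm A.
Proof. by rewrite -scaleN1r enormZ normrN1 mul1r. Qed.

Lemma enormB A B : enorm (A - B) <= enorm A + enorm B.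
Proof. by rewrite (le_trans (enormD _ _))// enormN. Qed.

Lemma enorm_distC A B : enorm (A - B) = enorm (B - A).
Proof. by rewrite -opprB enormN. Qed.

Lemma enorm_le_sum A : enorm A <= \sum_i \sum_j `|A i j|.
Proof.
have s0 : 0 <= \sum_i \sum_j `|A i j|.
  by apply: sumr_ge0 => i _; apply: sumr_ge0 => j _.
rewrite -(@ler_pXn2r _ 2)// ?nnegrE ?enorm_ge0// enorm_sqr expr2 mulr_suml /edot.
apply: ler_sum => i _; rewrite mulr_suml; apply: ler_sum => j _.
rewrite -expr2 -[leLHS]real_normK ?num_real// expr2 ler_wpM2l//.
rewrite (bigD1 i)//= (bigD1 j)//= -addrA lerDl addr_ge0//; first exact: sumr_ge0.
by apply: sumr_ge0 => k _; exact: sumr_ge0.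
Qed.

End euclidean_norm.

(** * Test functions of several variables as products *)

Section tensor.
Context {R : realType} {d : nat}.
Local Notation E := 'rV[R]_d.
Implicit Types (F G : 'I_d -> R -> R) (i j : 'I_d) (x : E).

Definition tensor F x : R := \prod_j F j (x ord0 j).

Definition subst F i (h : R -> R) j : R -> R := if j == i then h else F j.

Lemma tensor_subst F i (h : R -> R) x :
  tensor (subst F i h) x = h (x ord0 i) * \prod_(j | j != i) F j (x ord0 j).
Proof.
rewrite /tensor (bigD1 i)//= /subst eqxx; congr (_ * _).
by apply: eq_bigr => j /negbTE ->.
Qed.

Lemma subst_id F i : subst F i (F i) = F.
Proof. by apply/funext => j; rewrite /subst; case: eqP => [->|]. Qed.

Lemma is_derive_tensor F i (f' : R -> R) x :
  (forall y : R, is_derive y 1 (F i) (f' y)) ->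
  is_derive x (delta_mx ord0 i) (tensor F) (tensor (subst F i f') x).
Proof.
move=> dF; rewrite tensor_subst mulrC; set c := \prod_(_ | _) _.
have dFx := dF (x ord0 i).
have lim1 : h^-1 *: (F i (h *: 1 + x ord0 i) - F i (x ord0 i)) @[h --> 0^'] -->
    (f' (x ord0 i) : R).
  rewrite -(@derive_val _ _ _ _ _ _ _ dFx).
  exact: (@ex_derive _ _ _ _ _ _ _ dFx).
have lim2 : h^-1 *: (tensor F (h *: delta_mx ord0 i + x) - tensor F x)
    @[h --> 0^'] --> (c * f' (x ord0 i) : R).
  rewrite (_ : (fun _ => _) = fun h => c * (h^-1 *: (F i (h *: 1 + x ord0 i) - F i (x ord0 i)))).
    by apply: cvgM => //; exact: cvg_cst.
  apply/funext => h; rewrite -{1 2}(subst_id F i) !tensor_subst.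
  rewrite (_ : \prod_(_ | _) _ = c).
    by rewrite -mulrBl !mxE !eqxx/= /GRing.scale/=; ring.
  apply: eq_bigr => j ji; rewrite !mxE (negbTE ji) andbF.
  by rewrite mulr0 add0r.
apply: DeriveDef; first exact: (cvgP _ lim2).
exact: (cvg_lim _ lim2).
Qed.

Lemma continuous_tensor F : (forall j, continuous (F j)) -> continuous (tensor F).
Proof.
move=> cF x; have FF : Filter (nbhs x) by exact: nbhs_filter.
apply: (@cvg_big _ _ _ _ _ (@mul_continuous R) _ (nbhs x)) => j _.
apply: (@continuous_comp _ _ _ (fun x : E => x ord0 j)); last exact: cF.
exact: coord_continuous.
Qed.

(** A partial derivative of a tensor is the tensor with one factor differentiated, so the class is
    stable and the induction on the order goes through. *)
Lemma tensor_Ck k F : (forall k j, smooth1 k (F j)) -> Ck k (tensor F).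
Proof.
elim: k F => [|k IHk] F sF; split => //.
- by apply: continuous_tensor => j; exact: (smooth1_continuous (sF 0 j)).
- by apply: continuous_tensor => j; exact: (smooth1_continuous (sF 0 j)).
move=> i; have [f' df _] := sF 1 i.
(* Each order comes with its own witness of the derivative; they all coincide because a derivative
   is unique. *)
have sf' l : smooth1 l f'.
  have [f'' df' sf''] := sF l.+1 i; congr (smooth1 l _): sf''.
  apply/funext => y.
  by rewrite -(@derive_val _ _ _ _ _ _ _ (df y)) (@derive_val _ _ _ _ _ _ _ (df' y)).
split; first by move=> x; exact: (@ex_derive _ _ _ _ _ _ _ (is_derive_tensor x df)).
rewrite (_ : partial i _ = tensor (subst F i f')).
  by apply: IHk => l j; rewrite /subst; case: eqP.
by apply/funext => x; exact: (@derive_val _ _ _ _ _ _ _ (is_derive_tensor x df)).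
Qed.

Lemma partial_tensor F i (f' : R -> R) : (forall y : R, is_derive y 1 (F i) (f' y)) ->
  partial i (tensor F) = tensor (subst F i f').
Proof.
by move=> dF; apply/funext => x;
  exact: (@derive_val _ _ _ _ _ _ _ (is_derive_tensor x dF)).
Qed.

Lemma tensor_test F (K : R) : (forall k j, smooth1 k (F j)) ->
  (forall j y, K < `|y| -> F j y = 0) -> test_function (tensor F).
Proof.
move=> sF FK; split; first by move=> k; exact: tensor_Ck.
exists [set x : E | forall i, `[- K, K]%classic (x ord0 i)].
  apply: (@rV_compact R d (fun=> `[- K, K]%classic)) => i; exact: segment_compact.
move=> x xK; have [j xj] : exists j, ~ (`[- K, K]%classic (x ord0 j)).
  by apply/existsNP.
rewrite /tensor (bigD1 j)//= FK ?mul0r// ltNge; apply/negP => xjK; apply: xj.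
by rewrite /= in_itv/= -ler_norml.
Qed.

Lemma measurable_tensor F : (forall j, measurable_fun setT (F j)) ->
  measurable_fun setT (tensor F).
Proof.
move=> mF; apply: measurable_prod => j _.
by apply: measurableT_comp => //; exact: measurable_mx_entry.
Qed.

End tensor.

Lemma Rintegral_dominated d (T : measurableType d) (R : realType)
    (mu : {measure set T -> \bar R}) (D : set T) (f_ : nat -> T -> R) (f g : T -> R) :
  measurable D -> (forall n, measurable_fun D (f_ n)) ->
  (forall x, D x -> f_ n x @[n --> \oo] --> f x) ->
  mu.-integrable D (EFin \o g) ->
  (forall n x, D x -> `|f_ n x| <= g x) ->
  mu.-integrable D (EFin \o f) /\
  \int[mu]_(x in D) f_ n x @[n --> \oo] --> \int[mu]_(x in D) f x.
Proof.
move=> mD mf_ f_f ig f_g.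
have mf : measurable_fun D f by apply: (measurable_fun_cvg mf_).
have mf_E n : measurable_fun D (EFin \o f_ n) by apply/measurable_EFinP.
have mfE : measurable_fun D (EFin \o f) by apply/measurable_EFinP.
have cv : {ae mu, forall x, D x -> (EFin \o f_ n) x @[n --> \oo] --> (EFin \o f) x}.
  by apply/aeW => x Dx; apply: cvg_EFin; [exact: nearW|exact: f_f].
have dom : {ae mu, forall x, forall n, D x -> (`|(EFin \o f_ n) x| <= (EFin \o g) x)%E}.
  by apply/aeW => x n Dx; rewrite /= lee_fin f_g.
have [if_ _ lim] := dominated_convergence mD mf_E mfE cv ig dom.
split => //; apply: fine_cvg; rewrite fineK; first exact: lim.
exact: integrable_fin_num.
Qed.

(** * Weak derivatives integrated over boxes *)

Section boxes.
Context {R : realType} {d : nat}.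
Local Notation E := 'rV[R]_d.
Local Notation mu := (lebesgue_rV d).
Implicit Types (a b : 'I_d -> R).

(** Half-open, so that adjacent boxes are disjoint and the dyadic cubes of one generation partition
    the space. *)
Definition box a b : set E := [set x | forall i, a i <= x ord0 i < b i].

Lemma measurable_box a b : measurable (box a b).
Proof.
rewrite (_ : box a b = \bigcap_(i in [set: 'I_d])
    ((fun x : E => x ord0 i) @^-1` `[a i, b i[)).
  apply: fin_bigcap_measurable => // i _; rewrite -[X in measurable X]setTI.
  exact: measurable_mx_entry.
by apply/seteqP; split=> x /= h i; [move=> _|]; have := h i; rewrite /= in_itv/=; auto.
Qed.

Lemma tensor_box a b x :
  tensor (fun j => \1_(`[a j, b j[) : R -> R) x = \1_(box a b) x.
Proof.
rewrite /tensor indicE; case: (asboolP (box a b x)) => xb.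
  rewrite mem_set//= big1// => j _; rewrite indicE mem_setE in_itv/=.
  by rewrite (xb j).
rewrite memNset//=; have [j xj] : exists j, ~ (a j <= x ord0 j < b j).
  by apply/existsNP.
rewrite (bigD1 j)//= indicE mem_setE in_itv/=.
by rewrite (negbTE (introN idP xj)) mul0r.
Qed.

Lemma enorm_rV_le (x : E) (K : R) : (forall j, `|x ord0 j| <= K) -> enorm x <= K *+ d.
Proof.
move=> xK; rewrite (le_trans (enorm_le_sum _))// big_ord1.
rewrite (le_trans (ler_sum _ (fun j _ => xK j)))//.
by rewrite sumr_const card_ord.
Qed.

Lemma measurable_enorm m n : measurable_fun [set: 'M[R]_(m, n)] enorm.
Proof.
have mS : measurable_fun [set: 'M[R]_(m, n)]
    (fun A : 'M[R]_(m, n) => \sum_i \sum_j A i j ^+ 2 : R).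
  apply: measurable_sum => i; apply: measurable_sum => j.
  apply: measurable_funX; exact: measurable_mx_entry.
apply: (measurableT_comp _ mS).
by apply: measurable_realfun.continuous_measurable_fun; exact: sqrt_continuous.
Qed.

Lemma measurable_eball (r : R) : measurable (eball r : set E).
Proof.
rewrite (_ : eball r = enorm @^-1` `]-oo, r[); last first.
  by apply/seteqP; split => x; rewrite /eball /= in_itv.
by rewrite -[X in measurable X]setTI; exact: measurable_enorm.
Qed.

Lemma loc_integrable_measurable (w : E -> R) : loc_integrable w -> measurable_fun setT w.
Proof.
move=> lw; apply: (@measurable_fun_cvg _ _ _ _ (fun n => w \_ (eball n%:R))).
  move=> n; apply/(measurable_restrictT _ (measurable_eball _)).
  by have /integrableP[/measurable_EFinP] := lw n%:R.
move=> x _; apply: cvg_near_cst; near=> n; rewrite patchE ifT// inE /eball/=.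
by near: n; exact: nbhs_infty_gtr.
Unshelve. all: by end_near. Qed.

(** Dominated convergence: all the tensors are bounded by [1] and vanish off the ball of radius
    [K *+ d + 1], where [|w|] is integrable. *)
Lemma weak_tensor_cvg (w : E -> R) (G_ : nat -> 'I_d -> R -> R) (G : 'I_d -> R -> R)
    (K : R) : loc_integrable w ->
  (forall n j, measurable_fun setT (G_ n j)) ->
  (forall n j y, `|G_ n j y| <= \1_(`[- K, K]) y) ->
  (forall j y, G_ n j y @[n --> \oo] --> G j y) ->
  \int[mu]_x (w x * tensor (G_ n) x) @[n --> \oo] --> \int[mu]_x (w x * tensor G x).
Proof.
move=> lw mG GK G_G; set r := K *+ d + 1.
have mw : measurable_fun (eball r) w by have /integrableP[/measurable_EFinP] := lw r.
have G0 n x : ~ eball r x -> tensor (G_ n) x = 0.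
  move=> xr; have [j xj] : exists j, K < `|x ord0 j|.
    apply/not_existsP => xK; apply: xr; rewrite /eball /=.
    rewrite (@le_lt_trans _ _ (K *+ d)) ?ltrDl//.
    by apply: enorm_rV_le => j; rewrite leNgt; exact/negP.
  rewrite /tensor (bigD1 j)//=; have := GK n j (x ord0 j).
  have xF : (x ord0 j \in `[- K, K]) = false.
    by rewrite in_itv/= -ler_norml leNgt xj.
  rewrite indicE mem_setE xF normr_le0 => /eqP ->.
  by rewrite mul0r.
have cvT x : tensor (G_ n) x @[n --> \oo] --> tensor G x.
  apply: (@cvg_big _ _ _ _ _ (@mul_continuous R)) => j _; exact: G_G.
have G0' x : ~ eball r x -> tensor G x = 0.
  move=> xr; have := cvT x; under eq_fun do rewrite G0//.
  by move=> /cvg_lim <- //; rewrite lim_cst.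
have intE (F : E -> R) : (forall x, ~ eball r x -> F x = 0) ->
    \int[mu]_x (w x * F x) = \int[mu]_(x in eball r) (w x * F x).
  move=> F0; rewrite [RHS]Rintegral_mkcond; congr Rintegral; apply/funext => x.
  by rewrite patchE; case: ifPn => // /negP; rewrite inE => /F0 ->; rewrite mulr0.
rewrite (intE _ G0'); under eq_fun do rewrite (intE _ (G0 _)).
have G1 n x : `|tensor (G_ n) x| <= 1.
  rewrite /tensor normr_prod; apply: prodr_ile1 => j _; by rewrite normr_ge0/= (le_trans (GK _ _ _)).
have [] // := @Rintegral_dominated _ _ _ mu (eball r)
  (fun n x => w x * tensor (G_ n) x) (fun x => w x * tensor G x) (fun x => `|w x|).
- exact: measurable_eball.
- move=> n; apply: measurable_funM => //; apply: measurable_funTS.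
  exact: measurable_tensor.
- by move=> x _; apply: cvgM => //; exact: cvg_cst.
- by apply: (integrable_abse (lw r)).
- by move=> n x _; rewrite normrM ler_piMr.
Qed.

End boxes.

Section weak_box.
Context {R : realType} {d : nat}.
Local Notation E := 'rV[R]_d.
Local Notation mu := (lebesgue_rV d).
Implicit Types (a b : 'I_d -> R) (u w g : E -> R).

Lemma loc_integrable_abs w : loc_integrable w -> loc_integrable (fun x => `|w x|).
Proof. by move=> lw r; apply: (integrable_abse (lw r)). Qed.

Lemma integrable_tensor w (F : 'I_d -> R -> R) (K : R) : loc_integrable w ->
  (forall j, measurable_fun setT (F j)) ->
  (forall j y, `|F j y| <= \1_(`[- K, K]) y) ->
  mu.-integrable setT (fun x => (w x * tensor F x)%:E).
Proof.
move=> lw mF FK; set r := K *+ d + 1.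
have mw : measurable_fun (eball r) w by have /integrableP[/measurable_EFinP] := lw r.
have F0 x : ~ eball r x -> tensor F x = 0.
  move=> xr; have [j xj] : exists j, K < `|x ord0 j|.
    apply/not_existsP => xK; apply: xr; rewrite /eball /=.
    rewrite (@le_lt_trans _ _ (K *+ d)) ?ltrDl//.
    by apply: enorm_rV_le => j; rewrite leNgt; exact/negP.
  rewrite /tensor (bigD1 j)//=; have := FK j (x ord0 j).
  have xF : (x ord0 j \in `[- K, K]) = false.
    by rewrite in_itv/= -ler_norml leNgt xj.
  rewrite indicE mem_setE xF normr_le0 => /eqP ->.
  by rewrite mul0r.
have F1 x : `|tensor F x| <= 1.
  rewrite /tensor normr_prod; apply: prodr_ile1 => j _.
  by rewrite normr_ge0/= (le_trans (FK _ _)).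
rewrite (_ : (fun x => _) = (fun x => (w x * tensor F x)%:E) \_ (eball r)).
  apply/(integrable_mkcond _ (measurable_eball r)).
  apply: (le_integrable _ _ _ (lw r)); first exact: measurable_eball.
    apply/measurable_EFinP; apply: measurable_funM => //.
    by apply: measurable_funTS; exact: measurable_tensor.
  by move=> x _ /=; rewrite lee_fin normrM ler_piMr.
apply/funext => x; rewrite patchE; case: ifPn => // /negP; rewrite inE => /F0 ->.
by rewrite mulr0.
Qed.

Lemma Rintegral_box w a b :
  \int[mu]_x (w x * tensor (fun j => \1_(`[a j, b j[) : R -> R) x) =
  \int[mu]_(x in box a b) w x.
Proof.
rewrite [RHS]Rintegral_mkcond; congr Rintegral; apply/funext => x.
by rewrite tensor_box patchE indicE; case: ifPn => _; rewrite ?mulr1 ?mulr0.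
Qed.

(** The added [1] leaves room for the bumps, which may start as early as [a j - 1]. *)
Definition radius_of a b : R := \sum_j (`|a j| + `|b j|) + 1.

Lemma radius_of_le a b j : `|a j| + 1 <= radius_of a b /\ `|b j| + 1 <= radius_of a b.
Proof.
rewrite /radius_of (bigD1 j)//=; set S := \sum_(_ | _) _.
have : 0 <= S by apply: sumr_ge0 => k _; rewrite addr_ge0.
by have := normr_ge0 (a j); have := normr_ge0 (b j); split; lra.
Qed.

Lemma le_indic_radius a b j (v1 v2 : R) y : a j - 1 <= v1 -> v2 <= b j ->
  \1_(`[v1, v2]) y <= \1_(`[- radius_of a b, radius_of a b]) y :> R.
Proof.
move=> av vb; rewrite !indicE !mem_setE !in_itv/=.
have [v1y|//] := boolP (v1 <= y <= v2); move/andP: v1y => [v1y yv2].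
have [h1 h2] := radius_of_le a b j.
have := ler_norm (- a j); rewrite normrN => h3.
have := ler_norm (b j) => h4.
suff -> : - radius_of a b <= y <= radius_of a b by [].
by apply/andP; split; lra.
Qed.

Lemma le_indico (a b y : R) : \1_(`[a, b[) y <= \1_(`[a, b]) y :> R.
Proof.
rewrite !indicE !mem_setE !in_itv/=; have [/andP[-> /ltW ->]//|] := boolP (a <= y < b).
by case: (a <= y <= b).
Qed.

Lemma indic_out (K y : R) : K < `|y| -> \1_(`[- K, K]) y = 0 :> R.
Proof.
by move=> Ky; rewrite indicE mem_setE in_itv/= -ler_norml [_ <= _]leNgt Ky.
Qed.

Definition upd a (i : 'I_d) (v : R) (j : 'I_d) : R := if j == i then v else a j.

Lemma indic_upd a b i (v1 v2 : R) :
  (fun j => \1_(`[upd a i v1 j, upd b i v2 j[) : R -> R) =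
  subst (fun j => \1_(`[a j, b j[) : R -> R) i (\1_(`[v1, v2[)).
Proof. by apply/funext => j; rewrite /subst /upd; case: eqP. Qed.

Lemma indic_left_cvg (a b y : R) :
  (\1_(`[a - n.+1%:R^-1, b[) y : R) @[n --> \oo] --> (\1_(`[a, b[) y : R).
Proof.
apply: cvg_near_cst; have [ay|ya] := leP a y.
  apply: nearW => n; rewrite !indicE !mem_setE !in_itv/= ay.
  by rewrite (@le_trans _ _ a)// gerBl.
near=> n; rewrite !indicE !mem_setE !in_itv/= [a <= y]leNgt ya/=.
rewrite leNgt ltrBrDl -ltrBrDr (_ : _ < _)//=.
rewrite -(invrK (a - y)) ltf_pV2 ?posrE ?invr_gt0 ?subr_gt0//.
apply: (@lt_le_trans _ _ n%:R); last by rewrite ler_nat.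
by near: n; exact: nbhs_infty_gtr.
Unshelve. all: by end_near. Qed.

(* The test function is a product of bumps and, in direction i, of a tent whose
   derivative approximates 1 on [a i, b i[ and -1 on the adjacent interval. *)
Lemma weak_partial_box i u g a b : weak_partial i u g -> a i < b i ->
  `| \int[mu]_(x in box a b) u x -
     \int[mu]_(x in box (upd a i (b i)) (upd b i (b i + (b i - a i)))) u x | <=
  (b i - a i) * \int[mu]_(x in box a (upd b i (b i + (b i - a i)))) `|g x|.
Proof.
move=> [lu lg ug] ab; set s := b i - a i; set b' := upd b i (b i + s).
have s0 : 0 < s by rewrite subr_gt0.
have as_b : a i + s = b i by rewrite /s addrC subrK.
pose K := radius_of a b + radius_of a b'.
have r0 a' b'' : 0 <= radius_of a' b''.
  by rewrite addr_ge0// sumr_ge0// => j _; rewrite addr_ge0.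
have KK (r : R) y : r <= K -> \1_(`[- r, r]) y <= \1_(`[- K, K]) y :> R.
  move=> rK; rewrite !indicE !mem_setE !in_itv/= -!ler_norml.
  by have [yr|] := boolP (`|y| <= r); [rewrite (le_trans yr rK)|case: (`|y| <= K)].
have K1 : radius_of a b <= K by rewrite lerDl.
have K2 : radius_of a b' <= K by rewrite lerDr.
pose F n := sval (cid (tent n (a i) s0)).
pose F' n y := sbump n (a i) (b i) y - sbump n (b i) (b i + s) y.
have F_smooth n k : smooth1 k (F n) by rewrite /F; case: cid => ? [].
have dF n (y : R) : is_derive y 1 (F n) (F' n y).
  by rewrite /F /F'; case: cid => ? /= [_ + _ _]; rewrite as_b.
have F_le n y : `|F n y| <= s by rewrite /F; case: cid => ? [].
have F_0 n y : ~ (a i - n.+1%:R^-1 <= y < b i + s) -> F n y = 0.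
  by rewrite /F; case: cid => ? /= [_ _ _]; rewrite as_b; apply.
pose B n j : R -> R := sbump n (a j) (b j).
pose phi n := tensor (subst (B n) i (F n)).
have BK n j y : `|B n j y| <= \1_(`[- K, K]) y.
  rewrite ger0_norm ?bump_ge0// (le_trans (bump_le_indic _ _ _ _))//.
  by rewrite (le_trans _ (KK _ _ K1))//; apply: (@le_indic_radius a b j).
have F'K n y : `|F' n y| <= \1_(`[- K, K]) y.
  have b'i : b i + s <= b' i by rewrite /b' /upd eqxx.
  have h1 : sbump n (a i) (b i) y <= \1_(`[- K, K]) y.
    rewrite (le_trans (bump_le_indic _ _ _ _))// (le_trans _ (KK _ _ K2))//.
    by apply: (@le_indic_radius a b' i) => //; rewrite (le_trans _ b'i)// lerDl ltW.
  have h2 : sbump n (b i) (b i + s) y <= \1_(`[- K, K]) y.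
    rewrite (le_trans (bump_le_indic _ _ _ _))// (le_trans _ (KK _ _ K2))//.
    by apply: (@le_indic_radius a b' i) => //; rewrite lerD2r ltW.
  have := bump_ge0 n (a i) (b i) y; have := bump_ge0 n (b i) (b i + s) y.
  by rewrite /F' ler_norml; move=> *; apply/andP; split; lra.
have phi_test n : test_function (phi n).
  apply: (@tensor_test _ _ _ (K + `|a i| + 1 + `|b i + s|)).
    move=> k j; rewrite /subst; case: eqP => _; first exact: F_smooth.
    exact: smooth1_bump.
  move=> j y Ky; rewrite /subst; case: eqP => _.
    apply: F_0 => /andP[h1 h2]; move: Ky; apply/negP; rewrite -leNgt ler_norml.
    have : n.+1%:R^-1 <= 1 :> R by rewrite invf_le1 ?ltr0n// ler1n.
    have := ler_norm (- a i); have := ler_norm (b i + s); rewrite normrN.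
    have := normr_ge0 (b i + s); have := normr_ge0 (a i); have := r0 a b; have := r0 a b'.
    by rewrite -/K; move: h1 h2; move: (_^-1) => z; rewrite /K => *; apply/andP; split; lra.
  apply/eqP; rewrite -normr_le0 (le_trans (BK n j y))//.
  rewrite indic_out// (le_lt_trans _ Ky)// -2!(addrA K) lerDl !addr_ge0//.
(* The derivative in direction [i] is a bump on [[a i, b i[] minus a bump on the next interval of
   the same length, hence the difference of two box integrals in the limit. *)
have lim1 : \int[mu]_x (u x * partial i (phi n) x) @[n --> \oo] -->
    (\int[mu]_(x in box a b) u x - \int[mu]_(x in box (upd a i (b i)) b') u x).
  pose G : 'I_d -> R -> R := fun j => \1_(`[a j, b j[).
  pose D : R -> R := fun y => \1_(`[a i, b i[) y - \1_(`[b i, b i + s[) y.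
  have -> : \int[mu]_(x in box a b) u x - \int[mu]_(x in box (upd a i (b i)) b') u x =
      \int[mu]_x (u x * tensor (subst G i D) x).
    rewrite -!Rintegral_box -RintegralB//.
    - congr Rintegral; apply/funext => x; rewrite indic_upd -mulrBr; congr (_ * _).
      have GE : tensor G x = tensor (subst G i (G i)) x by rewrite subst_id.
      by rewrite -/G GE !tensor_subst mulrBl.
    - apply: (@integrable_tensor _ _ K) => // j y.
      rewrite ger0_norm// (le_trans (le_indico _ _ _))// (le_trans _ (KK _ _ K1))//.
      by apply: (@le_indic_radius a b j) => //; rewrite gerBl.
    - apply: (@integrable_tensor _ _ K) => // j y.
      rewrite ger0_norm// (le_trans (le_indico _ _ _))// (le_trans _ (KK _ _ K2))//.
      apply: (@le_indic_radius a b' j) => //; rewrite /upd; case: eqP => [->|_].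
        by rewrite lerBlDr (le_trans (ltW ab))// lerDl.
      by rewrite gerBl.
  have pE n : partial i (phi n) = tensor (subst (B n) i (F' n)).
    have dS (y : R) : is_derive y 1 (subst (B n) i (F n) i) (F' n y).
      by rewrite /subst eqxx; exact: dF.
    rewrite (partial_tensor dS).
    by congr tensor; apply/funext => j; rewrite /subst; case: eqP.
  under eq_fun do rewrite pE.
  apply: (@weak_tensor_cvg _ _ _ _ _ K) => //.
  - move=> n j; rewrite /subst; case: eqP => _; last exact: measurable_bump.
    by apply: measurable_funB; exact: measurable_bump.
  - by move=> n j y; rewrite /subst; case: eqP => _; [exact: F'K|exact: BK].
  - move=> j y; rewrite /subst; case: eqP => _; last exact: bump_cvg.
    by apply: cvgB; exact: bump_cvg.
(* Majorant of [|phi n|], up to the height [s] of the tent. The left ends recede by [n.+1%:R^-1],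
   where the bumps start; the limit is the union of the two boxes. *)
pose H n : 'I_d -> R -> R := fun j => \1_(`[a j - n.+1%:R^-1, b' j[).
have b_b' j : b j <= b' j.
  by rewrite /b' /upd; case: eqP => // ->; rewrite lerDl ltW.
have HK n j y : `|H n j y| <= \1_(`[- K, K]) y.
  rewrite ger0_norm// (le_trans (le_indico _ _ _))// (le_trans _ (KK _ _ K2))//.
  apply: (@le_indic_radius a b' j) => //.
  by rewrite lerD2l lerN2 invf_le1 ?ltr0n// ler1n.
have lim2 : s * \int[mu]_x (`|g x| * tensor (H n) x) @[n --> \oo] -->
    s * \int[mu]_(x in box a b') `|g x|.
  apply: cvgM; first exact: cvg_cst.
  rewrite -Rintegral_box; apply: (@weak_tensor_cvg _ _ _ _ _ K) => //.
    exact: loc_integrable_abs.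
    by move=> n j; apply: measurable_indic.
  by move=> j y; exact: indic_left_cvg.
have phiH n x : `|phi n x| <= s * tensor (H n) x.
  rewrite /phi -[in leRHS](subst_id (H n) i) !tensor_subst normrM mulrA.
  apply: ler_pM => //.
    rewrite /H indicE mem_setE in_itv/= /b' /upd eqxx.
    have [_|h] := boolP (_ <= _ < _); first by rewrite mulr1.
    by rewrite F_0 ?normr0 ?mulr0//; exact/negP.
  rewrite normr_prod; apply: ler_prod => j ji; rewrite normr_ge0/=.
  rewrite ger0_norm ?bump_ge0// /H indicE mem_setE in_itv/= /b' /upd (negbTE ji).
  have [_|] := boolP (_ <= _ < _); first exact: bump_le1.
  rewrite negb_and -ltNge -leNgt => /orP[/ltW|] h; first by rewrite /B bump_eq0l.
  by rewrite /B bump_eq0r// (le_trans _ h)// gerBl.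
have mphi n : measurable_fun setT (phi n).
  apply: measurable_tensor => j; rewrite /subst; case: eqP => _.
    apply: measurable_realfun.continuous_measurable_fun.
    exact: (smooth1_continuous (F_smooth n 0)).
  exact: measurable_bump.
have mg := loc_integrable_measurable lg.
have iH n : mu.-integrable setT (fun x => (`|g x| * tensor (H n) x)%:E).
  apply: (integrable_tensor (loc_integrable_abs lg) _ (HK n)).
  by move=> j; apply: measurable_indic.
have le_n n : `| \int[mu]_x (u x * partial i (phi n) x) | <=
    s * \int[mu]_x (`|g x| * tensor (H n) x).
  rewrite ug// normrN -(RintegralZl _ measurableT (iH n)).
  have leg x : `|g x * phi n x| <= s * (`|g x| * tensor (H n) x).
    by rewrite normrM mulrCA ler_wpM2l.
  have iZ : mu.-integrable setT (EFin \o (fun x => s * (`|g x| * tensor (H n) x))).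
    rewrite (_ : _ \o _ = fun x => (s%:E * (`|g x| * tensor (H n) x)%:E)%E)//.
    exact: integrableZl.
  have ig : mu.-integrable setT (EFin \o (fun x => g x * phi n x)).
    apply: (le_integrable _ _ _ iZ) => //.
      by apply/measurable_EFinP; apply: measurable_funM.
    by move=> x _ /=; rewrite lee_fin (le_trans (leg x))// ler_norm.
  rewrite (le_trans (le_normr_Rintegral _ ig))//.
  by apply: le_Rintegral => //; apply: (integrable_abse ig).
have lim1' : `|\int[mu]_x (u x * partial i (phi n) x)| @[n --> \oo] -->
    `|\int[mu]_(x in box a b) u x - \int[mu]_(x in box (upd a i (b i)) b') u x|.
  exact: cvg_norm.
by apply: (ler_cvg_to lim1' lim2); exact: nearW.
Qed.

End weak_box.

Lemma lebesgue_rV_prod {R : realType} n (B : 'I_n -> set R) :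
  (forall i, measurable (B i)) ->
  lebesgue_rV n [set x : 'rV[R]_n | forall i, B i (x ord0 i)] =
  (\prod_(i < n) lebesgue_measure (B i))%E.
Proof.
elim: n B => [|n IHn] B mB.
  by rewrite big_ord0 /= /unit_mass diracE mem_set//= => -[].
rewrite big_ord_recl /= /lebesgue_rV_step /pushforward.
rewrite (_ : _ @^-1` _ = B ord0 `*`
    [set x : 'rV[R]_n | forall i, B (lift ord0 i) (x ord0 i)]); last first.
  apply/seteqP; split=> -[t x] /= => [h|[h0 h1] i].
    split=> [|i]; first by have := h ord0; rewrite mxE unlift_none.
    by have := h (lift ord0 i); rewrite mxE liftK.
  by rewrite mxE; case: unliftP => [k ->|->]; [exact: h1|exact: h0].
rewrite product_measure1E//=; [by rewrite -IHn|exact: mB|].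
rewrite (_ : [set _ | _] = \bigcap_(i in [set: 'I_n])
    ((fun x : 'rV[R]_n => x ord0 i) @^-1` B (lift ord0 i))).
  apply: fin_bigcap_measurable => // i _; rewrite -[X in measurable X]setTI.
  exact: measurable_mx_entry.
by apply/seteqP; split=> x /= h i; [move=> _|]; exact: h.
Qed.

(** * Dyadic cubes and Lusin-Lipschitz estimates *)

Section cubes.
Context {R : realType} {d : nat} (l : R) (l0 : 0 < l).
Local Notation E := 'rV[R]_d.
Local Notation mu := (lebesgue_rV d).
Local Notation idx := {ffun 'I_d -> int}.
Implicit Types (k N : nat) (c : idx) (x : E).

Lemma lebesgue_rV_halfopen (a b : 'I_d -> R) : (forall i, a i <= b i) ->
  mu (box a b) = (\prod_i (b i - a i))%:E.
Proof.
move=> ab; pose B i : set R := `[a i, b i[%classic.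
rewrite (_ : box a b = [set x : E | forall i, B i (x ord0 i)]).
  rewrite lebesgue_rV_prod => [|i]; last exact: measurable_itv.
  rewrite -prodEFin; apply: eq_bigr => i _.
  rewrite lebesgue_measure_itv/= lte_fin.
  by have := ab i; rewrite le_eqVlt => /predU1P[->|->]//; rewrite ltxx subrr.
by apply/seteqP; split=> x /= h i; have := h i; rewrite /B /= in_itv/=.
Qed.

Definition mesh k : R := l / 2 ^+ k.

Lemma mesh_gt0 k : 0 < mesh k.
Proof. by rewrite divr_gt0// exprn_gt0. Qed.

Lemma meshS k : mesh k = 2 * mesh k.+1.
Proof. by rewrite /mesh exprS; field; rewrite expf_neq0. Qed.

Lemma mesh_le k : mesh k <= l.
Proof. by rewrite ler_pdivrMr ?exprn_gt0// ler_peMr ?(ltW l0)// exprn_ege1// ler1n. Qed.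

Definition cell k x : idx := [ffun i => Num.floor (x ord0 i / mesh k)].

Definition cube k c N : set E :=
  box (fun i => (c i)%:~R * mesh k) (fun i => (c i)%:~R * mesh k + N%:R * mesh k).

Lemma measurable_cube k c N : measurable (cube k c N).
Proof. exact: measurable_box. Qed.

Lemma cube_measure k c N : mu (cube k c N) = ((N%:R * mesh k) ^+ d)%:E.
Proof.
rewrite lebesgue_rV_halfopen => [|i].
  congr EFin; rewrite (eq_bigr (fun=> N%:R * mesh k)) => [|i _].
    by rewrite prodr_const card_ord.
  by rewrite addrAC subrr add0r.
by rewrite lerDl mulr_ge0// ltW// mesh_gt0.
Qed.

Lemma cubeP k c N x :
  cube k c N x <-> forall i, (c i <= cell k x i < c i + N%:Z)%R.
Proof.
have m0 := mesh_gt0 k.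
split=> h i; have := h i; rewrite /cell ffunE floor_ge_int floor_lt_int.
  rewrite ler_pdivlMr// ltr_pdivrMr// => /andP[-> /lt_le_trans]; apply.
  by rewrite rmorphD/= mulrDl.
rewrite ler_pdivlMr// ltr_pdivrMr// => /andP[-> /lt_le_trans]; apply.
by rewrite rmorphD/= mulrDl.
Qed.

Lemma cube1P k c x : cube k c 1 x <-> cell k x = c.
Proof.
rewrite cubeP; split => [h|<- i]; last by rewrite lexx/= ltrDl.
apply/ffunP => i; have := h i; rewrite ltzD1 => /andP[h1 h2].
by apply/eqP; rewrite eq_le h1 h2.
Qed.

Lemma cell_cube k x : cube k (cell k x) 1 x.
Proof. exact/cube1P. Qed.

Lemma cellS k x i : (2 * cell k x i <= cell k.+1 x i < 2 * cell k x i + 2)%R.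
Proof.
have m0 := mesh_gt0 k.+1.
have := proj1 (cubeP k (cell k x) 1 x) (cell_cube k x) i => _.
have /(_ i) := cell_cube k x; rewrite meshS mul1r => /andP[h1 h2].
rewrite [cell k.+1 x i]ffunE floor_ge_int floor_lt_int.
rewrite ler_pdivlMr// ltr_pdivrMr// rmorphD/= rmorphM/=.
by apply/andP; split; [move: h1|move: h2]; move: (_ %:~R) => z; lra.
Qed.

Definition child c (e : {ffun 'I_d -> bool}) : idx := [ffun i => (2 * c i + (e i : nat)%:Z)%R].

(** By [cellS] the finer index exceeds twice the coarser one by [0] or [1] in each direction; these
    bits form [e]. *)
Lemma cell_child k x c : cell k x = c <-> exists e, cell k.+1 x = child c e.
Proof.
split=> [<-|[e xe]].
  exists [ffun i => 2 * cell k x i < cell k.+1 x i].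
  apply/ffunP => i; have := cellS k x i.
  have -> (f : {ffun 'I_d -> bool}) : child (cell k x) f i = 2 * cell k x i + (f i : nat)%:Z.
    by rewrite ffunE.
  rewrite [X in nat_of_bool X]ffunE.
  by move: (cell k x i) (cell k.+1 x i) => a b; case: ltP => /=; lia.
apply/ffunP => i; have := cellS k x i; rewrite xe.
have -> : child c e i = 2 * c i + (e i : nat)%:Z by rewrite ffunE.
by move: (cell k x i) (c i) => a b; case: (e i) => /=; lia.
Qed.

Lemma child_inj c : injective (child c).
Proof.
move=> e e' /ffunP ee'; apply/ffunP => i; have := ee' i; rewrite !ffunE.
by case: (e i); case: (e' i) => //=; lia.
Qed.

Lemma cube_children k c :
  cube k c 1 = \big[setU/set0]_(e : {ffun 'I_d -> bool}) cube k.+1 (child c e) 1.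
Proof.
rewrite -bigcup_seq; apply/seteqP; split=> x.
  move=> /cube1P/cell_child[e xe]; exists e => /=; first by rewrite mem_index_enum.
  exact/cube1P.
by move=> [e _ /cube1P xe]; apply/cube1P/cell_child; exists e.
Qed.

Lemma Rintegral_children k c (w : E -> R) :
  mu.-integrable (cube k c 1) (EFin \o w) ->
  \int[mu]_(x in cube k c 1) w x =
  \sum_(e : {ffun 'I_d -> bool}) \int[mu]_(x in cube k.+1 (child c e) 1) w x.
Proof.
move=> iw; rewrite /Rintegral sum_fine; last first.
  move=> e _; apply: integrable_fin_num; first exact: measurable_cube.
  apply: (integrableS _ _ _ iw); [exact: measurable_cube|exact: measurable_cube|].
  by move=> x /cube1P xe; apply/cube1P/cell_child; exists e.
congr fine; rewrite cube_children integral_bigsetU_EFin//.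
- by move=> e; exact: measurable_cube.
- exact: index_enum_uniq.
- apply/trivIsetP => e e' _ _ ee'; apply/seteqP; split => // x [/cube1P h /cube1P].
  by rewrite h => /child_inj/eqP; rewrite (negbTE ee').
- by have /integrableP[] := iw; rewrite -cube_children.
Qed.

Lemma measurable_cell_fun k (F : idx -> R) :
  measurable_fun setT (fun x => F (cell k x)).
Proof.
move=> _ B mB; rewrite setTI.
rewrite (_ : _ @^-1` B = \bigcup_c (if asbool (B (F c)) then cube k c 1 else set0)).
  apply: countable_bigcupT_measurable => // c.
  by case: ifP => _; [exact: measurable_cube|exact: measurable0].
apply/seteqP; split => x /=.
  by move=> Bx; exists (cell k x) => //; rewrite asboolT//; exact: cell_cube.
by move=> [c _]; case: ifPn => // /asboolP Bc /cube1P ->.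
Qed.

End cubes.

Section dyadic.
Context {R : realType} {d : nat} (l : R) (l0 : 0 < l).
Local Notation E := 'rV[R]_d.
Local Notation mu := (lebesgue_rV d).
Local Notation idx := {ffun 'I_d -> int}.
Implicit Types (k N : nat) (c : idx) (x : E).

Lemma mesh_cvg0 : mesh l k @[k --> \oo] --> (0 : R).
Proof.
rewrite (_ : (fun k => mesh l k) = fun k => l * (2^-1 ^+ k)); last first.
  by apply/funext => k; rewrite /mesh exprVn.
rewrite -[X in _ --> X](mulr0 l); apply: cvgM; first exact: cvg_cst.
by apply: cvg_expr; rewrite ger0_norm// invf_lt1// ltr1n.
Qed.

Lemma cell_le k j x y : (k <= j)%N -> cell l j x = cell l j y -> cell l k x = cell l k y.
Proof.
move=> kj; rewrite -(subnKC kj); elim: (j - k)%N => [|m IHm]; first by rewrite addn0.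
rewrite addnS => xy; apply: IHm.
have [e xe] : exists e, cell l (k + m).+1 x = child (cell l (k + m) x) e.
  exact/(cell_child l0).
have : exists e, cell l (k + m).+1 y = child (cell l (k + m) x) e.
  by exists e; rewrite -xy.
by move/(cell_child l0) => ->.
Qed.

Lemma cube_nested k j c c' x : (k <= j)%N -> cube l k c 1 x -> cube l j c' 1 x ->
  cube l j c' 1 `<=` cube l k c 1.
Proof.
move=> kj /(cube1P l0) xc /(cube1P l0) xc' y /(cube1P l0) yc'; apply/(cube1P l0).
by rewrite -xc; apply: (cell_le kj); rewrite xc' yc'.
Qed.

Definition dyadic_cubes : set (set E) :=
  [set A | A = set0 \/ exists k c, A = cube l k c 1].

Lemma dyadic_setI : setI_closed dyadic_cubes.
Proof.
move=> A B [->|[k [c ->]]]; first by left; rewrite set0I.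
move=> [->|[j [c' ->]]]; first by left; rewrite setI0.
have [->|/set0P[x [xA xB]]] := eqVneq (cube l k c 1 `&` cube l j c' 1) set0; first by left.
right; have [kj|/ltnW jk] := leqP k j.
  exists j, c'; rewrite setIidr//; exact: (cube_nested kj xA).
exists k, c; rewrite setIidl//; exact: (cube_nested jk xB).
Qed.

(** Each coordinate is the limit of the corners of the cells, which are measurable for the dyadic
    sigma-algebra since they take one value on each cube; and the coordinates generate the Borel
    sets. *)
Lemma measurable_dyadic : @measurable _ E `<=` <<s dyadic_cubes >>.
Proof.
have mc (i : 'I_d) : measurable_fun setT (fun x : g_sigma_algebraType dyadic_cubes => (x : E) ord0 i).
  apply: (@measurable_fun_cvg _ _ _ _
    (fun k (x : g_sigma_algebraType dyadic_cubes) => (cell l k (x : E) i)%:~R * mesh l k)).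
    move=> k _ B mB; rewrite setTI.
    rewrite (_ : _ @^-1` B = \bigcup_(c in [set: idx])
        (if asbool (B ((c i)%:~R * mesh l k)) then cube l k c 1 else set0)).
      apply: countable_bigcupT_measurable => // c.
      case: ifP => _; last exact: measurable0.
      by apply: sub_sigma_algebra; right; exists k, c.
    apply/seteqP; split => x /=.
      by move=> Bx; exists (cell l k x) => //; rewrite asboolT//; exact: cell_cube.
    by move=> [c _]; case: ifPn => // /asboolP Bc /(cube1P l0) ->.
  move=> x _; apply/cvgrPdist_le => e e0; near=> k.
  have m0 := mesh_gt0 l0 k.
  have := cell_cube l0 k x i; rewrite mul1r => /andP[h1 h2].
  have : mesh l k <= e.
    near: k; have /cvgr0Pnorm_le/(_ e e0) := mesh_cvg0.
    by apply: filterS => k; apply: le_trans; rewrite ler_norm.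
  rewrite ger0_norm ?subr_ge0//; move: h1 h2; move: (_ * _) => z; lra.
move=> A; apply: smallest_sub; first exact: smallest_sigma_algebra.
move=> _ [i [j [B [mB ->]]]].
have := mc j measurableT B mB; rewrite setTI (_ : i = ord0)//.
by apply/val_inj; case: i => -[].
Unshelve. all: by end_near. Qed.

(* Dyadic cubes generate the Borel sets, so no differentiation theorem is needed. *)
Lemma dyadic_ae_eq0 c0 (w : E -> R) :
  mu.-integrable (cube l 0 c0 1) (EFin \o w) ->
  (forall k c, cube l k c 1 `<=` cube l 0 c0 1 -> \int[mu]_(x in cube l k c 1) w x = 0) ->
  {ae mu, forall x, cube l 0 c0 1 x -> w x = 0}.
Proof.
set Q := cube l 0 c0 1 => iw w0.
have mQ : measurable Q by exact: measurable_cube.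
pose v := w \_ Q.
have iv : mu.-integrable setT (EFin \o v).
  rewrite (_ : EFin \o v = (EFin \o w) \_ Q); first exact/(integrable_mkcond _ mQ).
  by apply/funext => x; rewrite /v /= !patchE; case: ifP.
(* Dynkin argument: [H] is a lambda-system containing the dyadic cubes, which are stable under
   intersection, so it contains all Borel sets. A function with zero integral over every Borel
   subset of [Q] vanishes a.e. on [Q]. *)
pose H := [set A : set E | measurable A /\ \int[mu]_(x in A) v x = 0].
have ivA A : measurable A -> mu.-integrable A (EFin \o v).
  by move=> mA; apply: (integrableS _ _ _ iv).
have vI A : \int[mu]_(x in A) v x = \int[mu]_(x in A `&` Q) w x.
  rewrite Rintegral_mkcond [RHS]Rintegral_mkcond; congr Rintegral; apply/funext => x.
  rewrite /v !patchE in_setI; by case: (x \in A); case: (x \in Q).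
have lH : lambda_system setT H.
  split => //.
  - split; first exact: measurableT.
    by rewrite vI setTI; exact: w0.
  - move=> A B BA [mA A0] [mB B0]; split; first exact: measurableD.
    have := A0; rewrite -{1}(setDUK BA) Rintegral_setU//; first by rewrite B0 add0r.
    + exact: measurableD.
    + by rewrite setDUK//; exact: ivA.
    + by rewrite disj_set2E; apply/eqP/seteqP; split => // x [Bx [_ ]].
  - move=> F ndF HF; split.
      by apply: bigcup_measurable => k _; have [] := HF k.
    have mF k : measurable (F k) by have [] := HF k.
    have mU : measurable (\bigcup_k F k) by exact: bigcup_measurable.
    have [||||_] := @Rintegral_dominated _ _ _ mu setT (fun n => v \_ (F n))
      (v \_ (\bigcup_k F k)) (fun x => `|v x|) measurableT.
    + move=> n; apply/(measurable_restrictT _ (mF n)); apply: measurable_funTS.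
      by have /integrableP[/measurable_EFinP] := iv.
    + move=> x _; apply: cvg_near_cst; have [[k _ xk]|xU] := pselect ((\bigcup_k F k) x).
        near=> n; rewrite !patchE !mem_set//; first by exists k.
        have : (k <= n)%N by near: n; exact: nbhs_infty_ge.
        by move=> /ndF/subsetPset; exact.
      apply: nearW => n; rewrite !patchE !memNset// => xn; apply: xU; by exists n.
    + exact: (integrable_abse iv).
    + by move=> n x _; rewrite patchE; case: ifP; rewrite ?normr0.
    rewrite -Rintegral_mkcond; under eq_fun do rewrite -Rintegral_mkcond (HF _).2.
    by move=> /cvg_lim <- //; rewrite lim_cst.
have GH : dyadic_cubes `<=` H.
  move=> A [->|[k [c ->]]]; first by split => //; rewrite Rintegral_set0.
  split; first exact: measurable_cube.
  rewrite vI; have [->|/set0P[x [xA xB]]] := eqVneq (cube l k c 1 `&` Q) set0.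
    by rewrite Rintegral_set0.
  have kQ : cube l k c 1 `<=` Q by exact: (cube_nested (leq0n k) xB).
  by rewrite setIidl//; exact: w0.
have sH : @measurable _ E `<=` H.
  apply: (subset_trans measurable_dyadic).
  exact: (lambda_system_subset dyadic_setI lH GH).
have := @integral_ae_eq _ _ _ mu Q mQ (cst 0%E) (EFin \o w) iw.
case => //.
- move=> A AQ mA; rewrite integral_cst// mul0e.
  have [_] := sH _ mA; rewrite vI setIidl// => h.
  rewrite -[LHS]fineK; first by congr EFin.
  by apply: integrable_fin_num => //; exact: (integrableS _ _ _ iw).
- move=> N [mN N0 NP]; exists N; split => // x h; apply: NP => /= h'; apply: h => Qx.
  by have [] := h' Qx.
Unshelve. all: by end_near. Qed.

End dyadic.

(** * Comparison of averages over neighbouring cubes *)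

Section averages.
Context {R : realType} {d : nat} (l : R) (l0 : 0 < l).
Local Notation E := 'rV[R]_d.
Local Notation mu := (lebesgue_rV d).
Local Notation idx := {ffun 'I_d -> int}.
Implicit Types (k N : nat) (c n m p : idx) (x : E).

Definition average (w : E -> R) k c N : R :=
  (\int[mu]_(x in cube l k c N) w x) / (N%:R * mesh l k) ^+ d.

(* The averages are over blocks of N^d cubes of one generation, not aligned with
   the coarser ones: points whose coordinates differ by less than N - 1 meshes
   share a block. *)
Definition maximal N (h : E -> R) x : \bar R :=
  ereal_sup [set (average h kc.1 kc.2 N)%:E | kc in [set kc : nat * idx | cube l kc.1 kc.2 N x]].

Lemma le_maximal N h k c x : cube l k c N x -> ((average h k c N)%:E <= maximal N h x)%E.
Proof. by move=> xc; apply: ereal_sup_ubound; exists (k, c). Qed.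

Lemma average_ge0 N h k c : (forall x, 0 <= h x) -> 0 <= average h k c N.
Proof.
move=> h0; rewrite divr_ge0//; last by rewrite exprn_ge0// mulr_ge0// ltW// mesh_gt0.
by apply: Rintegral_ge0.
Qed.

Lemma maximal_ge0 N h x : (0 < N)%N -> (forall x, 0 <= h x) -> (0 <= maximal N h x)%E.
Proof.
move=> N0 h0; have xN : cube l 0 (cell l 0 x) N x.
  apply/(cubeP l0) => i; rewrite lexx/= ltrDl.
  by case: N N0.
by rewrite (le_trans _ (le_maximal h xN))// lee_fin average_ge0.
Qed.

Lemma integrable_cube (u : E -> R) k c : loc_integrable u ->
  mu.-integrable (cube l k c 1) (EFin \o u).
Proof.
move=> lu; pose r := (`|l| + \sum_i `|(c i)%:~R * mesh l k|) *+ d + 1.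
apply: (integrableS (measurable_eball r) _ _ (lu r)); first exact: measurable_cube.
move=> x xc; rewrite /eball/= (@le_lt_trans _ _ ((`|l| + \sum_i `|(c i)%:~R * mesh l k|) *+ d))//.
  apply: enorm_rV_le => j; have /andP[h1 h2] := xc j.
  rewrite mul1r in h2; rewrite (bigD1 j)//=; move: h1 h2; set z := _ * _ => h1 h2.
  set S := \sum_(_ | _) _; have S0 : 0 <= S by apply: sumr_ge0.
  have := mesh_le l0 k; have := mesh_gt0 l0 k; have := ler_norm l.
  have := ler_norm z; have := ler_norm (- z); rewrite normrN.
  by move=> *; rewrite ler_norml; apply/andP; split; lra.
by rewrite ltrDl.
Qed.

Definition next c i : idx := [ffun j => if j == i then c j + 1 else c j].

Section chain.
Context (u h : E -> R) (g : 'I_d -> E -> R) (Om : set E).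
Context (ug : forall i, weak_partial i u (g i)).
Context (h0 : forall x, 0 <= h x).
Context (ih : mu.-integrable setT (EFin \o h)).
Context (gh : forall i x, Om x -> `|g i x| <= h x).

(** This is [weak_partial_box] on two adjacent cubes, divided by the volume of a cube. Their union
    lies in [Om], where [h] dominates the gradient, and in [C], to which the integral of [h] is then
    enlarged. *)
Lemma average_next k c i (C : set E) : measurable C ->
  cube l k c 1 `<=` Om `&` C -> cube l k (next c i) 1 `<=` Om `&` C ->
  `|average u k c 1 - average u k (next c i) 1| <=
  mesh l k * (\int[mu]_(x in C) h x / mesh l k ^+ d).
Proof.
move=> mC cC nC; have m0 := mesh_gt0 l0 k.
rewrite /average mul1r -mulrBl normrM [X in _ * X]ger0_norm; last first.
  by rewrite invr_ge0 exprn_ge0// ltW.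
rewrite mulrA ler_wpM2r ?invr_ge0 ?exprn_ge0 ?(ltW m0)//.
pose a i := (c i)%:~R * mesh l k; pose b i := a i + 1%:R * mesh l k.
have ab : a i < b i by rewrite ltrDl mul1r.
have := weak_partial_box (ug i) ab.
have bai : b i - a i = mesh l k by rewrite /b mul1r addrAC subrr add0r.
rewrite bai.
have -> : box (upd a i (b i)) (upd b i (b i + mesh l k)) = cube l k (next c i) 1.
  rewrite /cube; congr box; apply/funext => j; rewrite /upd /next ffunE; case: eqP => // ->.
    by rewrite /b /a rmorphD/= mulrDl mul1r.
  by rewrite /b /a rmorphD/= mulrDl !mul1r.
move=> /le_trans; apply; rewrite ler_wpM2l ?(ltW m0)//.
set Q := box a _; have QC : Q `<=` Om `&` C.
  move=> x Qx; have [xb|bx] := ltP (x ord0 i) (b i).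
    apply: cC => j; have := Qx j; rewrite /upd; case: eqP => [->|//].
    by rewrite -/(a i) -/(b i) xb => /andP[->].
  apply: nC => j; have := Qx j; rewrite /upd /next ffunE; case: eqP => [->|//].
  rewrite rmorphD/= mulrDl -/(a i) mul1r => /andP[_].
  by rewrite (_ : a i + mesh l k = b i) ?bx// /b mul1r.
have mQ : measurable Q by exact: measurable_box.
have ihQ : mu.-integrable Q (EFin \o h) by exact: (integrableS _ _ _ ih).
apply: (@le_trans _ _ (\int[mu]_(x in Q) h x)).
  apply: le_Rintegral => //; last by move=> x /QC[Omx _]; exact: gh.
  apply: (le_integrable _ _ _ ihQ) => //.
    apply/measurable_EFinP; apply: measurableT_comp => //.
    by apply: measurable_funTS; have [_ /loc_integrable_measurable] := ug i.
  move=> x /QC[Omx _] /=; rewrite lee_fin normr_id (ger0_norm (h0 x)); exact: gh.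
rewrite /Rintegral fine_le//.
- exact: integrable_fin_num.
- by apply: integrable_fin_num => //; exact: (integrableS _ _ _ ih).
apply: ge0_subset_integral => //.
- by apply/measurable_EFinP; apply: measurable_funTS; have /integrableP[/measurable_EFinP] := ih.
- by move=> x _; rewrite lee_fin.
- by move=> x /QC[].
Qed.

Definition between n m p := forall i, (n i <= p i <= m i) || (m i <= p i <= n i).

(** Induction on the l^1 distance of the indices: a step in a direction where they differ moves [n]
    towards [m], stays between them, and costs one [average_next]. *)
Lemma average_chain k n m (C : set E) : measurable C ->
  (forall p, between n m p -> cube l k p 1 `<=` Om `&` C) ->
  `|average u k n 1 - average u k m 1| <=
  (\sum_i absz (n i - m i))%:R * (mesh l k * (\int[mu]_(x in C) h x / mesh l k ^+ d)).
Proof.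
move=> mC; set A := mesh l k * _.
move DE : (\sum_i _)%N => D; elim: D n m DE => [|D IHD] n m nm HC.
  rewrite mul0r (_ : n = m) ?subrr ?normr0//; apply/ffunP => i.
  move/eqP: nm; rewrite sum_nat_eq0 => /forallP/(_ i)/=; lia.
have [i ni] : exists i, n i != m i.
  apply/existsP; rewrite -[[exists _, _]]negbK negb_exists; apply/negP => /forallP nmE.
  by move: nm; rewrite big1// => i _; have := nmE i; rewrite negbK => /eqP ->; rewrite subrr.
wlog nmi : n m nm HC ni / n i < m i.
  move=> H; have [|mn|/eqP] := ltgtP (n i) (m i); first exact: H; last by rewrite (negbTE ni).
  rewrite distrC; apply: H => //; last by rewrite eq_sym.
    by rewrite -nm; apply: eq_bigr => j _; lia.
  by move=> p pb; apply: HC => j; rewrite orbC.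
have bn : between n m n by move=> j; have [|] := leP (n j) (m j); lia.
have nextE j : next n i j = if j == i then n j + 1 else n j by rewrite ffunE.
have bn' : between n m (next n i).
  move=> j; rewrite nextE; case: eqP => [->|_]; first by lia.
  by have := bn j.
have sumE : (\sum_j absz (next n i j - m j))%N = D.
  apply/eqP; rewrite -eqSS -nm (bigD1 i)//= [X in _ == X](bigD1 i)//= nextE eqxx -addSn.
  apply/eqP; congr (_ + _)%N; first by lia.
  by apply: eq_bigr => j /negbTE ji; rewrite nextE ji.
have := IHD _ _ sumE; set B := average u k m 1.
have H2 : forall p, between (next n i) m p -> cube l k p 1 `<=` Om `&` C.
  move=> p bp; apply: HC => j; have := bp j; rewrite nextE; case: eqP => [->|_]; last by [].
  by lia.
move=> /(_ H2) h1; have h2 := average_next mC (HC _ bn) (HC _ bn').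
rewrite -(subrKA (average u k (next n i) 1)) (le_trans (ler_normD _ _))//.
by rewrite -natr1 mulrDl mul1r addrC lerD.
Qed.

Context (N : nat).
Context (N2 : (2 <= N)%N).

(** At most [d * N] steps inside a block of side [N], times [N ^ d], the ratio of the volume of the
    block to that of one cube. *)
Definition chain_cst : R := (d * N)%:R * N%:R ^+ d.

Lemma chain_cst_ge0 : 0 <= chain_cst.
Proof. by rewrite mulr_ge0// exprn_ge0. Qed.

Lemma average_chain_maximal k c n m x : cube l k c N x ->
  (forall i, c i <= n i < c i + N%:Z) -> (forall i, c i <= m i < c i + N%:Z) ->
  (forall p, between n m p -> cube l k p 1 `<=` Om) ->
  (maximal N h x < +oo)%E ->
  `|average u k n 1 - average u k m 1| <= chain_cst * mesh l k * fine (maximal N h x).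
Proof.
move=> xc nc mc HO Mx; have m0 := mesh_gt0 l0 k.
have N0 : (0 < N)%N by lia.
have NR : N%:R != 0 :> R by rewrite pnatr_eq0 -lt0n.
have HC : forall p, between n m p -> cube l k p 1 `<=` Om `&` cube l k c N.
  move=> p bp y yp; split; first exact: (HO _ bp).
  move/(cube1P l0) : yp => yp; apply/(cubeP l0) => i; rewrite yp.
  by have := bp i; have := nc i; have := mc i; lia.
rewrite (le_trans (average_chain (measurable_cube _ _ _ _) HC))//.
have -> : chain_cst * mesh l k * fine (maximal N h x) =
    (d * N)%:R * (mesh l k * (N%:R ^+ d * fine (maximal N h x))).
  by rewrite /chain_cst; ring.
apply: ler_pM => //.
- rewrite mulr_ge0 ?(ltW m0)// divr_ge0 ?exprn_ge0 ?(ltW m0)//.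
  exact: Rintegral_ge0.
- rewrite ler_nat -[d in (d * N)%N]card_ord -sum_nat_const leq_sum// => i _.
  by have := nc i; have := mc i; lia.
rewrite ler_wpM2l ?(ltW m0)//.
have : average h k c N <= fine (maximal N h x).
  rewrite -lee_fin fineK; first exact: le_maximal.
  by rewrite ge0_fin_numE// maximal_ge0.
have -> : \int[mu]_(x0 in cube l k c N) h x0 / mesh l k ^+ d =
    N%:R ^+ d * average h k c N.
  rewrite /average (exprMn d N%:R (mesh l k)).
  have : mesh l k ^+ d != 0 by rewrite expf_neq0// gt_eqF.
  have : N%:R ^+ d != 0 :> R by rewrite expf_neq0.
  move: (N%:R ^+ d) (mesh l k ^+ d) (Rintegral _ _ _) => a b I a0 b0.
  by field; rewrite a0 b0.
by move=> ah; rewrite ler_wpM2l// exprn_ge0.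
Qed.

Lemma averageS k c : loc_integrable u ->
  average u k c 1 = (2 ^ d)%:R^-1 * \sum_(e : {ffun 'I_d -> bool}) average u k.+1 (child c e) 1.
Proof.
move=> lu; have m0 := mesh_gt0 l0 k.+1.
rewrite /average !mul1r -mulr_suml Rintegral_children//; last exact: integrable_cube.
rewrite (meshS l k) (exprMn d 2 (mesh l k.+1)) natrX.
have : mesh l k.+1 ^+ d != 0 by rewrite expf_neq0// gt_eqF.
have : 2 ^+ d != 0 :> R by rewrite expf_neq0// pnatr_eq0.
move: (2 ^+ d) (mesh l k.+1 ^+ d) (\sum_(_ | _) _) => a b I a0 b0.
by field; rewrite a0 b0.
Qed.

(** By nesting, all the dyadic cubes containing such an [x] lie in [Om]. Finiteness matters because
    the estimates use [fine (maximal N h x)], and [fine] sends infinity to [0]. *)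
Definition good x := (maximal N h x < +oo)%E /\ cube l 0 (cell l 0 x) 1 `<=` Om.

Lemma between_children k c (e e' : {ffun 'I_d -> bool}) p :
  between (child c e) (child c e') p -> cube l k.+1 p 1 `<=` cube l k c 1.
Proof.
move=> bp y /(cube1P l0) yp; apply/(cube1P l0)/ffunP => i.
have cE (f : {ffun 'I_d -> bool}) : child c f i = 2 * c i + (f i : nat)%:Z by rewrite ffunE.
have := cellS l0 k y i; rewrite yp; have := bp i; rewrite !cE.
by case: (e i); case: (e' i) => /=; lia.
Qed.

(** The average over a cube is the mean of the averages over its [2 ^ d] children, and each child is
    joined to the one containing [x] by a walk among siblings, which does not leave the parent. *)
Lemma averageS_dist k x : loc_integrable u -> good x ->
  `|average u k.+1 (cell l k.+1 x) 1 - average u k (cell l k x) 1| <=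
  chain_cst * mesh l k.+1 * fine (maximal N h x).
Proof.
move=> lu [Mx xO]; set c := cell l k x.
have [e0 e0E] : exists e, cell l k.+1 x = child c e by exact/(cell_child l0).
rewrite (averageS k c lu) e0E.
set a := average u k.+1 _ 1; set K := _ * fine _.
have cardE : #|{ffun 'I_d -> bool}| = (2 ^ d)%N by rewrite card_ffun card_bool card_ord.
have n0 : (2 ^ d)%:R != 0 :> R by rewrite pnatr_eq0 expn_eq0.
have -> : a = (2 ^ d)%:R^-1 * \sum_(e : {ffun 'I_d -> bool}) a.
  by rewrite sumr_const cardE -(mulr_natl a) mulrA mulVf// mul1r.
rewrite -mulrBr -sumrB normrM ger0_norm ?invr_ge0//.
rewrite ler_pdivrMl ?ltr0n ?expn_gt0// mulr_natl -cardE -sumr_const.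
rewrite (le_trans (ler_norm_sum _ _ _))//; apply: ler_sum => e _.
have childE (f : {ffun 'I_d -> bool}) i : child c f i = 2 * c i + (f i : nat)%:Z by rewrite ffunE.
(* Since [2 <= N], the block with corner [2 * c] contains all the children, hence also [x]. *)
apply: (@average_chain_maximal k.+1 [ffun i => 2 * c i]) => //.
- apply/(cubeP l0) => i; rewrite e0E childE ffunE.
  by case: (e0 i) => /=; lia.
- by move=> i; rewrite childE ffunE; case: (e0 i) => /=; lia.
- by move=> i; rewrite childE ffunE; case: (e i) => /=; lia.
- move=> p /between_children pb; apply: subset_trans xO.
  apply: (subset_trans (pb k)); apply: (cube_nested l0 (leq0n k) (x := x)); exact: cell_cube.
Qed.

(** One refinement costs [mesh l k.+1], which equals [mesh l k - mesh l k.+1], so the costs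
    telescope exactly. *)
Lemma average_dist k j x : loc_integrable u -> good x -> (k <= j)%N ->
  `|average u j (cell l j x) 1 - average u k (cell l k x) 1| <=
  chain_cst * fine (maximal N h x) * (mesh l k - mesh l j).
Proof.
move=> lu gx kj; rewrite -(subnKC kj); elim: (j - k)%N => [|m IHm].
  by rewrite addn0 !subrr normr0 mulr0.
rewrite addnS -(subrKA (average u (k + m) (cell l (k + m) x) 1)).
rewrite (le_trans (ler_normD _ _))//.
have := averageS_dist (k + m) lu gx; rewrite (meshS l (k + m)) in IHm.
move: IHm; rewrite mulrBr [_ * (_ - _)]mulrBr.
rewrite [chain_cst * mesh _ _ * _]mulrAC => h1 h2.
apply: (le_trans (lerD h2 h1)); rewrite le_eqVlt; apply/orP; left; apply/eqP.
by ring.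
Qed.

(** By [average_dist], adding [K * mesh l k] turns the sequence of averages into a nonincreasing one
    that is bounded below, and the added term tends to [0]. *)
Lemma average_cvg x : loc_integrable u -> good x ->
  cvg (average u k (cell l k x) 1 @[k --> \oo]).
Proof.
move=> lu gx; set K := chain_cst * fine (maximal N h x).
pose B k := average u k (cell l k x) 1 + K * mesh l k.
have cK : K * mesh l k @[k --> \oo] --> (0 : R).
  by rewrite -(mulr0 K); apply: cvgM; [exact: cvg_cst|exact: mesh_cvg0].
have cB : cvg (B k @[k --> \oo]).
  apply: nonincreasing_is_cvgn.
    apply/nonincreasing_seqP => k; have := average_dist lu gx (leqnSn k).
    by rewrite -/K ler_norml mulrBr /B => /andP[_]; lra.
  exists (average u 0 (cell l 0 x) 1 - K * mesh l 0) => _ [k _ <-].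
  have := average_dist lu gx (leq0n k); rewrite -/K ler_norml mulrBr /B => /andP[].
  have : 0 <= K * mesh l k.
    rewrite mulr_ge0 ?(ltW (mesh_gt0 l0 k))// mulr_ge0 ?chain_cst_ge0//.
    exact: (fine_ge0 (maximal_ge0 x (ltnW N2) h0)).
  lra.
rewrite (_ : (fun k => _) = fun k => B k - K * mesh l k); last first.
  by apply/funext => k; rewrite /B addrK.
by apply: is_cvgB => //; apply: cvgP cK.
Qed.

End chain.
End averages.

Section real_integrable.
Context {disp : measure_display} {T : measurableType disp} {R : realType}.
Context (mu : {measure set T -> \bar R}) (D : set T) (mD : measurable D).
Implicit Types f g : T -> R.

Lemma integrable_addR f g : mu.-integrable D (EFin \o f) -> mu.-integrable D (EFin \o g) ->
  mu.-integrable D (EFin \o (fun x => f x + g x)).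
Proof.
move=> fi gi.
rewrite (_ : _ \o _ = (EFin \o f) \+ (EFin \o g))%E//; exact: integrableD.
Qed.

Lemma integrable_subR f g : mu.-integrable D (EFin \o f) -> mu.-integrable D (EFin \o g) ->
  mu.-integrable D (EFin \o (fun x => f x - g x)).
Proof.
move=> fi gi.
rewrite (_ : _ \o _ = (EFin \o f) \- (EFin \o g))%E//; exact: integrableB.
Qed.

Lemma integrable_scaleR (c : R) f : mu.-integrable D (EFin \o f) ->
  mu.-integrable D (EFin \o (fun x => c * f x)).
Proof.
move=> fi; rewrite (_ : _ \o _ = fun x => c%:E * (EFin \o f) x)%E//.
exact: integrableZl.
Qed.

Lemma integrable_cstR (c : R) : (mu D < +oo)%E -> mu.-integrable D (EFin \o cst c).
Proof.
move=> Doo; apply/integrableP; split; first exact/measurable_EFinP.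
rewrite (_ : (fun x => _) = cst `|c|%:E)//.
by rewrite integral_cst// lte_mul_pinfty.
Qed.

End real_integrable.

(** * Almost everywhere convergence of the averages *)

Section limit.
Context {R : realType} {d : nat} (l : R) (l0 : 0 < l).
Local Notation E := 'rV[R]_d.
Local Notation mu := (lebesgue_rV d).
Local Notation idx := {ffun 'I_d -> int}.
Implicit Types (k n : nat) (c m p : idx) (x : E).

(** A superlevel set is the union of the cubes whose average exceeds the level, and there are
    countably many cubes. *)
Lemma measurable_maximal N (h : E -> R) : measurable_fun setT (maximal l N h).
Proof.
move=> _; apply: (measurability _ (ErealGenOInfty.measurableE R)) => //.
move=> _ [_ [a ->] <-]; rewrite setTI.
rewrite (_ : _ @^-1` _ = \bigcup_(kc in [set: nat * idx])
    (if a < average l h kc.1 kc.2 N then cube l kc.1 kc.2 N else set0)).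
  apply: countable_bigcupT_measurable => // kc.
  by case: ifP => _; [exact: measurable_cube|exact: measurable0].
apply/seteqP; split => x /=; rewrite in_itv/= andbT.
  move=> /ereal_sup_gt[_ [kc xkc <-]] akc; exists kc => //.
  by rewrite -lte_fin akc.
move=> [kc _]; case: ifPn => // akc xkc.
by apply: lt_le_trans (le_maximal h xkc); rewrite lte_fin.
Qed.

Context (u h : E -> R) (g : 'I_d -> E -> R) (Om : set E) (N : nat).
Context (ug : forall i, weak_partial i u (g i)).
Context (h0 : forall x, 0 <= h x).
Context (ih : mu.-integrable setT (EFin \o h)).
Context (gh : forall i x, Om x -> `|g i x| <= h x).
Context (N2 : (2 <= N)%N).
Context (lu : loc_integrable u).

Let K : R := @chain_cst R d N.
Let Mf := maximal l N h.
Let A k x := average l u k (cell l k x) 1.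

(** This plays the part of Lebesgue's differentiation theorem. The averages converge where [Mf] is
    finite, and on each dyadic cube they are dominated by a constant plus a multiple of [Mf], which
    is integrable; so the limit [ut] has the same integral as [u] over every dyadic cube of [Q0],
    and equals [u] a.e. The rate is [average_dist] in the limit. *)
Lemma average_ae_limit c0 : cube l 0 c0 1 `<=` Om ->
  (\int[mu]_(x in cube l 0 c0 1) Mf x < +oo)%E ->
  {ae mu, forall x, cube l 0 c0 1 x -> (Mf x < +oo)%E /\
    forall k, `|u x - A k x| <= K * fine (Mf x) * mesh l k}.
Proof.
set Q0 := cube l 0 c0 1 => QO MQ.
have mM : measurable_fun setT Mf by exact: measurable_maximal.
have M0 x : (0 <= Mf x)%E by rewrite maximal_ge0// (leq_trans _ N2).
have K0 : 0 <= K by exact: chain_cst_ge0.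
have mQ0 : measurable Q0 by exact: measurable_cube.
have iM : mu.-integrable Q0 Mf.
  apply/integrableP; split; first exact: measurable_funTS.
  by under eq_integral do rewrite gee0_abs//.
pose G := [set x | (Mf x < +oo)%E].
have mG : measurable G by rewrite -[G]setTI; exact: emeasurable_fun_infty_o.
have goodG x : Q0 x -> G x -> good l h Om N x.
  by move=> /(cube1P l0) xc Gx; split => //; rewrite xc.
have aeG : {ae mu, forall x, Q0 x -> G x}.
  have := integrable_ae mQ0 iM; apply: filterS => x xM Qx.
  by rewrite /G/= -ge0_fin_numE//; exact: xM.
(* Cutting off the null part of [Q0] where [Mf] is infinite makes the sequence converge at every
   point of [Q0]. *)
pose A' k x := A k x * \1_G x.
have mA k : measurable_fun setT (A k).
  exact: (@measurable_cell_fun R d l l0 k (fun c => average l u k c 1)).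
have mA' k : measurable_fun setT (A' k) by apply: measurable_funM.
have dist k j x : Q0 x -> G x -> (k <= j)%N ->
    `|A j x - A k x| <= K * fine (Mf x) * (mesh l k - mesh l j).
  by move=> Qx Gx kj; exact: (average_dist l0 ug h0 ih gh N2 lu (goodG _ Qx Gx) kj).
pose ut x := lim (A' k x @[k --> \oo]).
have cvA x : Q0 x -> G x -> A k x @[k --> \oo] --> ut x.
  move=> Qx Gx; rewrite /ut /A' (_ : (fun k => _) = A^~ x).
    exact: (average_cvg l0 ug h0 ih gh N2 lu (goodG _ Qx Gx)).
  by apply/funext => k; rewrite indicE mem_set// mulr1.
have cvA' x : Q0 x -> A' k x @[k --> \oo] --> ut x.
  move=> Qx; have [Gx|Gx] := pselect (G x).
    rewrite /A' (_ : (fun k => _) = A^~ x); first exact: cvA.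
    by apply/funext => k; rewrite indicE mem_set// mulr1.
  rewrite /ut (_ : (fun k => A' k x) = cst 0); last first.
    by apply/funext => k; rewrite /A' indicE memNset// mulr0.
  by rewrite lim_cst//; exact: cvg_cst.
have cubeQ k c x : cube l k c 1 x -> Q0 x -> cube l k c 1 `<=` Q0.
  by move=> xc xQ; exact: (cube_nested l0 (leq0n k) xQ xc).
have mesh0 k : 0 <= mesh l k by rewrite ltW// mesh_gt0.
have domA k c j x : cube l k c 1 `<=` Q0 -> cube l k c 1 x -> (k <= j)%N ->
    `|A' j x| <= `|average l u k c 1| + K * mesh l k * fine (Mf x).
  move=> cQ xc kj; rewrite /A' indicE.
  have Mx0 := mulr_ge0 (mulr_ge0 K0 (mesh0 k)) (fine_ge0 (M0 x)).
  case: (boolP (x \in G)) => [|_]; last by rewrite mulr0 normr0 addr_ge0.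
  rewrite inE mulr1 => Gx; have := dist k j x (cQ _ xc) Gx kj.
  rewrite {2}/A; move/(cube1P l0) : (xc) => -> h1.
  rewrite -(subrK (average l u k c 1) (A j x)) addrC (le_trans (ler_normD _ _))//.
  rewrite lerD2l (le_trans h1)// mulrAC ler_wpM2r// ?fine_ge0//.
  by rewrite ler_wpM2l// gerBl.
have iD k c : cube l k c 1 `<=` Q0 -> mu.-integrable (cube l k c 1)
    (EFin \o (fun x => `|average l u k c 1| + K * mesh l k * fine (Mf x))).
  move=> cQ; have mc := measurable_cube l k c 1.
  apply: integrable_addR => //.
    have cfin : (mu (cube l k c 1) < +oo)%E by rewrite cube_measure// ltry.
    exact: integrable_cstR.
  apply: integrable_scaleR => //; apply: (integrableS mQ0 mc cQ).
  apply: (le_integrable mQ0 _ _ iM).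
    apply/measurable_EFinP; apply: measurable_funTS; exact: measurableT_comp.
  move=> x _; rewrite gee0_abs ?lee_fin ?fine_ge0// gee0_abs//.
  by rewrite /=; have := M0 x; case: (Mf x) => //=; rewrite ?leey.
have iA' k c j : cube l k c 1 `<=` Q0 -> (k <= j)%N ->
    mu.-integrable (cube l k c 1) (EFin \o A' j).
  move=> cQ kj; apply: (le_integrable _ _ _ (iD k c cQ)); first exact: measurable_cube.
    by apply/measurable_EFinP; exact: measurable_funTS.
  by move=> x xc; rewrite /= lee_fin (le_trans (domA _ _ _ _ cQ xc kj))// ler_norm.
have iu k c : mu.-integrable (cube l k c 1) (EFin \o u).
  exact: (integrable_cube l0).
(* Averaging at a finer generation preserves integrals over coarser cubes: split into children [n]
   times, down to cubes on which the average is constant. *)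
have intA' n k c : cube l k c 1 `<=` Q0 ->
    \int[mu]_(x in cube l k c 1) A' (k + n)%N x = \int[mu]_(x in cube l k c 1) u x.
  elim: n k c => [|n IHn] k c cQ.
    rewrite addn0; have mc := measurable_cube l k c 1.
    transitivity (\int[mu]_(x in cube l k c 1) average l u k c 1).
      congr fine; apply: ae_eq_integral => //.
      - by apply/measurable_EFinP; exact: measurable_funTS.
      - move: aeG; apply: filterS => x xG xc /=; congr EFin.
        rewrite /A' indicE mem_set ?mulr1; last exact/xG/cQ.
        by rewrite /A; move/(cube1P l0) : xc => ->.
    have cm : fine (mu (cube l k c 1)) = mesh l k ^+ d by rewrite cube_measure//= mul1r.
    rewrite Rintegral_cst// [X in _ * X]cm /average mul1r.
    by rewrite -mulrA mulVf ?mulr1// expf_neq0// gt_eqF// mesh_gt0.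
  rewrite addnS -addSn (Rintegral_children l0); last first.
    by apply: iA' => //; rewrite addSn leqW// leq_addr.
  rewrite (Rintegral_children l0)//; apply: eq_bigr => e _; apply: IHn.
  apply: subset_trans cQ => x /(cube1P l0) xe; apply/(cube1P l0)/(cell_child l0).
  by exists e.
have intut k c : cube l k c 1 `<=` Q0 ->
    mu.-integrable (cube l k c 1) (EFin \o ut) /\
    \int[mu]_(x in cube l k c 1) ut x = \int[mu]_(x in cube l k c 1) u x.
  move=> cQ; have mc := measurable_cube l k c 1.
  have mA'c n : measurable_fun (cube l k c 1) (A' (k + n)%N) by exact: measurable_funTS.
  have cv x : cube l k c 1 x -> A' (k + n)%N x @[n --> \oo] --> ut x.
    move=> xc; have := cvA' x (cQ _ xc); rewrite -(cvg_shiftn k).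
    by under eq_fun do rewrite addnC.
  have dom n x : cube l k c 1 x ->
      `|A' (k + n)%N x| <= `|average l u k c 1| + K * mesh l k * fine (Mf x).
    by move=> xc; apply: domA => //; exact: leq_addr.
  have [iut lim] := Rintegral_dominated mc mA'c cv (iD k c cQ) dom.
  split => //; move: lim; under eq_fun do rewrite intA'//.
  by move=> /cvg_lim <- //; rewrite lim_cst.
have aeu : {ae mu, forall x, Q0 x -> u x - ut x = 0}.
  apply: (dyadic_ae_eq0 l0).
    apply: (integrable_subR mQ0 (iu 0%N c0)).
    by have [] := intut 0%N c0 (@subset_refl _ _).
  move=> k c cQ; have [iut eut] := intut k c cQ.
  by rewrite RintegralB ?eut ?subrr//; exact: measurable_cube.
move: aeu aeG; apply: filterS2 => x xu xG Qx; split; first exact: xG.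
move=> k; have Gx := xG Qx.
have -> : u x = ut x by apply/eqP; rewrite -subr_eq0; apply/eqP/xu.
have lim1 : `|A j x - A k x| @[j --> \oo] --> `|ut x - A k x|.
  by apply: cvg_norm; apply: cvgB; [exact: cvA|exact: cvg_cst].
have lim2 : K * fine (Mf x) * mesh l k @[j --> \oo] --> K * fine (Mf x) * mesh l k.
  exact: cvg_cst.
apply: (ler_cvg_to lim1 lim2); near=> j.
rewrite (le_trans (dist k j x Qx Gx _))//; first by near: j; exact: nbhs_infty_ge.
by rewrite ler_wpM2l ?gerBl// mulr_ge0// fine_ge0.
Unshelve. all: by end_near. Qed.

End limit.

Lemma enorm_le {R : realType} m n (A B : 'M[R]_(m, n)) :
  (forall i j, `|A i j| <= `|B i j|) -> enorm A <= enorm B.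
Proof.
move=> AB; rewrite ler_wsqrtr//; apply: ler_sum => i _; apply: ler_sum => j _.
rewrite -[leLHS]real_normK ?num_real// -[leRHS]real_normK ?num_real//.
by rewrite ler_pXn2r// nnegrE.
Qed.

Lemma ae_forall_countable {disp} {T : measurableType disp} {R : realType}
    (mu : {measure set T -> \bar R}) (I : countType) (P : I -> T -> Prop) :
  (forall i, {ae mu, forall x, P i x}) -> {ae mu, forall x, forall i, P i x}.
Proof.
move=> aeP; have : {ae mu, forall x, forall n : nat, forall i : I, unpickle n = Some i -> P i x}.
  apply/ae_foralln => n; case E : (unpickle n) => [i|]; last exact: aeW.
  by move: (aeP i); apply: filterS => x Px j [<-].
by apply: filterS => x Px i; apply: (Px (pickle i)); rewrite pickleK.
Qed.

Lemma floor_near {R : realType} (a b : R) (D : nat) : a < b + D%:R ->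
  Num.floor a <= Num.floor b + D%:Z.
Proof.
move=> ab; rewrite -ltzD1 floor_lt_int (lt_trans ab)//.
have := floorD1_gt b; rewrite !rmorphD/=; lra.
Qed.

(** * Pointwise Lipschitz estimate with a maximal function *)

Section hajlasz.
Context {R : realType} {d : nat} (d0 : (0 < d)%N) (r : R) (r0 : 0 < r).
Local Notation E := 'rV[R]_d.
Local Notation mu := (lebesgue_rV d).
Local Notation idx := {ffun 'I_d -> int}.
Implicit Types (k n : nat) (c m p : idx) (x y z : E).

(** The vector with all coordinates [l] has norm at most [l *+ d = r]. With [N = 2 d + 1], two
    points whose coordinates differ by less than [2 d] meshes have cell indices at most [2 d] apart,
    hence share a block of side [N]. *)
Let l : R := r / d%:R.
Let N : nat := d.*2.+1.

Let dR : 0 < d%:R :> R. Proof. by rewrite ltr0n. Qed.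
Let l0 : 0 < l. Proof. by rewrite divr_gt0. Qed.
Let ld : l *+ d = r.
Proof. by rewrite -mulr_natr /l divfK// gt_eqF. Qed.

Lemma cell_near k x y (D : nat) i : `|x ord0 i - y ord0 i| < D%:R * mesh l k ->
  cell l k x i <= cell l k y i + D%:Z.
Proof.
have m0 := mesh_gt0 l0 k.
move=> xy; rewrite !ffunE; apply: floor_near; rewrite -ltrBlDl -mulrBl ltr_pdivrMr//.
by rewrite (le_lt_trans _ xy)// ler_norm.
Qed.

(** Each coordinate of [z] is at most [|x_i| + |y_i| + l] in absolute value, and the three vectors
    so bounding it have norm at most [r] each. This is the origin of the radius [3 * r]. *)
Lemma between_cube_ball k x y p z : eball r x -> eball r y ->
  between (cell l k x) (cell l k y) p -> cube l k p 1 z -> eball (3 * r) z.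
Proof.
rewrite /eball /= => xr yr bp /(cube1P l0) zp; have m0 := mesh_gt0 l0 k.
have ml := mesh_le l0 k.
pose a : E := \row_i (`|x ord0 i| + `|y ord0 i| + l).
pose vl : E := \row_i l; pose va (w : E) : E := \row_i `|w ord0 i|.
have va_le w : enorm (va w) <= enorm w.
  by apply: enorm_le => i j; rewrite mxE normr_id (ord1 i).
have vl_le : enorm vl <= r.
  by rewrite -ld; apply: enorm_rV_le => j; rewrite mxE gtr0_norm.
have aE : a = va x + va y + vl by apply/rowP => i; rewrite !mxE.
have : enorm a < 3 * r.
  rewrite aE; have := enormD (va x + va y) vl; have := enormD (va x) (va y).
  by have := va_le x; have := va_le y; lra.
apply: le_lt_trans; apply: enorm_le => i j; rewrite (ord1 i) !mxE.
rewrite [leRHS]ger0_norm; last by rewrite !addr_ge0// ltW.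
have cz := cell_cube l0 k z j; have cx := cell_cube l0 k x j; have cy := cell_cube l0 k y j.
have leM (s t : int) : s <= t -> s%:~R * mesh l k <= t%:~R * mesh l k :> R.
  by move=> st; rewrite ler_wpM2r ?(ltW m0)// ler_int.
move: cz cx cy; rewrite zp !mul1r => /andP[z1 z2] /andP[x1 x2] /andP[y1 y2].
have := ler_norm (x ord0 j); have := ler_norm (- x ord0 j).
have := ler_norm (y ord0 j); have := ler_norm (- y ord0 j).
have := normr_ge0 (x ord0 j); have := normr_ge0 (y ord0 j).
rewrite !normrN => h1 h2 h3 h4 h5 h6.
move: z1 z2 x1 x2 y1 y2.
have := bp j => /orP[] /andP[/leM + /leM].
  move: (_ * _) (_ * _) (_ * _) => s t w *; rewrite ler_norml; apply/andP; split; lra.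
move: (_ * _) (_ * _) (_ * _) => s t w *; rewrite ler_norml; apply/andP; split; lra.
Qed.

Context (u h : E -> R) (g : 'I_d -> E -> R).
Context (ug : forall i, weak_partial i u (g i)).
Context (h0 : forall x, 0 <= h x).
Context (ih : mu.-integrable setT (EFin \o h)).
Context (gh : forall i x, eball (3 * r) x -> `|g i x| <= h x).
Context (iM : forall c0, (\int[mu]_(x in cube l 0 c0 1) maximal l N h x < +oo)%E).

Let K : R := @chain_cst R d N.

(* P x bounds the distance from u x to the averages of u over the dyadic cubes
   containing x; the averages at x and y are compared at the scale of |x - y|. *)
Lemma hajlasz_pointwise : exists P : E -> Prop,
  {ae mu, forall x, eball r x -> P x} /\
  forall x y, eball r x -> eball r y -> P x -> P y ->
    `|u x - u y| <= 4 * K * enorm (x - y) *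
      (fine (maximal l N h x) + fine (maximal l N h y)).
Proof.
pose A k x := average l u k (cell l k x) 1.
exists (fun x => (maximal l N h x < +oo)%E /\
  forall k, `|u x - A k x| <= K * fine (maximal l N h x) * mesh l k).
have N2 : (2 <= N)%N by rewrite /N -addnn; lia.
have lu : loc_integrable u by have [] := ug (Ordinal d0).
have K0 : 0 <= K by exact: chain_cst_ge0.
have M0 x : (0 <= maximal l N h x)%E by rewrite maximal_ge0.
split.
  have : {ae mu, forall x, forall c0, cube l 0 c0 1 `<=` eball (3 * r) -> cube l 0 c0 1 x ->
      (maximal l N h x < +oo)%E /\
      forall k, `|u x - A k x| <= K * fine (maximal l N h x) * mesh l k}.
    apply: ae_forall_countable => c0.
    have [cO|ncO] := pselect (cube l 0 c0 1 `<=` eball (3 * r)); last first.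
      by apply: aeW => x /ncO.
    have := average_ae_limit l0 ug h0 ih gh N2 lu cO (iM c0).
    by apply: filterS => x Px _.
  apply: filterS => x Px xr; apply: (Px (cell l 0 x)); last exact: cell_cube.
  move=> z zc; apply: (between_cube_ball xr xr _ zc) => i.
  by rewrite lexx.
move=> x y xr yr [Mx Px] [My Py].
have [->|xy] := eqVneq x y.
  rewrite !subrr normr0 !mulr_ge0// ?enorm_ge0// addr_ge0// fine_ge0//.
set t := enorm (x - y).
have t0 : 0 < t.
  rewrite lt_neqAle enorm_ge0 andbT eq_sym; apply/eqP => /enorm_eq0/eqP.
  by rewrite subr_eq0 (negbTE xy).
have ti i : `|x ord0 i - y ord0 i| <= t by have := enorm_entry (x - y) ord0 i; rewrite !mxE.
have exk : exists k, mesh l k <= 2 * t.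
  have /cvgr0Pnorm_le/(_ (2 * t)) := @mesh_cvg0 R l.
  case; first by rewrite mulr_gt0.
  by move=> k _ /(_ k (leqnn k))/= mk; exists k; rewrite (le_trans (ler_norm _)).
(* Take the least [k] with [mesh l k <= 2 * t]. If [k] is positive, minimality gives [t < mesh l k];
   if [k] is [0], the bound is [|x_i - y_i| < 2 * r], which is [2 d] meshes. *)
have [k mk] : exists2 k, mesh l k <= 2 * t &
    forall i, `|x ord0 i - y ord0 i| < d.*2%:R * mesh l k.
  case: (ex_minnP exk) => k mk kmin; exists k => // i.
  case: k mk kmin => [|k] mk kmin.
    rewrite /mesh expr0 divr1 -mul2n natrM -mulrA [d%:R * l]mulrC mulr_natr ld.
    rewrite (le_lt_trans (ler_normB _ _))//.
    have := enorm_entry x ord0 i; have := enorm_entry y ord0 i.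
    by move: xr yr; rewrite /eball/=; lra.
  have : 2 * t < mesh l k.
    by rewrite ltNge; apply/negP => /kmin; rewrite ltnn.
  rewrite meshS ltr_pM2l// => tm; rewrite (le_lt_trans (ti i))//.
  rewrite (lt_le_trans tm)// ler_peMl ?(ltW (mesh_gt0 l0 _))//.
  by rewrite ler1n double_gt0.
move=> near_xy.
have cxy i : cell l k x i <= cell l k y i + d.*2%:Z by exact: cell_near.
have cyx i : cell l k y i <= cell l k x i + d.*2%:Z by apply: cell_near; rewrite distrC.
pose c : idx := [ffun i => Num.min (cell l k x i) (cell l k y i)].
have cx i : c i <= cell l k x i < c i + N%:Z.
  by rewrite ffunE; have := cxy i; have := cyx i; rewrite /N; lia.
have cy i : c i <= cell l k y i < c i + N%:Z.
  by rewrite ffunE; have := cxy i; have := cyx i; rewrite /N; lia.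
have xC : cube l k c N x by exact/(cubeP l0).
have h1 : `|A k x - A k y| <= K * mesh l k * fine (maximal l N h x).
  apply: (average_chain_maximal l0 ug h0 ih gh N2 xC cx cy) => //.
  by move=> p bp z; exact: (between_cube_ball xr yr bp).
have := Px k; have := Py k.
have -> : u x - u y = (u x - A k x) + (A k x - A k y) + (A k y - u y) by ring.
rewrite (distrC (u y)) => h2 h3.
rewrite (le_trans (ler_normD _ _))//.
have h4 := ler_normD (u x - A k x) (A k x - A k y).
have Fx := fine_ge0 (M0 x); have Fy := fine_ge0 (M0 y).
(* The three pieces carry [K * mesh l k] times [M x], [M x] and [M y], so at most [2 * K * mesh l k]
   times the sum; the choice of scale [mesh l k <= 2 * t] gives the factor 4. *)
have h5 : 2 * K * mesh l k * (fine (maximal l N h x) + fine (maximal l N h y)) <=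
    4 * K * t * (fine (maximal l N h x) + fine (maximal l N h y)).
  rewrite ler_wpM2r ?addr_ge0//.
  by have := ler_wpM2l K0 mk; lra.
apply: le_trans h5.
have h6 := mulr_ge0 (mulr_ge0 K0 (ltW (mesh_gt0 l0 k))) Fy.
move: h1 h2 h3 h4 h6; move: (fine _) (fine _) => a b; lra.
Qed.

End hajlasz.

(** * Weak type inequality and integral of the maximal function *)

Section maximal_bound.
Context {R : realType} {d : nat} (l : R) (l0 : 0 < l) (N : nat) (N0 : (0 < N)%N).
Local Notation E := 'rV[R]_d.
Local Notation mu := (lebesgue_rV d).
Local Notation idx := {ffun 'I_d -> int}.
Implicit Types (k n : nat) (c m p : idx) (x y z : E) (kc : nat * idx) (s t : seq (nat * idx)).

Let C kc := cube l kc.1 kc.2 N.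

(** The block [C kc] dilated by three about its centre: the corner moves back by [N] cells. *)
Definition triple kc : set E := cube l kc.1 [ffun i => kc.2 i - N%:Z] (3 * N).

Lemma triple_measure kc : mu (triple kc) = ((3 ^ d)%:R%:E * mu (C kc))%E.
Proof.
rewrite !cube_measure// -EFinM natrX -exprMn; congr (_ ^+ _)%:E.
by rewrite natrM -mulrA.
Qed.

Lemma mesh_antitone k n : (k <= n)%N -> mesh l n <= mesh l k.
Proof.
move=> kn; rewrite ler_pM2l// lef_pV2 ?posrE ?exprn_gt0//.
by rewrite ler_weXn2l// ler1n.
Qed.

Lemma cube_sub_triple kc kc' : (kc'.1 <= kc.1)%N -> C kc `&` C kc' !=set0 ->
  C kc `<=` triple kc'.
Proof.
move=> kk [w [wC wC']] z zC i; have := wC i; have := wC' i; have := zC i.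
rewrite ffunE rmorphB/= natrM.
have := mesh_antitone kk; have := mesh_gt0 l0 kc.1.
move: (mesh l kc.1) (mesh l kc'.1) => a b a0 ab.
have Nab : N%:R * a <= N%:R * b :> R by rewrite ler_wpM2l.
rewrite mulrBl -!mulrA.
rewrite -[(Posz N)%:~R]/(N%:R : R).
move: Nab; move: (_ * a) (_ * b) (_ * a) (_ * b) => e f g h eg.
move=> /andP[z1 z2] /andP[w1 w2] /andP[w3 w4]; apply/andP; split; lra.
Qed.

Lemma cube_nonempty kc : C kc !=set0.
Proof.
exists (\row_i ((kc.2 i)%:~R * mesh l kc.1)) => i; rewrite mxE lexx/= ltrDl.
by rewrite mulr_gt0 ?ltr0n// mesh_gt0.
Qed.

(** Vitali's selection, needed since blocks of side [N] overlap without being nested. With the list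
    sorted from fine to coarse, the head is kept if it is disjoint from the selection made in the
    tail; otherwise it meets a selected block at least as large, whose triple contains it. *)
Lemma vitali_cubes s : exists t : seq (nat * idx),
  [/\ uniq t, {subset t <= s}, trivIset [set` t] C &
      forall kc, kc \in s -> exists2 kc', kc' \in t & C kc `<=` triple kc'].
Proof.
wlog ss : s / sorted (fun a b : nat * idx => (b.1 <= a.1)%N) s.
  move=> H; pose leT := fun a b : nat * idx => (b.1 <= a.1)%N.
  have [t [ut ts tC cov]] := H (sort leT s) (sort_sorted (fun a b => leq_total _ _) s).
  exists t; split => //; first by move=> a /ts; rewrite mem_sort.
  by move=> kc kcs; apply: cov; rewrite mem_sort.
elim: s ss => [_|a s IHs /= ps]; first by exists [::]; split => //; exact: trivIset_set0.
have tr : transitive (fun a b : nat * idx => (b.1 <= a.1)%N).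
  by move=> y x z xy yz; exact: leq_trans yz xy.
have [t [ut ts tC cov]] := IHs (path_sorted ps).
have amin : all (fun b : nat * idx => (b.1 <= a.1)%N) s by exact: order_path_min ps.
have [[b bt abI]|nI] := pselect (exists2 b, b \in t & C a `&` C b !=set0).
  exists t; split => //; first by move=> x /ts; rewrite inE orbC => ->.
  move=> kc; rewrite inE => /predU1P[->|/cov//]; exists b => //.
  by apply: cube_sub_triple => //; exact: (allP amin _ (ts _ bt)).
have nat_t b : b \in t -> C a `&` C b = set0.
  by move=> bt; apply/eqP; apply/negP => /negP/set0P abI; apply: nI; exists b.
have at_ : a \notin t.
  apply/negP => /nat_t; rewrite setIid => Ca.
  by have [x] := cube_nonempty a; rewrite Ca.
exists (a :: t); split => /=.
- by rewrite at_.
- by move=> x; rewrite !inE => /predU1P[->|/ts ->]; rewrite ?eqxx// orbT.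
- move/trivIsetP : tC => tC; apply/trivIsetP => x y; rewrite /= !inE.
  move=> /predU1P[->|xt] /predU1P[->|yt] xy; first by rewrite eqxx in xy.
  + exact: nat_t.
  + by rewrite setIC; exact: nat_t.
  + exact: tC.
move=> kc; rewrite inE => /predU1P[->|/cov[b bt kcb]].
  exists a; first by rewrite inE eqxx.
  by apply: cube_sub_triple => //; rewrite setIid; exact: cube_nonempty.
by exists b => //; rewrite inE bt orbT.
Qed.

Context (h : E -> R).
Context (h0 : forall x, 0 <= h x).
Context (ih : mu.-integrable setT (EFin \o h)).
Context (q : R).
Context (q1 : 1 < q).
Local Notation hq := (fun x => (h x `^ q)%:E).

Let mh : measurable_fun setT h.
Proof. by have /integrableP[/measurable_EFinP] := ih. Qed.

Let mhq : measurable_fun setT (fun x => h x `^ q).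
Proof. exact: (measurableT_comp (measurable_powR _)). Qed.

(** Convexity of the power [q], obtained from Young's inequality for [t] and the power [q - 1] of
    [a]. *)
Lemma tangent_powR (a t : R) : 0 < a -> 0 <= t ->
  a `^ q + q * a `^ (q - 1) * (t - a) <= t `^ q.
Proof.
move=> a0 t0; have q0 : 0 < q by rewrite (lt_trans _ q1).
have p0 : 0 < q / (q - 1) by rewrite divr_gt0// subr_gt0.
have := @conjugate_powR R t (a `^ (q - 1)) q (q / (q - 1)) t0 (powR_ge0 _ _) q0 p0.
rewrite -powRrM mulrCA divff ?mulr1; last by rewrite gt_eqF// subr_gt0.
have -> : q^-1 + (q / (q - 1))^-1 = 1.
  by field; rewrite subr_eq0 !gt_eqF//.
move=> /(_ erefl).
have <- := mulr_powRB1 (ltW a0) q0; move: (a `^ (q - 1)) (t `^ q) => b e.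
rewrite invf_div => H.
have : q * (t * b) <= q * (e / q + a * b * ((q - 1) / q)) by rewrite ler_pM2l.
have -> : q * (e / q + a * b * ((q - 1) / q)) = e + a * b * (q - 1).
  by field; rewrite gt_eqF.
lra.
Qed.

Context (ihq : mu.-integrable setT hq).
Let Hq : R := \int[mu]_x (h x `^ q).

(** Jensen's inequality in the form needed here: integrate [tangent_powR] over the block; the linear
    term is nonnegative because the average exceeds [a]. *)
Lemma cube_average_powR (a : R) kc : 0 < a -> a < average l h kc.1 kc.2 N ->
  ((a `^ q)%:E * mu (C kc) <= \int[mu]_(x in C kc) hq x)%E.
Proof.
move=> a0 ah; have q0 : 0 < q by rewrite (lt_trans _ q1).
set V := (N%:R * mesh l kc.1) ^+ d.
have V0 : 0 < V by rewrite exprn_gt0// mulr_gt0 ?ltr0n// mesh_gt0.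
have CV : mu (C kc) = V%:E by rewrite cube_measure.
have mC : measurable (C kc) by exact: measurable_cube.
have iC f : mu.-integrable setT f -> mu.-integrable (C kc) f.
  by move=> fi; exact: (integrableS _ _ _ fi).
have Coo : (mu (C kc) < +oo)%E by rewrite CV ltry.
have := ah; rewrite /average ltr_pdivlMr// => aV.
have ihl : mu.-integrable (C kc)
    (EFin \o (fun x => a `^ q + q * a `^ (q - 1) * (h x - a))).
  apply: integrable_addR => //; first exact: integrable_cstR.
  apply: integrable_scaleR => //; apply: integrable_subR => //; first exact: iC.
  exact: integrable_cstR.
have : \int[mu]_(x in C kc) (a `^ q + q * a `^ (q - 1) * (h x - a)) <=
    \int[mu]_(x in C kc) (h x `^ q).
  apply: le_Rintegral => //; first exact: iC.
  by move=> x _; exact: tangent_powR.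
rewrite RintegralD//; last 2 first.
- exact: integrable_cstR.
- apply: integrable_scaleR => //; apply: integrable_subR => //; first exact: iC.
  exact: integrable_cstR.
rewrite RintegralZl//; last first.
  by apply: integrable_subR => //; [exact: iC|exact: integrable_cstR].
rewrite RintegralB//; [|exact: iC|exact: integrable_cstR].
have cE (b : R) : \int[mu]_(x in C kc) b = b * V by rewrite Rintegral_cst// [X in _ * fine X]CV.
rewrite !cE => H.
rewrite CV -EFinM -[leRHS]fineK ?lee_fin; last first.
  by apply: integrable_fin_num => //; exact: iC.
rewrite -[fine _]/(\int[mu]_(x in C kc) (h x `^ q)).
apply: le_trans H; rewrite lerDl !mulr_ge0 ?powR_ge0 ?(ltW q0)//.
by rewrite subr_ge0 ltW.
Qed.

(** The triples of the selected blocks cover the union, whence [3 ^ d]; each selected block is paid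
    for by the integral of the power of [h] over it, and these blocks are disjoint. *)
Lemma weak_type_seq (a : R) s : 0 < a ->
  (forall kc, kc \in s -> a < average l h kc.1 kc.2 N) ->
  (mu (\big[setU/set0]_(kc <- s) C kc) <= ((3 ^ d)%:R / a `^ q * Hq)%:E)%E.
Proof.
move=> a0 sa; have [t [ut ts tC cov]] := vitali_cubes s.
have mC kc : measurable (C kc) by exact: measurable_cube.
have mT kc : measurable (triple kc) by exact: measurable_cube.
have aq0 : 0 < a `^ q by rewrite powR_gt0.
apply: (@le_trans _ _ (mu (\big[setU/set0]_(kc <- t) triple kc))).
  apply: le_measure; rewrite ?inE; [exact: bigsetU_measurable|exact: bigsetU_measurable|].
  rewrite -!bigcup_seq => x [kc /= kcs xkc]; have [kc' kct sub] := cov _ kcs.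
  by exists kc' => //; exact: sub.
apply: (@le_trans _ _ (\sum_(kc <- t) mu (triple kc))%E).
  elim: t {ut ts tC cov} => [|kc t IH]; first by rewrite !big_nil measure0.
  rewrite !big_cons; apply: le_trans (measureU2 _ _ _) _ => //.
    exact: bigsetU_measurable.
  by rewrite leeD2l.
apply: (@le_trans _ _ (\sum_(kc <- t) ((3 ^ d)%:R / a `^ q)%:E * \int[mu]_(x in C kc) hq x)%E).
  rewrite big_seq [leRHS]big_seq; apply: lee_sum => kc kct.
  rewrite triple_measure EFinM -muleA lee_wpmul2l//.
  rewrite muleC lee_pdivlMr//; rewrite muleC.
  exact: cube_average_powR (sa _ (ts _ kct)).
rewrite -ge0_sume_distrr; last by move=> kc _; apply: integral_ge0 => x _; rewrite lee_fin powR_ge0.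
rewrite [X in (_ <= X)%E]EFinM lee_wpmul2l//; first by rewrite lee_fin divr_ge0// ltW.
rewrite -(@ge0_integral_bigsetU _ _ _ mu _ C _ t mC ut tC); first last.
- by move=> x _; rewrite lee_fin powR_ge0.
- by apply/measurable_EFinP; exact: measurable_funTS.
rewrite /Hq /Rintegral fineK; last by apply: integrable_fin_num.
apply: ge0_subset_integral => //; first exact: bigsetU_measurable.
- exact/measurable_EFinP.
- by move=> x _; rewrite lee_fin powR_ge0.
Qed.

(** The superlevel set is a countable union of blocks: enumerate the pairs by [unpickle], bound the
    first [n] of them uniformly by [weak_type_seq], and use continuity of the measure from below. *)
Lemma weak_type (a : R) : 0 < a ->
  (mu [set x | a%:E < maximal l N h x] <= ((3 ^ d)%:R / a `^ q * Hq)%:E)%E.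
Proof.
move=> a0; pose S n := [seq kc <- pmap (@unpickle (nat * idx)%type) (iota 0 n) | a < average l h kc.1 kc.2 N].
pose F n := \big[setU/set0]_(kc <- S n) C kc.
have mF n : measurable (F n) by apply: bigsetU_measurable => kc _; exact: measurable_cube.
have FE : [set x | (a%:E < maximal l N h x)%E] = \bigcup_n F n.
  apply/seteqP; split => x /=.
    move=> /ereal_sup_gt[_ [kc xkc <-]]; rewrite lte_fin => akc.
    exists (pickle kc).+1 => //; rewrite /F -bigcup_seq; exists kc => //.
    rewrite /mkset mem_filter akc andTb mem_pmap; apply/mapP; exists (pickle kc); last by rewrite pickleK.
    by rewrite mem_iota add0n leq0n ltnS leqnn.
  move=> [n _]; rewrite /F -bigcup_seq => -[kc /=]; rewrite mem_filter => /andP[akc _] xkc.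
  by apply: lt_le_trans (le_maximal h xkc); rewrite lte_fin.
have ndF : {homo F : n m / (n <= m)%N >-> (n <= m)%O}.
  move=> n m nm; apply/subsetPset; rewrite /F -!bigcup_seq => x [kc /= kcn xkc].
  exists kc => //=; move: kcn; rewrite !mem_filter => /andP[->/=].
  rewrite !mem_pmap => /mapP[i]; rewrite mem_iota add0n => /andP[_ im] iE.
  by apply/mapP; exists i => //; rewrite mem_iota add0n /= (leq_trans im).
have mU : measurable (\bigcup_n F n) by exact: bigcup_measurable.
rewrite FE; have := @nondecreasing_cvg_mu _ _ _ mu _ mF mU ndF.
move=> /cvg_lim <- //; apply: lime_le.
  by apply: ereal_nondecreasing_is_cvgn => n m nm; apply: le_measure; rewrite ?inE//; exact/subsetPset/ndF.
by apply: nearW => n; apply: weak_type_seq => // kc; rewrite mem_filter => /andP[].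
Qed.

Let Mf := maximal l N h.
Let mM : measurable_fun setT Mf := measurable_maximal l N h.
Let M0 x : (0 <= Mf x)%E. Proof. exact: maximal_ge0. Qed.

(** The 2 is the ratio of consecutive levels, [3 ^ d] comes from the covering, and the denominator
    from the geometric series of ratio [2^(1-q)], convergent as [1 < q]. *)
Definition kolmogorov_cst : R := 2 * (3 ^ d)%:R / (1 - 2 `^ (1 - q)).

Let rho : R := 2 `^ (1 - q).
Let rho_lt1 : rho < 1.
Proof.
have q10 : 0 < q - 1 by rewrite subr_gt0.
rewrite /rho -opprB powRN invf_lt1 ?powR_gt0//.
have := @gt0_ltr_powR R (q - 1) q10 1 2; rewrite !nnegrE powR1; apply => //.
by rewrite ltr1n.
Qed.
Let rho_ge0 : 0 <= rho. Proof. exact: powR_ge0. Qed.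

Lemma kolmogorov_cst_ge0 : 0 <= kolmogorov_cst.
Proof. by rewrite divr_ge0// ?mulr_ge0// subr_ge0 ltW. Qed.

Let level (a : R) (j : nat) : R := 2 ^+ j * a.
Let G (a : R) (j : nat) : set E := [set x | ((level a j)%:E < Mf x)%E].

Let mG a j : measurable (G a j).
Proof.
by rewrite -[G a j]setTI; apply: emeasurable_fun_o_infty.
Qed.

(** Dyadic layer cake: if [Mf x] exceeds the level of index [n], the last summand alone is the level
    of index [n.+1]; otherwise raising the truncation changes nothing. *)
Lemma min_maximal_le (a : R) n x : 0 < a ->
  (mine (Mf x) (level a n)%:E <= a%:E + \sum_(j < n) (2 * level a j)%:E * (\1_(G a j) x)%:E)%E.
Proof.
move=> a0; have lev0 j : 0 < level a j by rewrite mulr_gt0// exprn_gt0.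
elim: n => [|n IHn].
  by rewrite big_ord0 adde0 /level expr0 mul1r ge_min lexx orbT.
rewrite big_ord_recr/= addeA; set S := (a%:E + _)%E in IHn *.
have S0 : (0 <= S)%E.
  apply: adde_ge0; first by rewrite lee_fin ltW.
  by apply: sume_ge0 => j _; rewrite -EFinM lee_fin mulr_ge0// mulr_ge0// ltW.
have levS : level a n.+1 = 2 * level a n by rewrite /level exprS mulrA.
have [Gx|Gx] := pselect (G a n x).
  rewrite indicE mem_set// mule1 levS (@le_trans _ _ (2 * level a n)%:E)//.
    by rewrite ge_min lexx orbT.
  by rewrite leeDr.
rewrite indicE memNset// mule0 adde0; apply: le_trans IHn.
have MG : (Mf x <= (level a n)%:E)%E by rewrite leNgt; exact/negP.
by rewrite (min_l MG) ge_min lexx.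
Qed.

(** Each term is proportional to the power [1 - q] of [2 ^+ j * a], which makes a geometric sum of
    ratio [rho]. *)
Lemma level_sum_le (a : R) n : 0 < a ->
  \sum_(j < n) 2 * level a j * ((3 ^ d)%:R / level a j `^ q * Hq) <=
  kolmogorov_cst * a `^ (1 - q) * Hq.
Proof.
move=> a0; have lev0 j : 0 < level a j by rewrite mulr_gt0// exprn_gt0.
have Hq0 : 0 <= Hq by apply: Rintegral_ge0 => x _; rewrite powR_ge0.
have termE j : 2 * level a j * ((3 ^ d)%:R / level a j `^ q * Hq) =
    2 * (3 ^ d)%:R * a `^ (1 - q) * Hq * rho ^+ j.
  have e : rho ^+ j * a `^ (1 - q) = level a j / level a j `^ q.
    transitivity (level a j `^ (1 - q)).
      rewrite /level powRM ?(ltW a0) ?exprn_ge0//; congr (_ * _).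
      by rewrite -(powR_mulrn j rho_ge0) /rho powRAC powR_mulrn.
    rewrite powRB ?powRr1 ?(ltW (lev0 j))//.
    by apply/implyP => _; rewrite gt_eqF.
  transitivity (2 * (3 ^ d)%:R * Hq * (level a j / level a j `^ q)); first by ring.
  by rewrite -e; ring.
under eq_bigr do rewrite termE.
rewrite -mulr_sumr /kolmogorov_cst -/rho.
have geo : \sum_(j < n) rho ^+ j <= (1 - rho)^-1.
  rewrite -[leRHS]mul1r ler_pdivlMr ?subr_gt0// mulrC.
  have := subrX1 rho n; have : 0 <= rho ^+ n by exact: exprn_ge0.
  by move: (rho ^+ n) (\sum_(_ < _) _) => z S; lra.
have -> : 2 * (3 ^ d)%:R / (1 - rho) * a `^ (1 - q) * Hq =
  2 * (3 ^ d)%:R * a `^ (1 - q) * Hq * (1 - rho)^-1 by ring.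
by rewrite ler_wpM2l// !mulr_ge0// powR_ge0.
Qed.

(* The weak type inequality summed over the levels 2^j a. *)
Lemma kolmogorov_level (a : R) (B : set E) : 0 < a -> measurable B -> (mu B < +oo)%E ->
  (\int[mu]_(x in B) Mf x <=
   a%:E * mu B + (kolmogorov_cst * a `^ (1 - q) * Hq)%:E)%E.
Proof.
move=> a0 mB Boo.
have lev0 j : 0 < level a j by rewrite mulr_gt0// exprn_gt0.
(* Truncation keeps the number of layers finite; monotone convergence removes it, the bound being
   uniform in [n]. *)
pose f n x := mine (Mf x) (level a n)%:E.
have mf n : measurable_fun B (f n).
  by apply: measurable_funTS; apply: measurable_mine.
have f0 n x : B x -> (0 <= f n x)%E.
  by move=> _; rewrite /f le_min M0 lee_fin ltW.
have ndf x : B x -> {homo f^~ x : n m / (n <= m)%N >-> (n <= m)%E}.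
  move=> _ n m nm; rewrite /f le_min ge_min lexx/= ge_min; apply/orP; right.
  by rewrite lee_fin ler_pM2r// ler_weXn2l// ler1n.
have limf x : B x -> lim (f n x @[n --> \oo]) = Mf x.
  move=> _; apply/cvg_lim => //; rewrite /f; have := M0 x; case: (Mf x) => [m _| _|//].
    apply: cvg_near_cst; near=> n; rewrite min_l// lee_fin.
    rewrite -ler_pdivrMr// (@le_trans _ _ n%:R)//.
      by near: n; exact: nbhs_infty_ger.
    by rewrite -natrX ler_nat ltnW// ltn_expl.
  rewrite (_ : (fun n => _) = EFin \o level a); last first.
    by apply/funext => n /=; rewrite min_r// leey.
  apply/cvgeryP/cvgryPge => A; near=> n.
  rewrite -ler_pdivrMr// (@le_trans _ _ n%:R)//.
    by near: n; exact: nbhs_infty_ger.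
  by rewrite -natrX ler_nat ltnW// ltn_expl.
have -> : (\int[mu]_(x in B) Mf x = \int[mu]_(x in B) (lim (f n x @[n --> \oo])))%E.
  by apply: eq_integral => x /set_mem Bx; rewrite limf.
rewrite (monotone_convergence mu mB mf f0 ndf); apply: lime_le.
  apply: ereal_nondecreasing_is_cvgn => n m nm.
  by apply: ge0_le_integral => //; [exact: f0|move=> x Bx; exact: ndf].
apply: nearW => n.
have Hq0 : 0 <= Hq by apply: Rintegral_ge0 => x _; rewrite powR_ge0.
apply: (@le_trans _ _ (\int[mu]_(x in B)
    (a%:E + \sum_(j < n) (2 * level a j)%:E * (\1_(G a j) x)%:E))%E).
  apply: ge0_le_integral => //; [exact: f0| |].
  - apply: emeasurable_funD => //; apply: emeasurable_sum => j.
    apply/measurable_EFinP; apply: measurable_funM => //.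
  - by move=> x _; exact: min_maximal_le.
rewrite ge0_integralD//; first last.
- apply: emeasurable_sum => j.
  by apply/measurable_EFinP; apply: measurable_funM.
- by move=> x _; apply: sume_ge0 => j _; rewrite -EFinM lee_fin mulr_ge0// mulr_ge0// ltW.
- by move=> x _; rewrite lee_fin ltW.
rewrite integral_cst// leeD2l//.
rewrite ge0_integral_sum//; first last.
- by move=> j x _; rewrite -EFinM lee_fin mulr_ge0// mulr_ge0// ltW.
- by move=> j; apply/measurable_EFinP; apply: measurable_funM.
apply: (@le_trans _ _ (\sum_(j < n) (2 * level a j * ((3 ^ d)%:R / level a j `^ q * Hq))%:E)%E); last first.
  by rewrite sumEFin lee_fin level_sum_le.
apply: lee_sum => j _; rewrite ge0_integralZl//; first last.
- by rewrite lee_fin mulr_ge0// ltW.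
- by apply/measurable_EFinP.
rewrite [X in (_ <= X)%E]EFinM lee_wpmul2l//; first by rewrite lee_fin mulr_ge0// ltW.
rewrite integral_indic//; apply: le_trans (weak_type (lev0 j)).
apply: le_measure; rewrite ?inE; [exact: measurableI|exact: mG|].
by move=> x [].
Unshelve. all: by end_near. Qed.

End maximal_bound.

Lemma LpNorm_powR {disp} {T : measurableType disp} {R : realType}
    (mu : {measure set T -> \bar R}) (q : R) (D : set T) (w : T -> R) :
  0 < q -> (forall x, 0 <= w x) ->
  (LpNorm mu q%:E D w `^ q = \int[mu]_x ((w x * \1_D x) `^ q)%:E)%E.
Proof.
move=> q0 w0; rewrite /LpNorm (poweR_Lnorm _ _ (lt0r_neq0 q0)).
apply: eq_integral => x _ /=.
by rewrite ger0_norm ?mulr_ge0// indicE.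
Qed.

Section ball_measure.
Context {R : realType} {d : nat}.
Local Notation E := 'rV[R]_d.
Local Notation mu := (lebesgue_rV d).

Lemma eball_lty (r : R) : (mu (eball r) < +oo)%E.
Proof.
pose b : 'I_d -> R := fun=> `|r| + 1; pose a : 'I_d -> R := fun=> - (`|r| + 1).
have : (mu (eball r) <= mu (box a b))%E.
  apply: le_measure; rewrite ?inE; [exact: measurable_eball|exact: measurable_box|].
  move=> x; rewrite /eball/= => xr i; have := enorm_entry x ord0 i.
  have := ler_norm r; rewrite /a /b => h1 h2.
  have : `|x ord0 i| < `|r| + 1 by lra.
  by rewrite ltr_norml => /andP[/ltW -> ->].
move=> /le_lt_trans; apply; rewrite lebesgue_rV_halfopen ?ltry// => i.
by rewrite /a /b; have := normr_ge0 r; lra.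
Qed.

Lemma eball_gt0 (r : R) : 0 < r -> (0 < mu (eball r))%E.
Proof.
move=> r0; pose b : 'I_d -> R := fun=> r / d.+1%:R.
have b0 i : 0 < b i by rewrite divr_gt0.
pose a : 'I_d -> R := fun=> 0.
have : (mu (box a b) <= mu (eball r))%E.
  apply: le_measure; rewrite ?inE; [exact: measurable_box|exact: measurable_eball|].
  move=> x xb; rewrite /eball/= (@le_lt_trans _ _ (r / d.+1%:R *+ d))//.
    apply: enorm_rV_le => j; have /andP[h1 h2] := xb j.
    by rewrite ger0_norm// ltW.
  by rewrite -mulr_natr mulrAC ltr_pdivrMr// ltr_pM2l// ltr_nat.
apply: lt_le_trans; rewrite lebesgue_rV_halfopen => [|i]; last exact: ltW.
by rewrite lte_fin prodr_gt0// => i _; rewrite subr0.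
Qed.

End ball_measure.

(** * Lusin-Lipschitz estimate for Sobolev fields *)

Section lusin.
Context {R : realType} {d : nat} (d0 : (0 < d)%N) (q : R) (q1 : 1 < q).
Local Notation E := 'rV[R]_d.
Local Notation mu := (lebesgue_rV d).

(** Kolmogorov's inequality: [kolmogorov_level] holds at every level [a], and the best one turns the
    measure of [B] into its power [1 - 1/q]. *)
Lemma kolmogorov_power (l : R) (l0 : 0 < l) (N : nat) (N0 : (0 < N)%N) (h : E -> R)
    (B : set E) : (forall x, 0 <= h x) -> mu.-integrable setT (EFin \o h) ->
  mu.-integrable setT (fun x => (h x `^ q)%:E) -> measurable B ->
  (0 < mu B)%E -> (mu B < +oo)%E ->
  (\int[mu]_(x in B) maximal l N h x <= ((1 + @kolmogorov_cst R d q) *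
     (fine (mu B) `^ (1 - q^-1) * (\int[mu]_x (h x `^ q)) `^ q^-1))%:E)%E.
Proof.
move=> h0 ih ihq mB B0 Boo.
have q0 : 0 < q by rewrite (lt_trans _ q1).
set X := \int[mu]_x (h x `^ q); set b := fine (mu B).
have X0 : 0 <= X by apply: Rintegral_ge0 => x _; rewrite powR_ge0.
have b0 : 0 < b by rewrite fine_gt0// B0 Boo.
have bE : mu B = b%:E by rewrite fineK// ge0_fin_numE.
set K := @kolmogorov_cst R d q.
have K0 : 0 <= K by exact: kolmogorov_cst_ge0.
have lev a : 0 < a -> (\int[mu]_(x in B) maximal l N h x <=
    (a * b + K * a `^ (1 - q) * X)%:E)%E.
  by move=> a0; have := kolmogorov_level l0 N0 h0 ih q1 ihq a0 mB Boo; rewrite bE -EFinM -EFinD.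
(* If [X = 0] the best level would be [0], so the level [e / b] is used with [e] arbitrarily
   small. *)
have [X_0|Xn0] := eqVneq X 0.
  rewrite X_0 powR0 ?invr_neq0 ?gt_eqF// !mulr0.
  apply/lee_addgt0Pr => e e0; rewrite add0e.
  have := lev (e / b); rewrite X_0 mulr0 addr0 divfK ?gt_eqF//; apply.
  by rewrite divr_gt0.
have Xp : 0 < X by rewrite lt_neqAle eq_sym Xn0.
(* This level equates the two terms, [a * b] and the power [1 - q] of [a] times [X]. *)
pose a := (X / b) `^ q^-1.
have Xb : 0 < X / b by rewrite divr_gt0.
have a0 : 0 < a by rewrite powR_gt0.
apply: (le_trans (lev a a0)); rewrite lee_fin.
have abE : a * b = b `^ (1 - q^-1) * X `^ q^-1.
  rewrite powRB ?powRr1 ?(ltW b0)//; last by apply/implyP => _; rewrite gt_eqF.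
  rewrite /a powRM ?invr_ge0 ?(ltW b0)// -[b^-1](powR_inv1 (ltW b0)) powRAC powR_inv1 ?powR_ge0//.
  by ring.
have aXE : a `^ (1 - q) * X = b `^ (1 - q^-1) * X `^ q^-1.
  rewrite -abE powRB; last by apply/implyP => _; rewrite gt_eqF.
  rewrite powRr1 ?(ltW a0)// /a -[(_ `^ q^-1) `^ q]powRrM mulVf ?gt_eqF// powRr1 ?(ltW Xb)//.
  move: (_ `^ _) => z; field; rewrite !gt_eqF//.
by rewrite -mulrA aXE abE mulrDl mul1r.
Qed.

(** The product of [4 * chain_cst] from the pointwise estimate with [N = 2 d + 1], of [d] for
    summing over the components of the field, and of the constant of Kolmogorov's inequality. *)
Definition lusin_cst : R :=
  4 * @chain_cst R d d.*2.+1 * d%:R * (1 + @kolmogorov_cst R d q).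

Lemma lusin_cst_ge0 : 0 <= lusin_cst.
Proof.
have C0 : 0 <= @chain_cst R d d.*2.+1 by exact: chain_cst_ge0.
have K0 : 0 <= @kolmogorov_cst R d q by exact: kolmogorov_cst_ge0.
exact: mulr_ge0 (mulr_ge0 (mulr_ge0 _ C0) _) (addr_ge0 _ K0).
Qed.

(** The pointwise estimate is applied to each component of [b], with one common majorant [h] of all
    the entries of [J], so that a single maximal function serves; the exceptional sets are finitely
    many. *)
Lemma lusin_lipschitz (r : R) (b : E -> E) (J : E -> 'M[R]_d) : 0 < r ->
  weak_jacobian b J ->
  (LpNorm mu q%:E (eball (3 * r)) (fun x => enorm (J x)) < +oo)%E ->
  exists (M : E -> R) (P : E -> Prop),
  [/\ measurable_fun setT M, forall x, 0 <= M x,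
      (\int[mu]_(x in eball r) (M x)%:E <= (lusin_cst *
        (fine (mu (eball r)) `^ (1 - q^-1) *
         fine (LpNorm mu q%:E (eball (3 * r)) (fun x => enorm (J x)))))%:E)%E,
      {ae mu, forall x, eball r x -> P x} &
      forall x y, eball r x -> eball r y -> P x -> P y ->
        enorm (b x - b y) <= enorm (x - y) * (M x + M y)].
Proof.
move=> r0 bJ Joo; have q0 : 0 < q by rewrite (lt_trans _ q1).
have mJ : measurable_fun setT J.
  apply/measurable_fun_mxP => i j; have [_ lJ _] := bJ i j.
  exact: loc_integrable_measurable lJ.
have mb3 := @measurable_eball R d (3 * r).
have mbr := @measurable_eball R d r.
(* Cutting off at [3 * r] makes [h] globally integrable and loses nothing, as the cubes used for two
   points of the ball of radius [r] stay there. *)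
pose h x := enorm (J x) * \1_(eball (3 * r)) x.
have h0 x : 0 <= h x by rewrite mulr_ge0// enorm_ge0.
have mh : measurable_fun setT h.
  apply: measurable_funM; last exact: measurable_indic.
  exact: (measurableT_comp (@measurable_enorm R d d)).
have mhq : measurable_fun setT (fun x => h x `^ q).
  exact: (measurableT_comp (measurable_powR _)).
set Np := LpNorm _ _ _ _ in Joo *.
have NpE : (Np `^ q = \int[mu]_x (h x `^ q)%:E)%E.
  by rewrite LpNorm_powR// => x; exact: enorm_ge0.
have ihq : mu.-integrable setT (fun x => (h x `^ q)%:E).
  apply/integrableP; split; first exact/measurable_EFinP.
  under eq_integral do rewrite gee0_abs ?lee_fin ?powR_ge0//.
  by rewrite -NpE poweR_lty.
(* Pointwise [t <= 1 + t^q] on the ball, which has finite measure. *)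
have ih : mu.-integrable setT (EFin \o h).
  have i1 : mu.-integrable setT (EFin \o (\1_(eball (3 * r)) : E -> R)).
    apply/integrableP; split; first by apply/measurable_EFinP; exact: measurable_indic.
    under eq_integral do rewrite /= ger0_norm//.
    by rewrite integral_indic// setIT eball_lty.
  apply: (le_integrable measurableT _ _ (integrable_addR measurableT i1 ihq)).
    exact/measurable_EFinP.
  move=> x _ /=; rewrite lee_fin !ger0_norm//; last by rewrite addr_ge0// powR_ge0.
  rewrite /h indicE; case: (x \in _); last by rewrite mulr0 add0r powR_ge0.
  rewrite mulr1; have [e1|e1] := leP (enorm (J x)) 1; first by rewrite ler_wpDr// powR_ge0.
  by rewrite ler_wpDl// le1r_powR// ltW.
pose N := d.*2.+1; pose l : R := r / d%:R.
have l0 : 0 < l by rewrite divr_gt0// ltr0n.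
have M0 x : (0 <= maximal l N h x)%E by rewrite maximal_ge0.
have iM c0 : (\int[mu]_(x in cube l 0 c0 1) maximal l N h x < +oo)%E.
  have cfin : (mu (cube l 0 c0 1) < +oo)%E by rewrite cube_measure// ltry.
  have := kolmogorov_level l0 (ltn0Sn _ : (0 < N)%N) h0 ih q1 ihq ltr01 (measurable_cube l 0 c0 1) cfin.
  by move=> /le_lt_trans; apply; rewrite mul1e lte_add_pinfty// ltry.
set K := @chain_cst R d N.
have K0 : 0 <= K by exact: chain_cst_ge0.
have Jh i j x : eball (3 * r) x -> `|J x i j| <= h x.
  by move=> xr; rewrite /h indicE mem_set// mulr1 enorm_entry.
have HP i := hajlasz_pointwise d0 r0 (bJ i) h0 ih (Jh i) iM.
pose P i := sval (cid (HP i)).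
have aeP i : {ae mu, forall x, eball r x -> P i x} by have [H _] := svalP (cid (HP i)); exact: H.
have Plip i x y : eball r x -> eball r y -> P i x -> P i y ->
    `|b x ord0 i - b y ord0 i| <= 4 * K * enorm (x - y) *
      (fine (maximal l N h x) + fine (maximal l N h y)).
  by have [_ H] := svalP (cid (HP i)); exact: H.
pose c := 4 * K * d%:R; have c0 : 0 <= c by rewrite !mulr_ge0.
exists (fun x => c * fine (maximal l N h x)), (fun x => forall i, P i x); split.
- apply: measurable_funM => //; apply: measurableT_comp => //; exact: measurable_maximal.
- by move=> x; rewrite mulr_ge0// fine_ge0.
- apply: (@le_trans _ _ (c%:E * \int[mu]_(x in eball r) maximal l N h x)%E).
    rewrite -ge0_integralZl//; last by apply: measurable_funTS; exact: measurable_maximal.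
    apply: ge0_le_integral => //.
    + by move=> x _; rewrite lee_fin mulr_ge0// fine_ge0.
    + apply/measurable_EFinP; apply: measurable_funM => //; apply: measurable_funTS.
      by apply: measurableT_comp => //; exact: measurable_maximal.
    + by apply: measurable_funeM; apply: measurable_funTS; exact: measurable_maximal.
    + move=> x _; rewrite EFinM lee_wpmul2l//.
      by have := M0 x; case: (maximal l N h x) => //=; rewrite ?leey.
  have := kolmogorov_power l0 (ltn0Sn _ : (0 < N)%N) h0 ih ihq (measurable_eball r)
    (eball_gt0 r0) (eball_lty r).
  have -> : (\int[mu]_x (h x `^ q)) `^ q^-1 = fine Np.
    rewrite /Rintegral -NpE.
    have : (0 <= Np)%E by exact: Lnorm_ge0.
    move: Joo; case: Np NpE => // z _ _; rewrite lee_fin => z0 /=.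
    by rewrite -powRrM mulfV ?gt_eqF// powRr1.
  move=> H; apply: le_trans (lee_wpmul2l _ H) _ => //.
  rewrite -EFinM lee_fin /lusin_cst le_eqVlt; apply/orP; left; apply/eqP.
  by rewrite /c -/N -/K; ring.
- have : {ae mu, forall x, forall i, eball r x -> P i x} by apply: ae_forall_countable.
  by apply: filterS => x Px xr i; exact: Px.
move=> x y xr yr Px Py.
rewrite (le_trans (enorm_le_sum _))// big_ord1.
apply: (@le_trans _ _ (\sum_(j < d) 4 * K * enorm (x - y) *
      (fine (maximal l N h x) + fine (maximal l N h y)))).
  by apply: ler_sum => j _; rewrite !mxE; exact: Plip.
rewrite sumr_const card_ord -[leLHS]mulr_natr /c -mulrDr.
by rewrite le_eqVlt; apply/orP; left; apply/eqP; ring.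
Qed.

End lusin.

Lemma measurable_inv_ge0 {disp} {T : measurableType disp} {R : realType} (A : set T)
    (f : T -> R) : measurable_fun A f -> (forall x, A x -> 0 <= f x) ->
  measurable_fun A (fun x => (f x)^-1).
Proof.
move=> mf f0; apply: (@eq_measurable_fun _ _ _ _ _ (fun x => f x `^ (-1))).
  by move=> x /set_mem Ax; rewrite powR_inv1// f0.
exact: (measurableT_comp (measurable_powR _)).
Qed.

(** * Trajectories and regular Lagrangian flows *)

Section log_growth.
Context {R : realType}.
Local Notation leb := (@lebesgue_measure R).
Implicit Types (a b c s t : R) (f w D : R -> R).

Lemma Rintegral_itv_cat a b c f : a <= b -> b <= c ->
  leb.-integrable `[a, c] (EFin \o f) ->
  \int[leb]_(s in `[a, c]) f s =
  \int[leb]_(s in `[a, b]) f s + \int[leb]_(s in `[b, c]) f s.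
Proof.
move=> ab bc fi.
have := @Rintegral_itvB R f (BLeft a) (BRight c) b fi.
rewrite !bnd_simp => /(_ ab bc); rewrite Rintegral_itv_obnd_cbnd; first lra.
apply: (integrableS _ _ _ fi) => //.
by move=> x /=; rewrite !in_itv/= => /andP[/ltW bx ->]; rewrite (le_trans ab bx).
Qed.

Lemma ln_sub_le (x y : R) : 0 < x -> 0 < y -> ln y - ln x <= (y - x) / x.
Proof.
move=> x0 y0; rewrite -ln_div ?posrE//.
have -> : y / x = 1 + (y - x) / x by field; rewrite gt_eqF.
apply: le_ln1Dx; rewrite mulrBl divff ?gt_eqF//.
by rewrite ltrBrDr addrC subrr divr_gt0.
Qed.

(* D need not be differentiable: the chain rule for ln (lam + D) is replaced by
   ln y - ln x <= (y - x) / x along a fine partition. *)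
Lemma log_growth a b D w (lam : R) : a <= b -> 0 < lam ->
  (forall t, a <= t <= b -> 0 <= D t) ->
  (forall e, 0 < e -> exists2 del, 0 < del & forall s t, a <= s -> s <= t -> t <= b ->
     t - s < del -> `|D t - D s| < e) ->
  measurable_fun `[a, b] D ->
  (forall t, a <= t <= b -> 0 <= w t) -> leb.-integrable `[a, b] (EFin \o w) ->
  (forall s t, a <= s -> s <= t -> t <= b -> D t - D s <= \int[leb]_(u in `[s, t]) w u) ->
  leb.-integrable `[a, b] (EFin \o (fun t => w t / (lam + D t))) /\
  ln (lam + D b) - ln (lam + D a) <= \int[leb]_(t in `[a, b]) (w t / (lam + D t)).
Proof.
move=> ab lam0 D0 uD mD w0 wi Dw.
have lamD t : a <= t <= b -> 0 < lam + D t by move=> /D0; lra.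
have iwD : leb.-integrable `[a, b] (EFin \o (fun t => w t / (lam + D t))).
  have iZ : leb.-integrable `[a, b] (EFin \o (fun t => lam^-1 * w t)).
    exact: integrable_scaleR.
  apply: (le_integrable _ _ _ iZ) => //.
    apply/measurable_EFinP; apply: measurable_funM.
      by have /integrableP[/measurable_EFinP] := wi.
    apply: measurable_inv_ge0; first exact: measurable_funD.
    by move=> t; rewrite /= in_itv/= => /lamD /ltW.
  move=> t; rewrite /= in_itv/= => tab; rewrite lee_fin.
  rewrite ger0_norm ?divr_ge0 ?w0 ?(ltW (lamD _ tab))//.
  rewrite ger0_norm ?mulr_ge0 ?invr_ge0 ?w0 ?(ltW lam0)// mulrC.
  rewrite ler_wpM2r ?w0// lef_pV2 ?posrE ?lamD//.
  by have := D0 _ tab; lra.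
split => //; set I := \int[leb]_(t in _) _.
have iS s t f : a <= s -> t <= b -> leb.-integrable `[a, b] (EFin \o f) ->
    leb.-integrable `[s, t] (EFin \o f).
  move=> as_ tb fi; apply: (integrableS _ _ _ fi) => //.
  move=> x /=; rewrite !in_itv/= => /andP[sx xt].
  by rewrite (le_trans as_ sx) (le_trans xt tb).
have I0 : 0 <= I.
  apply: Rintegral_ge0 => t; rewrite /= in_itv/= => tab.
  by rewrite divr_ge0 ?w0 ?(ltW (lamD _ tab)).
(* Freezing the denominator at the left end of each interval of the partition costs a factor
   [1 + e], with [e] arbitrary. *)
suff H e : 0 < e -> ln (lam + D b) - ln (lam + D a) <= (1 + e) * I.
  rewrite leNgt; apply/negP => lt_I.
  pose x := ln (lam + D b) - ln (lam + D a).
  have I1 : 0 < I + 1 by lra.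
  have e0 : 0 < (x - I) / (2 * (I + 1)) by rewrite divr_gt0 ?mulr_gt0// subr_gt0.
  have := H _ e0; rewrite -/x mulrDl mul1r => h.
  have h2 : (x - I) / (2 * (I + 1)) * I <= (x - I) / 2.
    have -> : (x - I) / (2 * (I + 1)) * I = (x - I) / 2 * (I / (I + 1)).
      by field; rewrite gt_eqF.
    rewrite ler_piMr//; first by rewrite divr_ge0// subr_ge0 ltW.
    by rewrite ler_pdivrMr//; lra.
  have : x - I > 0 by rewrite subr_gt0.
  by move: h h2; lra.
(* Oscillation below [e * lam] ensures [lam + D s <= (1 + e) * (lam + D (t k))] on the interval
   starting at [t k]. *)
move=> e0; have [del del0 udel] := uD _ (mulr_gt0 e0 lam0).
pose n := (Num.truncn ((b - a) / del)).+1.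
have n0 : 0 < n%:R :> R by rewrite ltr0n.
pose t k := a + (b - a) * (k%:R / n%:R).
have tS k : t k.+1 - t k = (b - a) / n%:R.
  by rewrite /t -natr1; field; rewrite gt_eqF.
have stepdel : (b - a) / n%:R < del.
  rewrite ltr_pdivrMr// mulrC -ltr_pdivrMr//.
  exact: truncnS_gt.
have step0 : 0 <= (b - a) / n%:R by rewrite divr_ge0// subr_ge0.
have tn : t n = b by rewrite /t divff ?gt_eqF// mulr1 addrC subrK.
have t0 : t 0%N = a by rewrite /t mul0r mulr0 addr0.
have at_ k : a <= t k by rewrite lerDl mulr_ge0 ?subr_ge0// divr_ge0.
have tb k : (k <= n)%N -> t k <= b.
  move=> kn; rewrite -tn lerD2l ler_wpM2l ?subr_ge0//.
  by rewrite ler_pM2r ?invr_gt0// ler_nat.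
have tle k : t k <= t k.+1 by have := tS k; lra.
suff : forall k, (k <= n)%N -> ln (lam + D (t k)) - ln (lam + D a) <=
    (1 + e) * \int[leb]_(s in `[a, t k]) (w s / (lam + D s)).
  by move=> /(_ n (leqnn n)); rewrite tn.
elim=> [_|k IHk kn].
  rewrite t0 subrr mulr_ge0//; first lra.
  apply: Rintegral_ge0 => s; rewrite /= in_itv/= => /andP[as_ sa].
  have sab : a <= s <= b by rewrite as_ (le_trans sa).
  by rewrite divr_ge0 ?w0 ?(ltW (lamD _ sab)).
have kn' := ltnW kn.
rewrite (Rintegral_itv_cat (at_ k) (tle k)); last by apply: iS => //; exact: tb.
have tkab : a <= t k <= b by rewrite at_ tb.
have tk1ab : a <= t k.+1 <= b by rewrite at_ tb.
have h1 := ln_sub_le (lamD _ tkab) (lamD _ tk1ab).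
have h2 := Dw _ _ (at_ k) (tle k) (tb _ kn).
have h3 : (lam + D (t k))^-1 * \int[leb]_(s in `[t k, t k.+1]) w s <=
    (1 + e) * \int[leb]_(s in `[t k, t k.+1]) (w s / (lam + D s)).
  rewrite -!RintegralZl//; [|by apply: iS => //; exact: tb..].
  apply: le_Rintegral => //.
  - by apply: iS => //; [exact: tb|exact: integrable_scaleR].
  - by apply: iS => //; [exact: tb|exact: integrable_scaleR].
  move=> s; rewrite /= in_itv/= => /andP[ts st].
  have sab : a <= s <= b by rewrite (le_trans (at_ k) ts) (le_trans st (tb _ kn)).
  have sd : s - t k < del by apply: le_lt_trans stepdel; rewrite -(tS k); lra.
  have /andP[sb1 sb2] := sab.
  have := udel _ _ (at_ k) ts sb2 sd; rewrite ltr_norml => /andP[_ Ds].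
  rewrite mulrCA [leLHS]mulrC ler_wpM2l ?w0//.
  rewrite -ler_pdivrMr ?invr_gt0 ?lamD// invrK mulrC.
  rewrite ler_pdivrMr ?lamD//.
  have := D0 _ tkab; have := mulr_ge0 (ltW e0) (D0 _ tkab); lra.
have h4 : (lam + D (t k.+1) - (lam + D (t k))) / (lam + D (t k)) <=
    (lam + D (t k))^-1 * \int[leb]_(s in `[t k, t k.+1]) w s.
  rewrite opprD addrACA subrr add0r.
  by rewrite mulrC ler_wpM2l// invr_ge0 ltW// lamD.
have := IHk kn'; rewrite mulrDr.
by move: h1 h2 h3 h4; lra.
Qed.

End log_growth.

Section vector_integral.
Context {R : realType} {d : nat}.
Local Notation E := 'rV[R]_d.
Local Notation leb := (@lebesgue_measure R).

Lemma measurable_enorm_comp {disp} {T : measurableType disp} (A : set T) (F : T -> E) :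
  (forall i, measurable_fun A (fun t => F t ord0 i)) ->
  measurable_fun A (fun t => enorm (F t)).
Proof.
move=> mF; have mS : measurable_fun A (fun t => \sum_i \sum_j F t i j ^+ 2 : R).
  apply: measurable_sum => i; apply: measurable_sum => j.
  by apply: measurable_funX; rewrite (ord1 i).
apply: (measurableT_comp _ mS).
by apply: measurable_realfun.continuous_measurable_fun; exact: sqrt_continuous.
Qed.

Lemma measurable_enormB {disp} {X : measurableType disp} (D : set X) (F F' : X -> E) :
  measurable_fun D F -> measurable_fun D F' ->
  measurable_fun D (fun x => enorm (F x - F' x)).
Proof.
move=> mF mF'; apply: measurable_enorm_comp => i.
have mi := @measurable_mx_entry R 1 d ord0 i.
under eq_fun do rewrite !mxE; apply: measurable_funB.
  exact: (measurableT_comp mi mF).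
exact: (measurableT_comp mi mF').
Qed.

Lemma integrable_enorm (D : set R) (F : R -> E) : measurable D ->
  (forall i, leb.-integrable D (fun t => (F t ord0 i)%:E)) ->
  leb.-integrable D (fun t => (enorm (F t))%:E).
Proof.
move=> mD iF.
have iS : leb.-integrable D (EFin \o (fun t => \sum_(i < d) `|F t ord0 i|)).
  rewrite (_ : _ \o _ = fun t => (\sum_(i <- index_enum 'I_d) `|(F t ord0 i)%:E|)%E).
    by apply: integrable_sum => // i _; exact: (integrable_abse (iF i)).
  by apply/funext => t /=; rewrite sumEFin.
apply: (@le_integrable _ _ _ leb D mD _ _ _ _ iS).
  apply/measurable_EFinP; apply: measurable_enorm_comp => i.
  by have /integrableP[/measurable_EFinP] := iF i.
move=> t _ /=; rewrite lee_fin !ger0_norm ?enorm_ge0 ?sumr_ge0//.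
by have := enorm_le_sum (F t); rewrite big_ord1.
Qed.

(** Pair the integral [y] with itself: [|y|^2] is the integral of the scalar product of [y] and [F],
    at most [|y|] times the integral of [|F|]. *)
Lemma enorm_vint_le (D : set R) (F : R -> E) : measurable D ->
  (forall i, leb.-integrable D (fun t => (F t ord0 i)%:E)) ->
  enorm (vint D F) <= \int[leb]_(t in D) enorm (F t).
Proof.
move=> mD iF; set y := vint D F.
have I0 : 0 <= \int[leb]_(t in D) enorm (F t) by apply: Rintegral_ge0 => t _; exact: enorm_ge0.
have [->//|y0] := eqVneq (enorm y) 0.
have yp : 0 < enorm y by rewrite lt_neqAle eq_sym y0 enorm_ge0.
rewrite -(ler_pM2l yp) -expr2 enorm_sqr {1}/edot big_ord1.
have iF' i : leb.-integrable D (EFin \o (fun t => y ord0 i * F t ord0 i)).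
  by apply: integrable_scaleR => //; exact: iF.
have -> : \sum_j y ord0 j * y ord0 j = \int[leb]_(t in D) edot y (F t).
  transitivity (\sum_(j <- index_enum 'I_d) \int[leb]_(t in D) (y ord0 j * F t ord0 j)).
    by apply: eq_bigr => j _; rewrite RintegralZl ?mxE//; exact: iF.
  rewrite /Rintegral sum_fine; last by move=> j _; apply: integrable_fin_num => //; exact: iF'.
  rewrite -integral_sum//; congr fine; apply: eq_integral => t _ /=.
  by rewrite sumEFin /edot big_ord1.
rewrite -RintegralZl//; last exact: integrable_enorm.
apply: le_Rintegral => //; last by move=> t _; exact: edot_le.
  rewrite (_ : _ \o _ = fun t => (\sum_(i <- index_enum 'I_d) (y ord0 i * F t ord0 i)%:E)%E).
    by apply: integrable_sum => // i _; exact: iF'.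
  by apply/funext => t /=; rewrite sumEFin /edot big_ord1.
by apply: integrable_scaleR => //; exact: integrable_enorm.
Qed.

Lemma vint_cat (a b c : R) (F : R -> E) : a <= b -> b <= c ->
  (forall i, leb.-integrable `[a, c] (fun t => (F t ord0 i)%:E)) ->
  vint `[a, c] F = vint `[a, b] F + vint `[b, c] F.
Proof.
move=> ab bc iF; apply/rowP => i; rewrite !mxE.
exact: (Rintegral_itv_cat ab bc (iF i)).
Qed.

End vector_integral.

Section almost_everywhere.
Context {disp : measure_display} {T : measurableType disp} {R : realType}.
Context (mu : {measure set T -> \bar R}).

Lemma ae_mono (P Q : T -> Prop) : (forall x, P x -> Q x) ->
  {ae mu, forall x, P x} -> {ae mu, forall x, Q x}.
Proof. by move=> PQ; exact: filterS. Qed.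

Lemma ae_mono2 (P1 P2 Q : T -> Prop) : (forall x, P1 x -> P2 x -> Q x) ->
  {ae mu, forall x, P1 x} -> {ae mu, forall x, P2 x} -> {ae mu, forall x, Q x}.
Proof. by move=> PQ; exact: filterS2. Qed.

Lemma ae_mono3 (P1 P2 P3 Q : T -> Prop) : (forall x, P1 x -> P2 x -> P3 x -> Q x) ->
  {ae mu, forall x, P1 x} -> {ae mu, forall x, P2 x} -> {ae mu, forall x, P3 x} ->
  {ae mu, forall x, Q x}.
Proof. by move=> PQ; exact: filterS3. Qed.

End almost_everywhere.

(** * Joint measurability and Tonelli's theorem along flows *)

Section joint_version.
Context {R : realType} {d : nat}.
Local Notation E := 'rV[R]_d.
Local Notation mu := (lebesgue_rV d).
Local Notation leb := (@lebesgue_measure R).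

(* Z' is the limit of the interpolations of Z that are constant in time on the
   cells of a grid. *)
Lemma flow_jointly_measurable (a b : R) (Z : R -> E -> E) : a < b ->
  (forall t, a <= t <= b -> measurable_fun setT (Z t)) ->
  {ae mu, forall x, forall e, 0 < e -> exists2 del, 0 < del & forall s t, a <= s -> s <= t ->
     t <= b -> t - s < del -> enorm (Z t x - Z s x) < e} ->
  exists Z' : R * E -> E, measurable_fun setT Z' /\
    {ae mu, forall x, forall t, a <= t <= b -> Z' (t, x) = Z t x}.
Proof.
move=> ab mZ [X0 [mX0 X00 X0Z]].
have ba0 : 0 < b - a by rewrite subr_gt0.
(* Setting [Z'] to [0] off the time interval and on the null set [X0] makes the interpolations
   converge at every point. *)
pose Z' (z : R * E) : E := if (a <= z.1 <= b) && (z.2 \notin X0) then Z z.1 z.2 else 0.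
exists Z'; split; last first.
  exists X0; split => // x nx; apply: contrapT => xX0; apply: nx => t tab.
  by rewrite /Z' /= tab memNset.
apply/measurable_fun_mxP => i j; rewrite (ord1 i) => {i}.
(* The sum in [f] runs up to [k = n.+1], where [tau n k = b], so that the final time also has a
   cell. *)
pose tau n (k : nat) := a + (b - a) * (k%:R / n.+1%:R).
pose f n (z : R * E) : R := (\sum_(k < n.+2) \1_(`[tau n k, tau n k.+1[) z.1 * Z (tau n k) z.2 ord0 j) *
  (\1_(`[a, b]) z.1 * \1_(~` X0) z.2).
have tauab n k : (k < n.+2)%N -> a <= tau n k <= b.
  move=> kn; rewrite lerDl mulr_ge0 ?(ltW ba0)//=.
  rewrite -lerBrDl ler_piMr ?(ltW ba0)// ler_pdivrMr// mul1r ler_nat.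
  by rewrite -ltnS.
apply: (@measurable_fun_cvg _ _ _ _ f).
  move=> n; apply: measurable_funM.
    apply: measurable_sum => k; apply: measurable_funM.
      by apply: (measurableT_comp _ measurable_fst); exact: measurable_indic.
    have mZj : measurable_fun setT (fun x => Z (tau n k) x ord0 j).
      apply: (measurableT_comp (@measurable_mx_entry R 1 d ord0 j)).
      exact: mZ (tauab _ _ (ltn_ord k)).
    exact: (measurableT_comp mZj measurable_snd).
  apply: measurable_funM.
    by apply: (measurableT_comp _ measurable_fst); exact: measurable_indic.
  apply: (measurableT_comp _ measurable_snd); apply: measurable_indic.
  exact: measurableC.
move=> [t x] _; rewrite /f /Z' /=.
have [tab|tab] := boolP (a <= t <= b); last first.
  rewrite mxE /=; apply: cvg_near_cst; apply: nearW => n.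
  by rewrite [\1_(`[a, b]) t]indicE mem_setE in_itv/= (negbTE tab) mul0r mulr0.
have [xX0|xX0] := boolP (x \in X0).
  rewrite mxE /=; apply: cvg_near_cst; apply: nearW => n.
  rewrite [\1_(~` X0) x]indicE memNset ?mulr0//.
  by move=> /=; apply; exact: set_mem.
have uZ : forall e, 0 < e -> exists2 del, 0 < del & forall s t, a <= s -> s <= t ->
     t <= b -> t - s < del -> enorm (Z t x - Z s x) < e.
  by apply: contrapT => h; move: xX0 => /negP; apply; rewrite inE; apply: X0Z.
have -> : (\1_(`[a, b]) t * \1_(~` X0) x : R) = 1.
  rewrite !indicE [t \in _]mem_set/= ?in_itv// mem_set ?mulr1//.
  by move=> /= /mem_set; exact/negP.
under eq_fun do rewrite mulr1.
apply/cvgrPdist_lt => e e0.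
have [del del0 udel] := uZ e e0; near=> n.
have n0 : 0 < n.+1%:R :> R by [].
pose y := (t - a) * n.+1%:R / (b - a).
have y0 : 0 <= y by rewrite divr_ge0 ?(ltW ba0)// mulr_ge0// subr_ge0; case/andP: tab.
have /andP[k1 k2] := truncn_itv y0; set k := Num.truncn y in k1 k2.
have itvE m : (t \in `[tau n m, tau n m.+1[) = (m == k).
  rewrite in_itv/= /tau -lerBrDl -ltrBlDl.
  rewrite -!(mulrC (_ / _)) -ler_pdivlMr// -ltr_pdivrMr//.
  rewrite ler_pdivrMr// ltr_pdivlMr//.
  rewrite -[(t - a) / (b - a) * _]mulrA [_ ^-1 * _]mulrC mulrA -/y.
  apply/idP/eqP => [|->]; last by rewrite k1 k2.
  by move=> /truncn_def <-.
have kn : (k < n.+2)%N.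
  rewrite -(ltr_nat R) (le_lt_trans k1)// /y.
  rewrite (@le_lt_trans _ _ n.+1%:R) ?ltr_nat//.
  rewrite mulrAC ler_piMl// ler_pdivrMr// mul1r lerD2r; by case/andP: tab.
rewrite (bigD1 (Ordinal kn))//= big1 ?addr0; last first.
  move=> m; rewrite -val_eqE /= => /negbTE mk.
  by rewrite indicE mem_setE itvE mk mul0r.
rewrite indicE mem_setE itvE eqxx mul1r.
have : t \in `[tau n k, tau n k.+1[ by rewrite itvE.
rewrite in_itv/= => /andP[t1 t2].
have /andP[tk1 tk2] := tauab n k kn.
apply: (@le_lt_trans _ _ (enorm (Z t x - Z (tau n k) x))).
  by have := enorm_entry (Z t x - Z (tau n k) x) ord0 j; rewrite !mxE.
apply: udel => //; first by case/andP: tab.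
have -> : t = t - tau n k.+1 + tau n k + (b - a) / n.+1%:R.
  by rewrite /tau -natr1; field; rewrite gt_eqF// ltr_wpDl.
have nd : (b - a) / n.+1%:R < del.
  rewrite ltr_pdivrMr// mulrC -ltr_pdivrMr//.
  apply: (@lt_trans _ _ n%:R); last by rewrite ltr_nat.
  by near: n; exact: nbhs_infty_gtr.
by move: nd t2; move: (_ / _) => z; lra.
Unshelve. all: by end_near. Qed.

(** Change of variable, then monotonicity of the integral in the measure. This is where the
    compressibility constants enter the estimate. *)
Lemma pushforward_le_integral (L : R) (Z : E -> E) (phi : E -> \bar R) : 0 <= L ->
  measurable_fun setT Z ->
  (forall B : set E, measurable B -> (pushforward mu Z B <= L%:E * mu B)%E) ->
  measurable_fun setT phi -> (forall y, (0 <= phi y)%E) ->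
  (\int[mu]_x phi (Z x) <= L%:E * \int[mu]_y phi y)%E.
Proof.
move=> L0 mZ ZL mphi phi0.
pose m1 : {measure set E -> \bar R} :=
  measure_function_pushforward__canonical__measure_function_Measure mu mZ.
have := @ge0_le_measure_integral _ _ _ m1 (mscale (NngNum L0) mu) _ phi setT measurableT phi0 mphi.
rewrite ge0_integral_mscale// => H.
have := @ge0_integral_pushforward _ _ _ _ _ _ mZ mu setT phi measurableT mphi (fun y _ => phi0 y).
rewrite preimage_setT /= => <-.
by apply: H => S mS; exact: ZL.
Qed.

Lemma tonelli_on (I : set R) (B : set E) (phi : R * E -> \bar R) :
  measurable I -> measurable B -> measurable_fun setT phi -> (forall z, (0 <= phi z)%E) ->
  (\int[mu]_(x in B) \int[leb]_(s in I) phi (s, x) =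
   \int[leb]_(s in I) \int[mu]_(x in B) phi (s, x))%E.
Proof.
move=> mI mB mphi phi0.
pose psi (z : R * E) : \bar R := (phi z * (\1_I z.1 * \1_B z.2)%:E)%E.
have mpsi : measurable_fun setT psi.
  apply: emeasurable_funM => //; apply/measurable_EFinP; apply: measurable_funM.
    by apply: (measurableT_comp _ measurable_fst); exact: measurable_indic.
  by apply: (measurableT_comp _ measurable_snd); exact: measurable_indic.
have psi0 z : (0 <= psi z)%E by rewrite mule_ge0// lee_fin mulr_ge0.
have := @fubini_tonelli _ _ _ _ R leb mu psi mpsi psi0.
move=> H; transitivity (\int[mu]_y \int[leb]_x psi (x, y))%E.
  rewrite integral_mkcond; apply: eq_integral => x _; rewrite patchE.
  case: ifPn => xB.
    rewrite integral_mkcond; apply: eq_integral => s _; rewrite patchE /psi /= !indicE xB mulr1.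
    by case: ifPn; rewrite ?mule1 ?mule0.
  rewrite integral0_eq// => s _.
  by rewrite /psi /= !indicE (negbTE xB) mulr0 mule0.
rewrite -H [RHS]integral_mkcond; apply: eq_integral => s _; rewrite patchE.
case: ifPn => sI.
  rewrite [RHS]integral_mkcond; apply: eq_integral => x _; rewrite patchE /psi /= !indicE sI mul1r.
  by case: ifPn; rewrite ?mule1 ?mule0.
rewrite integral0_eq// => x _.
by rewrite /psi /= !indicE (negbTE sI) mul0r mule0.
Qed.

Lemma measurable_time_integral (I : set R) (phi : R * E -> \bar R) :
  measurable I -> measurable_fun setT phi -> (forall z, (0 <= phi z)%E) ->
  measurable_fun setT (fun x => \int[leb]_(s in I) phi (s, x))%E.
Proof.
move=> mI mphi phi0.
have mpsi : measurable_fun setT (fun z : R * E => (phi z * (\1_I z.1)%:E)%E).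
  apply: emeasurable_funM => //; apply/measurable_EFinP.
  by apply: (measurableT_comp _ measurable_fst); exact: measurable_indic.
have psi0 z : (0 <= phi z * (\1_I z.1)%:E)%E by rewrite mule_ge0// lee_fin.
have := @measurable_fun_fubini_tonelli_G _ _ _ _ R leb _ mpsi psi0.
apply: eq_measurable_fun => x _; rewrite /fubini_G [RHS]integral_mkcond.
apply: eq_integral => s _; rewrite patchE indicE /=.
by case: ifPn => _; rewrite ?mule1 ?mule0.
Qed.

(** At a.e. time the set of [x] with [Z s x] in the slice of [Q] is null by compressibility;
    Tonelli's theorem exchanges the order. It transfers a.e. bounds on a field to almost every
    trajectory. *)
Lemma ae_flow_avoids (a b L : R) (Z : R -> E -> E) (Z' : R * E -> E) (Q : set (R * E)) :
  0 <= L -> measurable_fun setT Z' ->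
  {ae mu, forall x, forall t, a <= t <= b -> Z' (t, x) = Z t x} ->
  (forall t, a <= t <= b -> measurable_fun setT (Z t)) ->
  (forall t, a <= t <= b -> forall B : set E, measurable B ->
     (pushforward mu (Z t) B <= L%:E * mu B)%E) ->
  measurable Q ->
  {ae leb, forall s, a <= s <= b -> {ae mu, forall y, ~ Q (s, y)}} ->
  {ae mu, forall x, {ae leb, forall s, a <= s <= b -> ~ Q (s, Z s x)}}.
Proof.
move=> L0 mZ' Z'E mZ ZL mQ Q0.
pose phi (z : R * E) : \bar R := (\1_Q (z.1, Z' z))%:E.
have mphi : measurable_fun setT phi.
  apply/measurable_EFinP.
  have mp : measurable_fun setT (fun z : R * E => (z.1, Z' z)).
    by apply: measurable_fun_pair => //; exact: measurable_fst.
  by apply: (measurableT_comp _ mp); exact: measurable_indic.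
have phi0 z : (0 <= phi z)%E by rewrite lee_fin.
have mI : measurable (`[a, b]%classic : set R) by [].
have mphi1 s : measurable_fun setT (fun x => phi (s, x)).
  by apply: (measurableT_comp mphi); exact: measurable_pair1.
have mphi2 x : measurable_fun setT (fun s => phi (s, x)).
  by apply: (measurableT_comp mphi); exact: measurable_pair2.
have mQs s : measurable_fun setT (fun y => (\1_Q (s, y))%:E : \bar R).
  apply/measurable_EFinP.
  apply: (measurableT_comp (f := \1_Q : R * E -> R)); first exact: measurable_indic.
  exact: measurable_pair1.
have F0 : {ae leb, forall s, a <= s <= b -> (\int[mu]_x phi (s, x) = 0)%E}.
  apply: ae_mono Q0 => s Qs sab.
  have sZ := mZ s sab.
  have -> : (\int[mu]_x phi (s, x) = \int[mu]_x (\1_Q (s, Z s x))%:E)%E.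
    apply: ae_eq_integral => //; first exact: (measurableT_comp (mQs s) sZ).
    move: Z'E; apply: filterS => x Zx _.
    by rewrite /phi /= Zx.
  apply/eqP; rewrite eq_le; apply/andP; split; last by apply: integral_ge0.
  have := @pushforward_le_integral L (Z s) (fun y => (\1_Q (s, y))%:E) L0 sZ (ZL s sab) (mQs s).
  have -> : (\int[mu]_y (\1_Q (s, y))%:E = 0)%E.
    rewrite -[RHS](integral0 mu setT); apply: ae_eq_integral => //.
    move: (Qs sab); apply: filterS => y nQ _.
    by rewrite indicE memNset.
  by rewrite mule0; apply => y; rewrite lee_fin.
have := tonelli_on mI measurableT mphi phi0.
have -> : (\int[leb]_(s in `[a, b]) \int[mu]_x phi (s, x) = 0)%E.
  rewrite -[RHS](integral0 leb `[a, b]); apply: ae_eq_integral => //.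
    apply: measurable_funTS.
    exact: (@measurable_fun_fubini_tonelli_F _ _ _ _ R mu phi mphi phi0).
move=> H.
have mG := measurable_time_integral mI mphi phi0.
have : ae_eq mu setT (fun x => \int[leb]_(s in `[a, b]) phi (s, x))%E (cst 0%E).
  apply/ae_eq_integral_abs => //.
  by under eq_integral do rewrite gee0_abs ?integral_ge0//.
move=> aeG; move: Z'E aeG; apply: filterS2 => x Zx /(_ I) /= Gx.
have : ae_eq leb `[a, b]%classic (fun s => phi (s, x)) (cst 0%E).
  apply/ae_eq_integral_abs => //; first by apply: measurable_funTS; exact: (mphi2 x).
  by under eq_integral do rewrite gee0_abs//.
apply: ae_mono => s sQ sab QZ.
have := sQ sab; rewrite /phi /= Zx// indicE mem_set//= => /eqP.
by rewrite eqe oner_eq0.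
Qed.

End joint_version.

(** * Distance and growth along trajectories *)

Section paths.
Context {R : realType} {d : nat}.
Local Notation E := 'rV[R]_d.
Local Notation leb := (@lebesgue_measure R).
Implicit Types (a b s t : R) (x : E) (gam F : R -> E) (D : R -> R).

Definition uniform_on a b D := forall e, 0 < e -> exists2 del, 0 < del &
  forall s t, a <= s -> s <= t -> t <= b -> t - s < del -> `|D t - D s| < e.

Lemma uniform_on_measurable a b D : uniform_on a b D -> measurable_fun `[a, b] D.
Proof.
move=> uD; apply: subspace_continuous_measurable_fun => //.
apply/subspace_continuousP => x; rewrite /= in_itv/= => /andP[ax xb].
apply/cvgrPdist_lt => e e0; have [del del0 H] := uD _ e0.
rewrite near_withinE; near=> y; rewrite /= in_itv/= => /andP[ay yb].
have xy : `|x - y| < del by near: y; exact: nbhsx_ballx.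
have [le_xy|lt_yx] := leP x y.
  by rewrite distrC; apply: H => //; rewrite (le_lt_trans _ xy)// distrC ler_norm.
by apply: H => //; [exact: ltW|rewrite (le_lt_trans _ xy)// ler_norm].
Unshelve. all: by end_near. Qed.

Lemma ac_uniform a b gam : absolutely_continuous_on a b gam ->
  forall e, 0 < e -> exists2 del, 0 < del & forall s t, a <= s -> s <= t -> t <= b ->
    t - s < del -> enorm (gam t - gam s) < e.
Proof.
move=> acg e e0; have [del del0 H] := acg e e0; exists del => // s t as_ st tb td.
have := H [:: (s, t)]; rewrite /= !big_seq1 as_ st tb; exact.
Qed.

Definition integral_path a b x gam F :=
  [/\ absolutely_continuous_on a b gam,
      forall i, leb.-integrable `[a, b] (fun s => (F s ord0 i)%:E) &
      forall t, `[a, b]%classic t -> gam t = x + vint `[a, t] F].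

Lemma integrable_sub a b s t F : a <= s -> t <= b ->
  (forall i, leb.-integrable `[a, b] (fun s => (F s ord0 i)%:E)) ->
  forall i, leb.-integrable `[s, t] (fun s => (F s ord0 i)%:E).
Proof.
move=> as_ tb iF i; apply: (integrableS _ _ _ (iF i)) => // u.
by rewrite /= !in_itv/= => /andP[su ut]; rewrite (le_trans as_ su) (le_trans ut tb).
Qed.

Lemma path_increment a b x gam F s t : integral_path a b x gam F ->
  a <= s -> s <= t -> t <= b -> gam t - gam s = vint `[s, t] F.
Proof.
move=> [_ iF gE] as_ st tb.
have at_ := le_trans as_ st; have sb := le_trans st tb.
rewrite !gE; [|by rewrite /= in_itv/= as_|by rewrite /= in_itv/= at_].
rewrite (vint_cat as_ st); last exact: (integrable_sub (lexx a) tb iF).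
by rewrite opprD addrACA subrr add0r addrAC subrr add0r.
Qed.

Lemma path_start a b x gam F : a <= b -> integral_path a b x gam F -> gam a = x.
Proof.
move=> ab [_ _ gE]; rewrite gE; last by rewrite /= in_itv/= lexx.
rewrite (_ : vint _ _ = 0) ?addr0//; apply/rowP => i; rewrite !mxE.
by rewrite set_itv1 Rintegral_set1.
Qed.

Lemma vintB (D : set R) F F' : measurable D ->
  (forall i, leb.-integrable D (fun t => (F t ord0 i)%:E)) ->
  (forall i, leb.-integrable D (fun t => (F' t ord0 i)%:E)) ->
  vint D F - vint D F' = vint D (fun t => F t - F' t).
Proof.
move=> mD iF iF'; apply/rowP => i; rewrite !mxE -RintegralB//; [|exact: iF|exact: iF'].
by apply: eq_Rintegral => t _; rewrite !mxE.
Qed.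

Lemma enorm_sub_sub (A B : E) : `|enorm A - enorm B| <= enorm (A - B).
Proof.
rewrite ler_norml; apply/andP; split.
  by have := enormD (B - A) A; rewrite subrK (enorm_distC B); lra.
by have := enormD (A - B) B; rewrite subrK; lra.
Qed.

Lemma ae_le_Rintegral (D : set R) (f g : R -> R) : measurable D ->
  leb.-integrable D (EFin \o f) -> leb.-integrable D (EFin \o g) ->
  (forall t, D t -> 0 <= f t) -> (forall t, D t -> 0 <= g t) ->
  {ae leb, forall t, D t -> f t <= g t} ->
  \int[leb]_(t in D) f t <= \int[leb]_(t in D) g t.
Proof.
move=> mD fi gi f0 g0 fg; rewrite /Rintegral fine_le//; [exact: integrable_fin_num..|].
apply: ae_ge0_le_integral => //.
- by have /integrableP[] := fi.
- by have /integrableP[] := gi.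
Qed.

(** [log_growth] for the distance of the two paths, whose increments are controlled by the integral
    of [|F - F'|]; the distance is [0] at time [a], so the initial term is [ln lam]. *)
Lemma path_distance a b x gam gam' F F' (lam : R) : a <= b -> 0 < lam ->
  integral_path a b x gam F -> integral_path a b x gam' F' ->
  let D t := enorm (gam t - gam' t) in
  leb.-integrable `[a, b] (EFin \o (fun t => enorm (F t - F' t) / (lam + D t))) /\
  ln (1 + D b / lam) <= \int[leb]_(t in `[a, b]) (enorm (F t - F' t) / (lam + D t)).
Proof.
move=> ab lam0 pg pg' D.
have [acg iF _] := pg; have [acg' iF' _] := pg'.
have uD : uniform_on a b D.
  move=> e e0; have e20 : 0 < e / 2 by rewrite divr_gt0.
  have [d1 d10 H1] := ac_uniform acg e20; have [d2 d20 H2] := ac_uniform acg' e20.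
  exists (Num.min d1 d2); first by rewrite lt_min d10.
  move=> s t as_ st tb; rewrite lt_min => /andP[t1 t2].
  rewrite (le_lt_trans (enorm_sub_sub _ _))//.
  have -> : gam t - gam' t - (gam s - gam' s) = (gam t - gam s) - (gam' t - gam' s).
    by rewrite !opprD !opprK addrACA.
  rewrite (le_lt_trans (enormB _ _))//.
  have := H1 _ _ as_ st tb t1; have := H2 _ _ as_ st tb t2; lra.
have iw i : leb.-integrable `[a, b] (fun t => ((F t - F' t) ord0 i)%:E).
  have -> : (fun t => ((F t - F' t) ord0 i)%:E) = EFin \o (fun t => F t ord0 i - F' t ord0 i).
    by apply/funext => t; rewrite /= !mxE.
  by apply: integrable_subR => //; [exact: iF|exact: iF'].
have inc s t : a <= s -> s <= t -> t <= b ->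
    D t - D s <= \int[leb]_(u in `[s, t]) enorm (F u - F' u).
  move=> as_ st tb; rewrite /D.
  have := enorm_sub_sub (gam t - gam' t) (gam s - gam' s).
  have -> : gam t - gam' t - (gam s - gam' s) = (gam t - gam s) - (gam' t - gam' s).
    by rewrite !opprD !opprK addrACA.
  rewrite (path_increment pg)// (path_increment pg')// vintB//; last 2 first.
  - exact: (integrable_sub as_ tb iF).
  - exact: (integrable_sub as_ tb iF').
  move=> h; apply: le_trans (enorm_vint_le _ _) => //; last exact: (integrable_sub as_ tb iw).
  by apply: le_trans h; exact: ler_norm.
have iw' : leb.-integrable `[a, b] (EFin \o (fun t => enorm (F t - F' t))).
  exact: (integrable_enorm _ iw).
have [iD h] := log_growth ab lam0 (fun t _ => enorm_ge0 _) uD (uniform_on_measurable uD)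
  (fun t _ => enorm_ge0 _) iw' inc.
split => //; apply: le_trans h.
rewrite /D (path_start ab pg) (path_start ab pg') subrr enorm0 addr0.
rewrite -ln_div ?posrE ?ltr_wpDr ?enorm_ge0//.
by rewrite mulrDl divff ?gt_eqF.
Qed.

(** Gronwall's inequality as another instance of [log_growth], with [lam = 1] and [D = |gam|]: the
    integrand [|F| / (1 + |gam|)] is at most [|G|]. *)
Lemma path_bound a b x gam F (G : R -> R) : a <= b ->
  integral_path a b x gam F -> leb.-integrable `[a, b] (EFin \o G) ->
  {ae leb, forall t, a <= t <= b -> enorm (F t) <= G t * (1 + enorm (gam t))} ->
  forall t, a <= t <= b ->
    1 + enorm (gam t) <= (1 + enorm x) * expR (\int[leb]_(s in `[a, b]) `|G s|).
Proof.
move=> ab pg iG FG t /andP[at_ tb]; have [acg iF gE] := pg.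
have iGa : leb.-integrable `[a, b] (EFin \o (fun s => `|G s|)) by exact: (integrable_abse iG).
pose D s := enorm (gam s).
have uD : uniform_on a t D.
  move=> e e0; have [d1 d10 H1] := ac_uniform acg e0; exists d1 => // s u as_ su ut ud.
  rewrite (le_lt_trans (enorm_sub_sub _ _))//; apply: H1 => //; exact: le_trans ut tb.
have iFt := integrable_sub (lexx a) tb iF.
have inc s u : a <= s -> s <= u -> u <= t ->
    D u - D s <= \int[leb]_(y in `[s, u]) enorm (F y).
  move=> as_ su ut.
  have := enorm_sub_sub (gam u) (gam s); rewrite (path_increment pg)//; last exact: le_trans ut tb.
  move=> h; apply: le_trans (enorm_vint_le _ _) => //; last exact: (integrable_sub as_ ut iFt).
  by apply: le_trans h; exact: ler_norm.
have iF1 : leb.-integrable `[a, t] (EFin \o (fun s => enorm (F s))).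
  exact: (integrable_enorm _ iFt).
have [iD h2] := log_growth at_ ltr01 (fun t _ => enorm_ge0 _) uD (uniform_on_measurable uD)
  (fun t _ => enorm_ge0 _) iF1 inc.
have st_ab : `[a, t] `<=` `[a, b].
  by move=> s /=; rewrite !in_itv/= => /andP[-> st]; rewrite (le_trans st tb).
have iGt : leb.-integrable `[a, t] (EFin \o (fun s => `|G s|)).
  by apply: (integrableS _ _ _ iGa).
have h1 : \int[leb]_(s in `[a, t]) (enorm (F s) / (1 + D s)) <=
    \int[leb]_(s in `[a, b]) `|G s|.
  apply: (@le_trans _ _ (\int[leb]_(s in `[a, t]) `|G s|)).
    apply: ae_le_Rintegral => //.
    - by move=> s _; rewrite divr_ge0 ?enorm_ge0// addr_ge0// enorm_ge0.
    - apply: ae_mono FG => s Fs; rewrite /= in_itv/= => /andP[as_ st].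
      have sab : a <= s <= b by rewrite as_ (le_trans st tb).
      rewrite ler_pdivrMr; last by rewrite ltr_wpDr ?enorm_ge0.
      apply: (le_trans (Fs sab)); rewrite ler_wpM2r ?ler_norm//.
      by rewrite addr_ge0// enorm_ge0.
  rewrite (Rintegral_itv_cat at_ tb)// lerDl; exact: Rintegral_ge0.
have := le_trans h2 h1; rewrite /D (path_start ab pg) => h3.
have p1 y : 0 < 1 + enorm (y : E) by rewrite ltr_wpDr ?enorm_ge0.
rewrite -[leLHS]lnK ?posrE// -[X in X * _]lnK ?posrE// -expRD ler_expR; lra.
Qed.

End paths.

(** * Integration over the initial points *)

Section flow_estimates.
Context {R : realType} {d : nat}.
Local Notation E := 'rV[R]_d.
Local Notation mu := (lebesgue_rV d).
Local Notation leb := (@lebesgue_measure R).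

Lemma ae_pullback (L : R) (Z : E -> E) (P : E -> Prop) : 0 <= L ->
  measurable_fun setT Z ->
  (forall B : set E, measurable B -> (pushforward mu Z B <= L%:E * mu B)%E) ->
  {ae mu, forall y, P y} -> {ae mu, forall x, P (Z x)}.
Proof.
move=> L0 mZ ZL [N [mN N0 PN]]; exists (Z @^-1` N); split.
- by rewrite -[X in measurable X]setTI; exact: mZ.
- apply/eqP; rewrite eq_le measure_ge0 andbT.
  by apply: le_trans (ZL _ mN) _; rewrite N0 mule0.
- by move=> x nP; exact: PN.
Qed.

Lemma rlf_path a b (v : R -> E -> E) (L : R) (Z : R -> E -> E) :
  regular_lagrangian_flow a b v L Z ->
  {ae mu, forall x, integral_path a b x (fun t => Z t x) (fun s => v s (Z s x))}.
Proof. by move=> [_ H _]; exact: H. Qed.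

Lemma rlf_joint a b (v : R -> E -> E) (L : R) (Z : R -> E -> E) : a < b ->
  regular_lagrangian_flow a b v L Z ->
  exists Z' : R * E -> E, measurable_fun setT Z' /\
    {ae mu, forall x, forall t, a <= t <= b -> Z' (t, x) = Z t x}.
Proof.
move=> ab [mZ aZ _]; apply: flow_jointly_measurable => //.
by move: aZ; apply: ae_mono => x [acZ _ _] e e0; exact: (ac_uniform acZ e0).
Qed.

(** The growth bound holds a.e. in space and time only. The set [Q] where it fails is avoided by
    almost every trajectory at a.e. time, so [path_bound] applies. *)
Lemma rlf_bound a b (v : R -> E -> E) (L : R) (Z : R -> E -> E) (G : R -> R) :
  a < b -> 0 <= L -> measurable_fun setT (fun z : R * E => v z.1 z.2) ->
  regular_lagrangian_flow a b v L Z ->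
  leb.-integrable `[a, b] (EFin \o G) ->
  {ae leb, forall s, a <= s <= b -> {ae mu, forall y, enorm (v s y) <= G s * (1 + enorm y)}} ->
  {ae mu, forall x, forall t, a <= t <= b ->
    1 + enorm (Z t x) <= (1 + enorm x) * expR (\int[leb]_(s in `[a, b]) `|G s|)}.
Proof.
move=> ab L0 mv hZ iG vG.
have [Z' [mZ' Z'E]] := rlf_joint ab hZ.
have [mZ _ ZL] := hZ.
pose G' := G \_ `[a, b].
have mG' : measurable_fun setT G'.
  apply: (measurable_restrictT _ _).1 => //.
  by have /integrableP[/measurable_EFinP] := iG.
pose h (z : R * E) := enorm (v z.1 z.2) - G' z.1 * (1 + enorm z.2).
have mh : measurable_fun setT h.
  apply: measurable_funB; first exact: (measurableT_comp (@measurable_enorm R 1 d) mv).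
  apply: measurable_funM; first exact: (measurableT_comp mG' measurable_fst).
  apply: measurable_funD => //.
  exact: (measurableT_comp (@measurable_enorm R 1 d) measurable_snd).
pose Q := h @^-1` `]0, +oo[.
have mQ : measurable Q by rewrite -[X in measurable X]setTI; exact: mh.
have GE s : a <= s <= b -> G' s = G s by move=> sab; rewrite /G' patchE mem_set//= in_itv.
have Q0 : {ae leb, forall s, a <= s <= b -> {ae mu, forall y, ~ Q (s, y)}}.
  apply: ae_mono vG => s vs sab; apply: ae_mono (vs sab) => y vy.
  by rewrite /Q /h /= in_itv/= andbT GE// subr_gt0 ltNge vy.
have mZt t : a <= t <= b -> measurable_fun setT (Z t).
  by move=> tab; apply: mZ; rewrite /= in_itv.
have ZLt t : a <= t <= b -> forall B : set E, measurable B ->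
     (pushforward mu (Z t) B <= L%:E * mu B)%E.
  by move=> tab; apply: ZL; rewrite /= in_itv.
have av := ae_flow_avoids L0 mZ' Z'E mZt ZLt mQ Q0.
apply: ae_mono2 (rlf_path hZ) av => x px ax t tab.
apply: (path_bound (ltW ab) px iG) => //.
apply: ae_mono ax => s nQ sab; have := nQ sab.
rewrite /Q /h /= in_itv/= andbT GE// subr_gt0.
by move/negP; rewrite -leNgt.
Qed.

Lemma integral_indic_mul (A : set E) (g : E -> R) : measurable A ->
  (\int[mu]_x (g x * \1_A x)%:E = \int[mu]_(x in A) (g x)%:E)%E.
Proof.
move=> mA; rewrite [RHS]integral_mkcond; apply: eq_integral => x _.
by rewrite patchE indicE; case: ifPn; rewrite ?mulr1 ?mulr0.
Qed.

(** Insert [b (Zt x)]: the variation of [b] divided by the distance leaves [M (Z x) + M (Zt x)], and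
    the error [b - b'] divided by [lam] is seen at [Zt x] only. Hence [L + Lt] in front of [M], but
    [Lt] alone in front of the error. *)
Lemma slice_estimate (b b' : E -> E) (Z Zt : E -> E) (L Lt lam : R) (A B : set E)
    (M : E -> R) (P : E -> Prop) :
  0 <= L -> 0 <= Lt -> 0 < lam -> measurable A -> measurable B ->
  measurable_fun setT b -> measurable_fun setT b' ->
  measurable_fun setT Z -> measurable_fun setT Zt ->
  (forall B : set E, measurable B -> (pushforward mu Z B <= L%:E * mu B)%E) ->
  (forall B : set E, measurable B -> (pushforward mu Zt B <= Lt%:E * mu B)%E) ->
  {ae mu, forall x, B x -> A (Z x) /\ A (Zt x)} ->
  measurable_fun setT M -> (forall x, 0 <= M x) ->
  {ae mu, forall x, A x -> P x} ->
  (forall x y, A x -> A y -> P x -> P y ->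
     enorm (b x - b y) <= enorm (x - y) * (M x + M y)) ->
  (\int[mu]_(x in B) (enorm (b (Z x) - b' (Zt x)) / (lam + enorm (Z x - Zt x)))%:E <=
   (L + Lt)%:E * \int[mu]_(x in A) (M x)%:E +
   (Lt / lam)%:E * \int[mu]_(x in A) (enorm (b x - b' x))%:E)%E.
Proof.
move=> L0 Lt0 lam0 mA mB mb mb' mZ mZt ZL ZtL AZ mM M0 AP HM.
pose g1 x : \bar R := (M x * \1_A x)%:E.
pose g2 x : \bar R := (lam^-1 * (enorm (b x - b' x) * \1_A x))%:E.
have mg1 : measurable_fun setT g1.
  by apply/measurable_EFinP; apply: measurable_funM => //; exact: measurable_indic.
have mg2 : measurable_fun setT g2.
  apply/measurable_EFinP; apply: measurable_funM => //; apply: measurable_funM.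
    exact: measurable_enormB.
  exact: measurable_indic.
have g10 x : (0 <= g1 x)%E by rewrite lee_fin mulr_ge0.
have g20 x : (0 <= g2 x)%E.
  by rewrite lee_fin !mulr_ge0 ?enorm_ge0// invr_ge0 ltW.
have mg1Z := measurableT_comp mg1 mZ; have mg1Zt := measurableT_comp mg1 mZt.
have mg2Zt := measurableT_comp mg2 mZt.
have g1E : (\int[mu]_x g1 x = \int[mu]_(x in A) (M x)%:E)%E by exact: integral_indic_mul.
have g2E : (\int[mu]_x g2 x = lam^-1%:E * \int[mu]_(x in A) (enorm (b x - b' x))%:E)%E.
  rewrite /g2; under eq_integral do rewrite EFinM.
  rewrite ge0_integralZl//; last 3 first.
  - apply/measurable_EFinP; apply: measurable_funM; first exact: measurable_enormB.
    exact: measurable_indic.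
  - by move=> x _; rewrite lee_fin mulr_ge0// enorm_ge0.
  - by rewrite lee_fin invr_ge0 ltW.
  by rewrite integral_indic_mul.
apply: (@le_trans _ _ (\int[mu]_(x in B) (g1 (Z x) + g1 (Zt x) + g2 (Zt x)))%E).
  apply: ae_ge0_le_integral => //.
  - by move=> x _; rewrite lee_fin divr_ge0 ?enorm_ge0// addr_ge0 ?enorm_ge0// ltW.
  - apply/measurable_EFinP; apply: measurable_funTS; apply: measurable_funM.
      by apply: measurable_enormB; exact: measurableT_comp.
    apply: measurable_inv_ge0; first by apply: measurable_funD => //; exact: measurable_enormB.
    by move=> x _; rewrite addr_ge0 ?enorm_ge0// ltW.
  - by move=> x _; rewrite !adde_ge0.
  - apply: measurable_funTS; apply: emeasurable_funD => //; exact: emeasurable_funD.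
  move: (ae_pullback L0 mZ ZL AP) (ae_pullback Lt0 mZt ZtL AP) => PZ PZt.
  move: AZ; apply: filterS3 PZ PZt => x PZ PZt AZ Bx.
  have [AZx AZtx] := AZ Bx.
  rewrite /g1 /g2 !indicE !mem_set// !mulr1 -!EFinD lee_fin.
  have den0 : 0 < lam + enorm (Z x - Zt x) by rewrite ltr_pwDl ?enorm_ge0.
  rewrite ler_pdivrMr//.
  have h1 := HM _ _ AZx AZtx (PZ AZx) (PZt AZtx).
  have h2 : enorm (b (Z x) - b' (Zt x)) <=
      enorm (b (Z x) - b (Zt x)) + enorm (b (Zt x) - b' (Zt x)).
    by rewrite (le_trans _ (enormD _ _))// addrA subrK.
  have h3 : enorm (b (Zt x) - b' (Zt x)) <=
      lam^-1 * enorm (b (Zt x) - b' (Zt x)) * (lam + enorm (Z x - Zt x)).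
    rewrite mulrDr mulrAC mulVf ?gt_eqF// mul1r lerDl !mulr_ge0 ?enorm_ge0//.
    by rewrite invr_ge0 ltW.
  have h4 : 0 <= lam * (M (Z x) + M (Zt x)) by rewrite mulr_ge0 ?addr_ge0// ltW.
  apply: (le_trans h2); apply: (le_trans (lerD h1 h3)).
  by move: h4; move: (M _ + M _) (enorm (Z x - Zt x)) => m e; nra.
rewrite ge0_integralD//; last 3 first.
- by move=> x _; rewrite adde_ge0.
- by apply: measurable_funTS; exact: emeasurable_funD.
- by apply: measurable_funTS.
rewrite ge0_integralD//; last 2 first.
- by apply: measurable_funTS.
- by apply: measurable_funTS.
have sub (g : E -> \bar R) (F : E -> E) l : measurable_fun setT g -> (forall x, (0 <= g x)%E) ->
    0 <= l -> measurable_fun setT F ->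
    (forall B : set E, measurable B -> (pushforward mu F B <= l%:E * mu B)%E) ->
    (\int[mu]_(x in B) g (F x) <= l%:E * \int[mu]_x g x)%E.
  move=> mg g0 l0 mF Fl; apply: le_trans (pushforward_le_integral l0 mF Fl mg g0).
  by apply: ge0_subset_integral => //; exact: measurableT_comp.
apply: le_trans (leeD (leeD (sub _ _ _ mg1 g10 L0 mZ ZL) (sub _ _ _ mg1 g10 Lt0 mZt ZtL))
  (sub _ _ _ mg2 g20 Lt0 mZt ZtL)) _.
rewrite g1E g2E muleA -EFinM EFinD ge0_muleDl ?lee_fin//.
Qed.

End flow_estimates.

Section log_estimate.
Context {R : realType} {d : nat}.
Local Notation E := 'rV[R]_d.
Local Notation mu := (lebesgue_rV d).
Local Notation leb := (@lebesgue_measure R).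

(** The functions [M] and [P] are chosen separately at each time, with no measurability in time;
    only the bound [K] of the integral is, so it alone survives in the time integral. *)
Definition maximal_control (A : set E) (b : E -> E) (K : \bar R) :=
  exists (M : E -> R) (P : E -> Prop),
  [/\ measurable_fun setT M, forall x, 0 <= M x,
      (\int[mu]_(x in A) (M x)%:E <= K)%E,
      {ae mu, forall x, A x -> P x} &
      forall x y, A x -> A y -> P x -> P y ->
        enorm (b x - b y) <= enorm (x - y) * (M x + M y)].

Lemma measurable_slice_integral (I : set R) (A : set E) (phi : R * E -> \bar R) :
  measurable A -> measurable_fun setT phi -> (forall z, (0 <= phi z)%E) ->
  measurable_fun I (fun s => \int[mu]_(x in A) phi (s, x))%E.
Proof.
move=> mA mphi phi0; apply: measurable_funTS.
have mpsi : measurable_fun setT (fun z : R * E => (phi z * (\1_A z.2)%:E)%E).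
  apply: emeasurable_funM => //; apply/measurable_EFinP.
  by apply: (measurableT_comp _ measurable_snd); exact: measurable_indic.
have psi0 z : (0 <= phi z * (\1_A z.2)%:E)%E by rewrite mule_ge0// lee_fin.
have := @measurable_fun_fubini_tonelli_F _ _ _ _ R mu _ mpsi psi0.
apply: eq_measurable_fun => s _; rewrite /fubini_F [RHS]integral_mkcond.
apply: eq_integral => x _; rewrite patchE indicE /=.
by case: ifPn => _; rewrite ?mule1 ?mule0.
Qed.

(** Integrate [path_distance] in [x], exchange the integrals using the joint versions of the flows,
    and apply [slice_estimate] at a.e. time. *)
Lemma rlf_log_estimate a b (v vt : R -> E -> E) (L Lt lam : R) (Z Zt : R -> E -> E)
    (A B : set E) (K : R -> \bar R) :
  a < b -> 0 <= L -> 0 <= Lt -> 0 < lam -> measurable A -> measurable B ->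
  measurable_fun setT (fun z : R * E => v z.1 z.2) ->
  measurable_fun setT (fun z : R * E => vt z.1 z.2) ->
  regular_lagrangian_flow a b v L Z -> regular_lagrangian_flow a b vt Lt Zt ->
  {ae mu, forall x, B x -> forall t, a <= t <= b -> A (Z t x) /\ A (Zt t x)} ->
  measurable_fun `[a, b] K -> (forall s, (0 <= K s)%E) ->
  {ae leb, forall s, a <= s <= b -> maximal_control A (v s) (K s)} ->
  (\int[mu]_(x in B) (ln (1 + enorm (Z b x - Zt b x) / lam))%:E <=
   (L + Lt)%:E * \int[leb]_(s in `[a, b]) K s +
   (Lt / lam)%:E * \int[leb]_(s in `[a, b]) \int[mu]_(x in A) (enorm (v s x - vt s x))%:E)%E.
Proof.
move=> ab L0 Lt0 lam0 mA mB mv mvt hZ hZt AZ mK K0 vK.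
have [Z' [mZ' Z'E]] := rlf_joint ab hZ.
have [Zt' [mZt' Zt'E]] := rlf_joint ab hZt.
have [mZ _ ZL] := hZ; have [mZt _ ZtL] := hZt.
have mI : measurable (`[a, b]%classic : set R) by [].
have mt (u : R -> E -> E) (Y : R * E -> E) : measurable_fun setT (fun z : R * E => u z.1 z.2) ->
    measurable_fun setT Y -> measurable_fun setT (fun z : R * E => u z.1 (Y z)).
  move=> mu_ mY.
  have mp : measurable_fun setT (fun z : R * E => (z.1, Y z)).
    by apply: measurable_fun_pair => //; exact: measurable_fst.
  exact: (measurableT_comp mu_ mp).
have ms (u : R -> E -> E) s : measurable_fun setT (fun z : R * E => u z.1 z.2) ->
    measurable_fun setT (u s).
  by move=> mu_; apply: (measurableT_comp mu_ (measurable_pair1 s)).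
pose w (z : R * E) : \bar R :=
  (enorm (v z.1 (Z' z) - vt z.1 (Zt' z)) / (lam + enorm (Z' z - Zt' z)))%:E.
have w0 z : (0 <= w z)%E.
  by rewrite lee_fin divr_ge0 ?enorm_ge0// addr_ge0 ?enorm_ge0// ltW.
have mw : measurable_fun setT w.
  apply/measurable_EFinP; apply: measurable_funM.
    by apply: measurable_enormB; exact: mt.
  apply: measurable_inv_ge0; first by apply: measurable_funD => //; exact: measurable_enormB.
  by move=> x _; rewrite addr_ge0 ?enorm_ge0// ltW.
have pi0 x : 0 <= enorm (Z b x - Zt b x) / lam by rewrite divr_ge0 ?enorm_ge0// ltW.
have bab : `[a, b]%classic b by rewrite /= in_itv/= lexx ltW.
apply: (@le_trans _ _ (\int[mu]_(x in B) \int[leb]_(s in `[a, b]) w (s, x))%E).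
  apply: ae_ge0_le_integral => //.
  - by move=> x _; rewrite lee_fin ln_ge0// lerDl.
  - apply/measurable_EFinP; apply: measurable_funTS; apply: (measurableT_comp (@measurable_ln R)).
    apply: measurable_funD => //; apply: measurable_funM => //.
    by apply: measurable_enormB; [exact: mZ|exact: mZt].
  - by move=> x _; apply: integral_ge0.
  - by apply: measurable_funTS; exact: measurable_time_integral.
  have ae1 : {ae mu, forall x, (forall t, a <= t <= b -> Z' (t, x) = Z t x) /\
      (forall t, a <= t <= b -> Zt' (t, x) = Zt t x)}.
    by apply: ae_mono2 Z'E Zt'E => x.
  move: (rlf_path hZ) (rlf_path hZt) ae1; apply: filterS3 => x px pxt [Zx Ztx] _.
  have [iw h] := path_distance (ltW ab) lam0 px pxt.
  apply: (@le_trans _ _ (\int[leb]_(t in `[a, b])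
    (enorm (v t (Z t x) - vt t (Zt t x)) / (lam + enorm (Z t x - Zt t x))))%:E).
    by rewrite lee_fin.
  rewrite /Rintegral fineK; last exact: integrable_fin_num.
  rewrite le_eqVlt; apply/orP; left; apply/eqP; apply: eq_integral => s.
  by rewrite inE/= in_itv/= => sab; rewrite /w /= Zx// Ztx.
rewrite tonelli_on//.
pose e (s : R) : \bar R := (\int[mu]_(x in A) (enorm (v s x - vt s x))%:E)%E.
have me : measurable_fun `[a, b] e.
  have mD : measurable_fun setT (fun z : R * E => (enorm (v z.1 z.2 - vt z.1 z.2))%:E).
    by apply/measurable_EFinP; exact: measurable_enormB.
  apply: (measurable_slice_integral mA mD).
  by move=> z; rewrite lee_fin enorm_ge0.
have e0 s : (0 <= e s)%E by apply: integral_ge0 => x _; rewrite lee_fin enorm_ge0.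
have LLt0 : 0 <= L + Lt by rewrite addr_ge0.
have Ll0 : 0 <= Lt / lam by rewrite divr_ge0// ltW.
apply: (@le_trans _ _ (\int[leb]_(s in `[a, b]) ((L + Lt)%:E * K s + (Lt / lam)%:E * e s))%E).
  apply: ae_ge0_le_integral => //.
  - by move=> s _; apply: integral_ge0.
  - exact: measurable_slice_integral.
  - by move=> s _; rewrite adde_ge0// mule_ge0.
  - by apply: emeasurable_funD; exact: measurable_funeM.
  apply: ae_mono vK => s vs sab; have [M [P [mM M0 MK AP HM]]] := vs sab.
  have sab' : `[a, b]%classic s by rewrite /= in_itv.
  apply: le_trans (_ : _ <= (L + Lt)%:E * \int[mu]_(x in A) (M x)%:E + (Lt / lam)%:E * e s)%E _; last first.
    by rewrite leeD2r// lee_wpmul2l.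
  apply: le_trans (slice_estimate L0 Lt0 lam0 mA mB (ms _ s mv) (ms _ s mvt) (mZ _ sab')
    (mZt _ sab') (ZL _ sab') (ZtL _ sab') _ mM M0 AP HM); last first.
    by apply: ae_mono AZ => x Ax Bx; exact: Ax.
  rewrite le_eqVlt; apply/orP; left; apply/eqP; apply: ae_eq_integral => //.
  - apply: measurable_funTS; exact: (measurableT_comp mw (measurable_pair1 s)).
  - apply/measurable_EFinP; apply: measurable_funTS; apply: measurable_funM.
      by apply: measurable_enormB; apply: measurableT_comp; [exact: ms|exact: mZ|exact: ms|exact: mZt].
    apply: measurable_inv_ge0; first by apply: measurable_funD => //; apply: measurable_enormB; [exact: mZ|exact: mZt].
    by move=> x _; rewrite addr_ge0 ?enorm_ge0// ltW.
  by move: Z'E Zt'E; apply: filterS2 => x Zx Ztx Bx; rewrite /w /= Zx// Ztx.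
rewrite ge0_integralD//; last 4 first.
- by move=> s _; rewrite mule_ge0.
- exact: measurable_funeM.
- by move=> s _; rewrite mule_ge0.
- exact: measurable_funeM.
by rewrite !ge0_integralZl.
Qed.

End log_estimate.

(** * Finiteness of the gradient term *)

Section weak_uniqueness.
Context {R : realType} {d : nat}.
Local Notation E := 'rV[R]_d.
Local Notation mu := (lebesgue_rV d).
Implicit Types (a b : 'I_d -> R) (u w g : E -> R).

(** The extreme value theorem bounds [f'] on [[-K, K]]; outside, [f] vanishes near the point, so
    [f'] is [0] there. *)
Lemma derive_bounded_support (f f' : R -> R) (K : R) : 0 <= K ->
  (forall y : R, is_derive y 1 f (f' y)) -> continuous f' ->
  (forall y, K < `|y| -> f y = 0) ->
  exists2 C, 0 < C & forall y, `|f' y| <= C * \1_(`[- K, K]) y.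
Proof.
move=> K0 df cf' fK.
have cN : {within `[- K, K], continuous (fun y : R => `|f' y|)}.
  apply: continuous_subspaceT => y; apply: (@continuous_comp _ _ _ f' Num.norm).
    exact: cf'.
  exact: norm_continuous.
have NKK : - K <= K by lra.
have [c _ Hc] := EVT_max NKK cN.
exists (`|f' c| + 1) => [|y]; first by rewrite ltr_wpDl.
have [yK|Ky] := boolP (y \in `[- K, K]).
  by rewrite indicE mem_set//= mulr1 (le_trans (Hc _ yK))// lerDl.
have Ky' : K < `|y| by rewrite ltNge ler_norml; move: Ky; rewrite in_itv.
suff -> : f' y = 0 by rewrite normr0 mulr_ge0// addr_ge0.
have f0 : \forall z \near y, f z = (fun=> 0 : R) z.
  have : \forall z \near y, K < `|z|.
    have o : open (fun z : R => K < `|z|).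
      apply: (@open_comp _ _ (fun z : R => `|z|) [set z | K < z]); last exact: open_gt.
      by move=> z _; exact: norm_continuous.
    exact: (open_nbhs_nbhs (conj o Ky')).
  by apply: filterS => z; exact: fK.
have h := near_eq_is_derive f0 (df y).
rewrite -(@derive_val _ _ _ _ _ _ _ h).
by rewrite derive_cst.
Qed.

(* The test functions do not depend on w, which makes the weak formulations of
   several functions linear in the limit. *)
Lemma box_test a b i : exists phi : nat -> E -> R,
  [/\ forall n, test_function (phi n),
      forall n w, loc_integrable w ->
        mu.-integrable setT (EFin \o (fun x => w x * phi n x)),
      forall n w, loc_integrable w ->
        mu.-integrable setT (EFin \o (fun x => w x * partial i (phi n) x)) &
      forall w, loc_integrable w ->
        \int[mu]_x (w x * phi n x) @[n --> \oo] --> \int[mu]_(x in box a b) w x].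
Proof.
pose G n j : R -> R := sbump n (a j) (b j).
have GK n j y : `|G n j y| <= \1_(`[- radius_of a b, radius_of a b]) y.
  rewrite ger0_norm ?bump_ge0// (le_trans (bump_le_indic _ _ _ _))//.
  by apply: (@le_indic_radius R d a b j).
have G0 n j y : radius_of a b < `|y| -> G n j y = 0.
  move=> Ky; apply/eqP; rewrite -normr_le0 (le_trans (GK n j y))//.
  by rewrite indic_out.
have mG n j : measurable_fun setT (G n j) by exact: measurable_bump.
exists (fun n => tensor (G n)); split.
- move=> n; apply: (@tensor_test _ _ _ (radius_of a b)); last exact: G0.
  by move=> k j; exact: smooth1_bump.
- by move=> n w lw; exact: (integrable_tensor lw (mG n) (GK n)).
- move=> n w lw.
  have [f' df sf'] : smooth1 1 (G n i) by exact: smooth1_bump.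
  have r0 : 0 <= radius_of a b.
    by rewrite addr_ge0// sumr_ge0// => j _; rewrite addr_ge0.
  (* Dividing the differentiated factor by [C] brings it under the indicator bound that
     [integrable_tensor] asks for. *)
  have [C C0 f'C] := derive_bounded_support r0 df sf' (G0 n i).
  have mf' : measurable_fun setT f' by exact: measurable_realfun.continuous_measurable_fun.
  have -> : EFin \o (fun x => w x * partial i (tensor (G n)) x) =
      EFin \o (fun x => C * (w x * tensor (subst (G n) i (fun y => C^-1 * f' y)) x)).
    apply/funext => x /=; congr EFin; rewrite (partial_tensor df) !tensor_subst.
    by rewrite [RHS]mulrCA; congr (_ * _); rewrite !mulrA divff ?gt_eqF// mul1r.
  apply: integrable_scaleR => //.
  apply: (@integrable_tensor _ _ _ _ (radius_of a b)) => // j.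
    rewrite /subst; case: eqP => // _; exact: measurable_funM.
  move=> y; rewrite /subst; case: eqP => // _.
  rewrite normrM gtr0_norm ?invr_gt0// mulrC ler_pdivrMr// mulrC; exact: f'C.
- move=> w lw; rewrite -Rintegral_box.
  by apply: (@weak_tensor_cvg R d w G _ _ lw mG GK) => j y; exact: bump_cvg.
Qed.

Lemma loc_integrable_sub u w : loc_integrable u -> loc_integrable w ->
  loc_integrable (fun x => u x - w x).
Proof. by move=> lu lw r; apply: integrable_subR => //; exact: measurable_eball. Qed.

Lemma loc_integrable_scale (c : R) w : loc_integrable w ->
  loc_integrable (fun x => c * w x).
Proof. by move=> lw r; apply: integrable_scaleR => //; exact: measurable_eball. Qed.

(** Dyadic cubes are boxes, so [dyadic_ae_eq0] applies on each unit cube, and countably many of them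
    cover the space. *)
Lemma integral_box_ae_eq0 w : loc_integrable w ->
  (forall a b, \int[mu]_(x in box a b) w x = 0) -> {ae mu, forall x, w x = 0}.
Proof.
move=> lw w0.
have : {ae mu, forall x, forall c : {ffun 'I_d -> int}, cube 1 0 c 1 x -> w x = 0}.
  apply: ae_forall_countable => c; apply: (@dyadic_ae_eq0 R d 1 ltr01).
    exact: integrable_cube.
  by move=> k c' _; exact: w0.
by apply: filterS => x H; apply: (H (cell 1 0 x)); exact: cell_cube.
Qed.

(** Linearity and uniqueness of weak derivatives at once: [g'' - (g - c g')] has zero integral
    against the test functions of [box_test], hence over every box. *)
Lemma weak_partial_combination i u u' u'' g g' g'' (c : R) :
  weak_partial i u g -> weak_partial i u' g' -> weak_partial i u'' g'' ->
  (forall x, u'' x = u x - c * u' x) ->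
  {ae mu, forall x, g'' x = g x - c * g' x}.
Proof.
move=> [lu lg ug] [lu' lg' ug'] [lu'' lg'' ug''] uE.
pose w x := g'' x - (g x - c * g' x).
have lcg : loc_integrable (fun x => c * g' x) by exact: loc_integrable_scale.
have lgg : loc_integrable (fun x => g x - c * g' x) by exact: loc_integrable_sub.
have lw : loc_integrable w by exact: loc_integrable_sub.
suff : {ae mu, forall x, w x = 0}.
  by apply: filterS => x /eqP; rewrite subr_eq0 => /eqP.
apply: integral_box_ae_eq0 => // a b.
have [phi [tphi iphi dphi cphi]] := box_test a b i.
suff w0 n : \int[mu]_x (w x * phi n x) = 0.
  have := cphi _ lw; under eq_fun do rewrite w0.
  by move=> /cvg_lim <- //; rewrite lim_cst.
have -> : \int[mu]_x (w x * phi n x) =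
    \int[mu]_x (g'' x * phi n x) - (\int[mu]_x (g x * phi n x) - c * \int[mu]_x (g' x * phi n x)).
  rewrite -RintegralZl//; last exact: iphi.
  rewrite -RintegralB//; [|exact: iphi|]; last first.
    by apply: integrable_scaleR => //; exact: iphi.
  rewrite -RintegralB//; [|exact: iphi|]; last first.
    by apply: integrable_subR => //; [exact: iphi|apply: integrable_scaleR => //; exact: iphi].
  by apply: eq_Rintegral => x _; rewrite /w; ring.
have h := ug _ (tphi n); have h' := ug' _ (tphi n); have h'' := ug'' _ (tphi n).
have : \int[mu]_x (u'' x * partial i (phi n) x) =
    \int[mu]_x (u x * partial i (phi n) x) - c * \int[mu]_x (u' x * partial i (phi n) x).
  rewrite -RintegralZl//; last exact: dphi.
  rewrite -RintegralB//; [|exact: dphi|]; last first.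
    by apply: integrable_scaleR => //; exact: dphi.
  by apply: eq_Rintegral => x _; rewrite uE; ring.
by rewrite h h' h''; lra.
Qed.

End weak_uniqueness.

(** * Lebesgue norms and Jacobians of combined fields *)

Section Lp_norms.
Context {disp : measure_display} {X : measurableType disp} {R : realType}.
Context (mu : {measure set X -> \bar R}).
Implicit Types (D : set X) (g h : X -> R) (q : R).

Lemma LpNormE q D g : 0 < q -> (forall x, 0 <= g x) ->
  LpNorm mu q%:E D g = ((\int[mu]_x ((g x * \1_D x) `^ q)%:E) `^ q^-1)%E.
Proof.
move=> q0 g0; rewrite -LpNorm_powR// -poweRrM mulfV ?gt_eqF// poweRe1//.
exact: Lnorm_ge0.
Qed.

Lemma measurable_LpNorm_integrand q D g : measurable D -> measurable_fun setT g ->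
  measurable_fun setT (fun x => ((g x * \1_D x) `^ q)%:E).
Proof.
move=> mD mg; apply/measurable_EFinP; apply: (measurableT_comp (measurable_powR _)).
by apply: measurable_funM => //; exact: measurable_indic.
Qed.

Lemma LpNorm_le q D g h : 0 < q -> measurable D ->
  measurable_fun setT g -> measurable_fun setT h ->
  (forall x, 0 <= g x) -> (forall x, 0 <= h x) ->
  {ae mu, forall x, g x <= h x} -> (LpNorm mu q%:E D g <= LpNorm mu q%:E D h)%E.
Proof.
move=> q0 mD mg mh g0 h0 gh; rewrite !LpNormE//.
apply: gt0_ler_poweR; rewrite ?invr_ge0 ?(ltW q0)//.
- by rewrite in_itv/= leey andbT; apply: integral_ge0 => x _; rewrite lee_fin powR_ge0.
- by rewrite in_itv/= leey andbT; apply: integral_ge0 => x _; rewrite lee_fin powR_ge0.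
apply: ae_ge0_le_integral => //.
- by move=> x _; rewrite lee_fin powR_ge0.
- exact: measurable_LpNorm_integrand.
- by move=> x _; rewrite lee_fin powR_ge0.
- exact: measurable_LpNorm_integrand.
move: gh; apply: filterS => x gx _; rewrite lee_fin.
apply: ge0_ler_powR; rewrite ?nnegrE ?(ltW q0) ?mulr_ge0//.
by rewrite ler_wpM2r.
Qed.

Lemma LpNormZ q D g (c : R) : 0 < q -> 0 <= c -> measurable D -> measurable_fun setT g ->
  (forall x, 0 <= g x) ->
  LpNorm mu q%:E D (fun x => c * g x) = (c%:E * LpNorm mu q%:E D g)%E.
Proof.
move=> q0 c0 mD mg g0; rewrite !LpNormE//; last by move=> x; rewrite mulr_ge0.
under eq_integral do rewrite -mulrA powRM ?mulr_ge0// EFinM.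
rewrite ge0_integralZl//; last 3 first.
- exact: measurable_LpNorm_integrand.
- by move=> x _; rewrite lee_fin powR_ge0.
- by rewrite lee_fin powR_ge0.
rewrite poweRM ?lee_fin ?powR_ge0//; last by apply: integral_ge0 => x _; rewrite lee_fin powR_ge0.
by rewrite poweR_EFin -powRrM mulfV ?gt_eqF// powRr1.
Qed.

Lemma LpNormD q D g h : 1 <= q -> measurable D ->
  measurable_fun setT g -> measurable_fun setT h ->
  (LpNorm mu q%:E D (fun x => (g x + h x)%R) <= LpNorm mu q%:E D g + LpNorm mu q%:E D h)%E.
Proof.
move=> q1 mD mg mh.
have mi : measurable_fun setT (\1_D : X -> R) by exact: measurable_indic.
have := @minkowski_EFin _ _ _ mu (fun x => g x * \1_D x) (fun x => h x * \1_D x) q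
  (measurable_funM mg mi) (measurable_funM mh mi) q1.
rewrite /LpNorm; congr (_ <= _)%E; congr Lnorm.
by apply/funext => x /=; rewrite mulrDl.
Qed.

End Lp_norms.

Section gradients.
Context {R : realType} {d : nat}.
Local Notation E := 'rV[R]_d.
Local Notation mu := (lebesgue_rV d).
Local Notation leb := (@lebesgue_measure R).

Lemma measurable_LpNorm_slice (q rho : R) (I : set R) (J : R -> E -> 'M[R]_d) : 0 < q ->
  measurable I -> joint_measurable I J ->
  measurable_fun I (fun s => LpNorm mu q%:E (eball rho) (fun x => enorm (J s x))).
Proof.
move=> q0 mI mJ.
pose J' := (fun z : R * E => J z.1 z.2) \_ (I `*` setT).
have mJ' : measurable_fun setT J'.
  by apply: (measurable_restrictT _ _).1 => //; exact: measurableX.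
pose phi (z : R * E) := ((enorm (J' z) * \1_(eball rho) z.2) `^ q)%:E.
have mphi : measurable_fun setT phi.
  apply/measurable_EFinP; apply: (measurableT_comp (measurable_powR _)).
  apply: measurable_funM; first exact: (measurableT_comp (@measurable_enorm R d d) mJ').
  apply: (measurableT_comp _ measurable_snd); apply: measurable_indic.
  exact: measurable_eball.
have phi0 z : (0 <= phi z)%E by rewrite lee_fin powR_ge0.
have mF := @measurable_fun_fubini_tonelli_F _ _ _ _ R mu phi mphi phi0.
have FE s : I s -> fubini_F mu phi s =
    (\int[mu]_x ((enorm (J s x) * \1_(eball rho) x) `^ q)%:E)%E.
  move=> sI; rewrite /fubini_F; apply: eq_integral => x _.
  by rewrite /phi /J' patchE mem_set.
have mFq : measurable_fun I (fun s => poweR (fubini_F mu phi s) q^-1).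
  by apply: measurable_funTS; exact: (measurableT_comp (measurable_poweR q^-1) mF).
apply: (eq_measurable_fun _ _ mFq) => s /set_mem sI.
rewrite (FE _ sI) (LpNormE mu _ q0)//.
by move=> x; exact: enorm_ge0.
Qed.

Lemma weak_jacobian_measurable (u : E -> E) (J : E -> 'M[R]_d) :
  weak_jacobian u J -> measurable_fun setT J.
Proof.
move=> uJ; apply/measurable_fun_mxP => i j; have [_ lJ _] := uJ i j.
exact: loc_integrable_measurable lJ.
Qed.

Lemma weak_jacobian_combination (u u' u'' : E -> E) (J J' J'' : E -> 'M[R]_d) (c : R) :
  weak_jacobian u J -> weak_jacobian u' J' -> weak_jacobian u'' J'' ->
  (forall x, u'' x = u x - c *: u' x) ->
  {ae mu, forall x, J'' x = J x - c *: J' x}.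
Proof.
move=> uJ uJ' uJ'' uE.
have : {ae mu, forall x, forall ij : 'I_d * 'I_d,
    J'' x ij.1 ij.2 = J x ij.1 ij.2 - c * J' x ij.1 ij.2}.
  apply: ae_forall_countable => -[i j] /=.
  apply: (weak_partial_combination (uJ i j) (uJ' i j) (uJ'' i j)) => x.
  by rewrite uE !mxE.
by apply: filterS => x H; apply/matrixP => i j; rewrite !mxE (H (i, j)).
Qed.

(** Minkowski's inequality. In the application [c] is half of [sigma ^+ 2] at one time, and [k] is
    its bound uniform in time. *)
Lemma LpNorm_combination (q rho k : R) (u u' u'' : E -> E) (J J' J'' : E -> 'M[R]_d) (c : R) :
  1 <= q -> 0 <= c <= k ->
  weak_jacobian u J -> weak_jacobian u' J' -> weak_jacobian u'' J'' ->
  (forall x, u'' x = u x - c *: u' x) ->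
  (LpNorm mu q%:E (eball rho) (fun x => enorm (J'' x)) <=
   LpNorm mu q%:E (eball rho) (fun x => enorm (J x)) +
   k%:E * LpNorm mu q%:E (eball rho) (fun x => enorm (J' x)))%E.
Proof.
move=> q1 /andP[c0 ck] uJ uJ' uJ'' uE; have q0 : 0 < q by rewrite (lt_le_trans _ q1).
have k0 := le_trans c0 ck.
have me (H : E -> 'M[R]_d) : measurable_fun setT H -> measurable_fun setT (fun x => enorm (H x)).
  by move=> mH; exact: (measurableT_comp (@measurable_enorm R d d) mH).
have mJ := me _ (weak_jacobian_measurable uJ).
have mJ' := me _ (weak_jacobian_measurable uJ').
have mJ'' := me _ (weak_jacobian_measurable uJ'').
have mB := @measurable_eball R d rho.
have mkJ' : measurable_fun setT (fun x => k * enorm (J' x)) by exact: measurable_funM.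
rewrite -LpNormZ//; last by move=> x; exact: enorm_ge0.
apply: le_trans (LpNormD mu q1 mB mJ mkJ').
apply: LpNorm_le => //.
- exact: measurable_funD.
- by move=> x; exact: enorm_ge0.
- by move=> x; rewrite addr_ge0 ?mulr_ge0 ?enorm_ge0.
apply: filterS (weak_jacobian_combination uJ uJ' uJ'' uE) => x ->.
by rewrite (le_trans (enormB _ _))// lerD2l enormZ ger0_norm// ler_wpM2r// enorm_ge0.
Qed.

End gradients.

Section slices.
Context {R : realType} {d : nat}.
Local Notation E := 'rV[R]_d.
Local Notation mu := (lebesgue_rV d).
Local Notation leb := (@lebesgue_measure R).

Lemma ae_slice (P : R * E -> Prop) : {ae (leb \x mu)%E, forall z, P z} ->
  {ae leb, forall s, {ae mu, forall y, P (s, y)}}.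
Proof.
move=> [N [mN N0 PN]].
have mx s : measurable (xsection N s) by exact: measurable_xsection.
have : ae_eq leb setT (mu \o xsection N) (cst 0%E).
  apply/ae_eq_integral_abs => //; first exact: measurable_fun_xsection.
  by under eq_integral do rewrite gee0_abs ?measure_ge0//.
apply: ae_mono => s /(_ I) /= h; exists (xsection N s); split => // y nP.
by apply/xsectionP; apply: PN.
Qed.

Lemma measurable_fun_mx_on {disp} {X : measurableType disp} (D : set X) (m n : nat)
    (f : X -> 'M[R]_(m, n)) : measurable D ->
  (forall i j, measurable_fun D (fun x => f x i j)) -> measurable_fun D f.
Proof.
move=> mD mf; apply: (@measurability _ _ _ _ D f (@mx_entry_sets _ R m n)) => //.
move=> _ [_ [i [j [B [mB ->]]]] <-].
exact: (mf i j mD B mB).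
Qed.

Lemma joint_drift (I J : set R) (f u : R -> E -> E) (sigma : R -> R) :
  measurable I -> measurable J -> I `<=` J ->
  joint_measurable I f -> joint_measurable I u -> measurable_fun J sigma ->
  joint_measurable I (drift f sigma u).
Proof.
move=> mI mJ IJ mf mu_ ms; rewrite /joint_measurable.
have mIE : measurable (I `*` [set: E]) by exact: measurableX.
apply: measurable_fun_mx_on => // i j; rewrite (ord1 i).
have me (k : R -> E -> E) : joint_measurable I k ->
    measurable_fun (I `*` setT) (fun z : R * E => k z.1 z.2 ord0 j).
  by move=> mk; exact: (measurableT_comp (@measurable_mx_entry R 1 d ord0 j) mk).
rewrite (_ : (fun z => _) = (fun z : R * E =>
    f z.1 z.2 ord0 j - 2^-1 * sigma z.1 ^+ 2 * u z.1 z.2 ord0 j)); last first.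
  by apply/funext => z; rewrite !mxE.
apply: measurable_funB; first exact: me.
apply: measurable_funM; last exact: me.
apply: measurable_funM => //; apply: measurable_funX.
have ms' : measurable_fun setT (sigma \_ J) by exact: (measurable_restrictT _ _).1.
apply: (eq_measurable_fun (fun z : R * E => (sigma \_ J) z.1)).
  by move=> z /set_mem[Iz _]; rewrite patchE mem_set//; exact: IJ.
by apply: measurable_funTS; exact: (measurableT_comp ms' measurable_fst).
Qed.

Lemma drift_growth (I : set R) (f u : R -> E -> E) (sigma : R -> R) (eps : R) (Cf A : R -> R) :
  0 < eps ->
  {ae leb, forall s, I s -> eps <= sigma s <= eps^-1} ->
  {ae leb, forall s, I s -> {ae mu, forall y, enorm (f s y) <= Cf s * (1 + enorm y)}} ->
  {ae leb, forall s, I s -> {ae mu, forall y, enorm (u s y) <= A s * (1 + enorm y)}} ->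
  {ae leb, forall s, I s -> {ae mu, forall y,
    enorm (drift f sigma u s y) <= growth_rate eps Cf A s * (1 + enorm y)}}.
Proof.
move=> eps0; apply: ae_mono3 => s sE fE uE Is.
have /andP[s1 s2] := sE Is; apply: ae_mono2 (fE Is) (uE Is) => y fy uy.
have s0 : 0 <= sigma s by rewrite (le_trans (ltW eps0)).
have hs : sigma s ^+ 2 <= eps ^- 2.
  by rewrite -exprVn lerXn2r// nnegrE// (le_trans s0).
have s2_0 : 0 <= sigma s ^+ 2 by rewrite exprn_ge0.
rewrite (le_trans (enormB _ _))// enormZ ger0_norm ?mulr_ge0//.
rewrite /growth_rate mulrDl lerD//.
apply: (@le_trans _ _ (2^-1 * eps ^- 2 * enorm (u s y))).
  by rewrite ler_wpM2r ?enorm_ge0// ler_wpM2l.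
by rewrite -[leRHS]mulrA ler_wpM2l// mulr_ge0// invr_ge0 exprn_ge0// ltW.
Qed.

Lemma eq_rlf a b (v v' : R -> E -> E) (L : R) (Z : R -> E -> E) :
  (forall s, a <= s <= b -> v s = v' s) ->
  regular_lagrangian_flow a b v L Z -> regular_lagrangian_flow a b v' L Z.
Proof.
move=> vv' [mZ aZ ZL]; split => //; move: aZ; apply: filterS => x [acZ iZ ZE].
have vE s : `[a, b]%classic s -> v s (Z s x) = v' s (Z s x).
  by rewrite /= in_itv/= => sab; rewrite vv'.
split => //.
- move=> i; apply: eq_integrable (iZ i) => // s /set_mem sab.
  by rewrite vE.
- move=> t tab; rewrite ZE//; congr (_ + _); apply/rowP => i; rewrite !mxE.
  apply: eq_Rintegral => s /set_mem; rewrite /= in_itv/= => /andP[as_ st].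
  by rewrite vE//= in_itv/= as_ (le_trans st)//; move: tab; rewrite /= in_itv/= => /andP[].
Qed.

End slices.

(** A nonnegative function with finite integral is finite a.e., so that [fine] inside the integral
    changes only a null set. *)
Lemma ae_fine {disp} {T : measurableType disp} {R : realType}
    (mu : {measure set T -> \bar R}) (I : set T) (K : T -> \bar R) : measurable I -> measurable_fun I K ->
  (forall s, (0 <= K s)%E) -> (\int[mu]_(s in I) K s < +oo)%E ->
  {ae mu, forall s, I s -> K s \is a fin_num} /\
  (\int[mu]_(s in I) K s)%E = (\int[mu]_(s in I) fine (K s))%:E.
Proof.
move=> mI mK K0 Koo.
have iK : mu.-integrable I K.
  by apply/integrableP; split => //; under eq_integral do rewrite gee0_abs//.
have aK := integrable_ae mI iK.
split => //.
have E1 : (\int[mu]_(s in I) K s = \int[mu]_(s in I) (fine (K s))%:E)%E.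
  apply: ae_eq_integral => //; first by apply/measurable_EFinP; exact: measurableT_comp.
  by move: aK; apply: ae_mono => s h Is; rewrite fineK//; exact: h.
rewrite /Rintegral -E1 fineK//.
by rewrite ge0_fin_numE//; exact: integral_ge0.
Qed.

(** * Stability estimate for two flows *)

Section stability.
Context {R : realType} {d : nat}.
Local Notation E := 'rV[R]_d.
Local Notation mu := (lebesgue_rV d).
Local Notation leb := (@lebesgue_measure R).

(** The field error is a real integral over the product, which would read [0] if it were infinite.
    On the ball the fields are at most [1 + |rho|] times their growth rates, which gives finiteness;
    the rest is Tonelli's theorem. *)
Lemma field_error_finite (I : set R) (rho : R) (v vt : R -> E -> E) (G Gt : R -> R) :
  measurable I ->
  measurable_fun setT (fun z : R * E => v z.1 z.2) ->
  measurable_fun setT (fun z : R * E => vt z.1 z.2) ->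
  leb.-integrable I (EFin \o G) -> leb.-integrable I (EFin \o Gt) ->
  {ae leb, forall s, I s -> {ae mu, forall y, enorm (v s y) <= G s * (1 + enorm y)}} ->
  {ae leb, forall s, I s -> {ae mu, forall y, enorm (vt s y) <= Gt s * (1 + enorm y)}} ->
  (\int[leb]_(s in I) \int[mu]_(x in eball rho) (enorm (v s x - vt s x))%:E)%E =
  (field_error I rho v vt)%:E.
Proof.
move=> mI mv mvt iG iGt vG vtGt.
have mB := @measurable_eball R d rho.
pose phi (z : R * E) : \bar R := (enorm (v z.1 z.2 - vt z.1 z.2))%:E.
have mphi : measurable_fun setT phi.
  by apply/measurable_EFinP; exact: measurable_enormB.
have phi0 z : (0 <= phi z)%E by rewrite lee_fin enorm_ge0.
pose J := (\int[leb]_(s in I) \int[mu]_(x in eball rho) phi (s, x))%E.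
have J0 : (0 <= J)%E by apply: integral_ge0 => s _; apply: integral_ge0.
have Joo : (J < +oo)%E.
  pose c := (1 + `|rho|) * fine (mu (eball rho)).
  have iH : leb.-integrable I (EFin \o (fun s => c * (`|G s| + `|Gt s|))).
    apply: integrable_scaleR => //; apply: integrable_addR => //.
      exact: (integrable_abse iG).
    exact: (integrable_abse iGt).
  have c0 : 0 <= c by rewrite mulr_ge0 ?addr_ge0// fine_ge0.
  apply: (@le_lt_trans _ _ (\int[leb]_(s in I) (c * (`|G s| + `|Gt s|))%:E)%E); last first.
    have /integrableP[_] := iH.
    congr (_ < _)%E; apply: eq_integral => s _ /=.
    by rewrite ger0_norm// mulr_ge0// addr_ge0.
  apply: ae_ge0_le_integral => //.
  - by move=> s _; apply: integral_ge0.
  - exact: measurable_slice_integral.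
  - by move=> s _; rewrite lee_fin mulr_ge0// addr_ge0.
  - by have /integrableP[] := iH.
  apply: ae_mono2 vG vtGt => s vG vtGt Is.
  apply: (@le_trans _ _ (\int[mu]_(x in eball rho) ((1 + `|rho|) * (`|G s| + `|Gt s|))%:E)%E).
    apply: ae_ge0_le_integral => //.
    - apply: measurable_funTS; exact: (measurableT_comp mphi (measurable_pair1 s)).
    apply: ae_mono2 (vG Is) (vtGt Is) => y h1 h2; rewrite /eball /= => yr.
    rewrite lee_fin (le_trans (enormB _ _))// (le_trans (lerD h1 h2))//.
    rewrite -mulrDl mulrC.
    apply: (@le_trans _ _ ((1 + enorm y) * (`|G s| + `|Gt s|))).
      by rewrite ler_wpM2l ?addr_ge0 ?enorm_ge0// lerD// ler_norm.
    by rewrite ler_wpM2r ?addr_ge0// lerD2l (le_trans (ltW yr))// ler_norm.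
  rewrite integral_cst// /c -[X in (_ * X)%E](@fineK _ (mu (eball rho))); last first.
    by rewrite ge0_fin_numE// eball_lty.
  by rewrite -EFinM lee_fin mulrAC.
rewrite -/J /field_error /Rintegral.
have -> : (\int[leb \x mu]_(z in I `*` eball rho) (enorm (v z.1 z.2 - vt z.1 z.2))%:E = J)%E.
  pose psi (z : R * E) : \bar R := (phi z * (\1_(I `*` eball rho) z)%:E)%E.
  have mX : measurable (I `*` eball rho) := measurableX mI mB.
  have mpsi : measurable_fun setT psi.
    by apply: emeasurable_funM => //; apply/measurable_EFinP; exact: measurable_indic.
  have psi0 z : (0 <= psi z)%E by rewrite mule_ge0// lee_fin.
  transitivity (\int[leb \x mu]_z psi z)%E.
    rewrite integral_mkcond; apply: eq_integral => z _; rewrite patchE /psi indicE.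
    by case: ifPn; rewrite ?mule1 ?mule0.
  rewrite (@fubini_tonelli1 _ _ _ _ _ leb mu psi mpsi psi0) /J [RHS]integral_mkcond.
  apply: eq_integral => s _; rewrite patchE /fubini_F.
  case: ifPn => sI.
    rewrite [RHS]integral_mkcond; apply: eq_integral => x _; rewrite patchE /psi indicE.
    by rewrite in_setX sI /=; case: ifPn; rewrite ?mule1 ?mule0.
  rewrite integral0_eq// => x _.
  by rewrite /psi indicE in_setX (negbTE sI) mule0.
by rewrite fineK// ge0_fin_numE.
Qed.

End stability.

Section stability.
Context {R : realType} {d : nat}.
Local Notation E := 'rV[R]_d.
Local Notation mu := (lebesgue_rV d).
Local Notation leb := (@lebesgue_measure R).

(** Extension by [0] to all times, so that the estimates on flows can assume Borel fields on the
    whole product. *)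
Lemma joint_extension (I : set R) (v : R -> E -> E) : measurable I ->
  joint_measurable I v -> exists v' : R -> E -> E,
  measurable_fun setT (fun z : R * E => v' z.1 z.2) /\ forall s, I s -> v' s = v s.
Proof.
move=> mI mv; exists (fun s y => ((fun z : R * E => v z.1 z.2) \_ (I `*` setT)) (s, y)).
split.
  rewrite (_ : (fun z => _) = (fun z : R * E => v z.1 z.2) \_ (I `*` setT)).
    by apply: (measurable_restrictT _ _).1 => //; exact: measurableX.
  by apply/funext => -[].
by move=> s Is; apply/funext => y; rewrite patchE mem_set.
Qed.

(** [rlf_log_estimate] with [A] the ball of radius [Rr] and [K] given by [lusin_lipschitz];
    finiteness of the norm of [Dv] at a.e. time is what lets the latter be used and turns [K] into
    the real gradient term. *)
Lemma stability_log_integral (q q' : R) (a b r lam : R) (v vt : R -> E -> E)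
    (L Lt : R) (Z Zt : R -> E -> E) (G Gt : R -> R) (Dv : R -> E -> 'M[R]_d) :
  let I := `[a, b]%classic in
  let Rr := flow_radius I r G Gt in
  (0 < d)%N -> 1 < q -> q'^-1 = 1 - q^-1 -> a < b -> 0 < r -> 0 < lam ->
  0 <= L -> 0 <= Lt ->
  joint_measurable I v -> joint_measurable I vt ->
  regular_lagrangian_flow a b v L Z -> regular_lagrangian_flow a b vt Lt Zt ->
  leb.-integrable I (EFin \o G) -> leb.-integrable I (EFin \o Gt) ->
  {ae leb, forall s, I s -> {ae mu, forall y, enorm (v s y) <= G s * (1 + enorm y)}} ->
  {ae leb, forall s, I s -> {ae mu, forall y, enorm (vt s y) <= Gt s * (1 + enorm y)}} ->
  jacobian_field I v Dv ->
  (\int[leb]_(s in I) LpNorm mu q%:E (eball (3 * Rr)) (fun x => enorm (Dv s x)) < +oo)%E ->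
  (\int[mu]_(x in eball r) (ln (1 + enorm (Z b x - Zt b x) / lam))%:E <=
   (gradient_term (@lusin_cst R d q) L Lt q q' I Rr Dv +
    Lt / lam * field_error I Rr v vt)%:E)%E.
Proof.
move=> I Rr d0 q1 qq' ab r0 lam0 L0 Lt0 mv0 mvt0 hZ0 hZt0 iG iGt vG0 vtGt0 [mDv JDv] Doo.
have q0 : 0 < q by rewrite (lt_trans _ q1).
have mI : measurable I by exact: measurable_itv.
have [v1 [mv vE]] := joint_extension mI mv0.
have [vt1 [mvt vtE]] := joint_extension mI mvt0.
have IP s : a <= s <= b -> I s by rewrite /I /= in_itv.
have hZ : regular_lagrangian_flow a b v1 L Z.
  by apply: eq_rlf hZ0 => s sab; rewrite vE//; exact: IP.
have hZt : regular_lagrangian_flow a b vt1 Lt Zt.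
  by apply: eq_rlf hZt0 => s sab; rewrite vtE//; exact: IP.
have vG : {ae leb, forall s, I s -> {ae mu, forall y, enorm (v1 s y) <= G s * (1 + enorm y)}}.
  by move: vG0; apply: ae_mono => s h Is; rewrite vE//; exact: h.
have vtGt : {ae leb, forall s, I s -> {ae mu, forall y, enorm (vt1 s y) <= Gt s * (1 + enorm y)}}.
  by move: vtGt0; apply: ae_mono => s h Is; rewrite vtE//; exact: h.
have N0 (g : R -> R) : 0 <= L1norm I g by apply: Rintegral_ge0.
(* Each flow grows at most by the exponential of its own rate; the sum in [flow_radius] gives one
   ball for both. *)
have expRr (g : R -> R) : L1norm I g <= L1norm I G + L1norm I Gt ->
    forall x y : E, eball r x -> 1 + enorm y <= (1 + enorm x) * expR (L1norm I g) -> eball Rr y.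
  move=> gle x y; rewrite /eball /= => xr h.
  have h2 : (1 + enorm x) * expR (L1norm I g) < Rr.
    apply: (@le_lt_trans _ _ ((1 + enorm x) * expR (L1norm I G + L1norm I Gt))).
      by rewrite ler_wpM2l ?addr_ge0 ?enorm_ge0// ler_expR.
    by rewrite /Rr /flow_radius ltr_pM2r ?expR_gt0// ltrD2l.
  by have := le_lt_trans h h2; lra.
have conf : {ae mu, forall x, eball r x -> forall t, a <= t <= b ->
    eball Rr (Z t x) /\ eball Rr (Zt t x)}.
  apply: ae_mono2 (rlf_bound ab L0 mv hZ iG vG) (rlf_bound ab Lt0 mvt hZt iGt vtGt).
  move=> x hx htx xr t tab; split.
    by apply: (expRr G) (hx t tab) => //; rewrite lerDl.
  by apply: (expRr Gt) (htx t tab) => //; rewrite lerDr.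
have Rr0 : 0 < Rr by rewrite mulr_gt0 ?expR_gt0// addr_gt0.
pose c := @lusin_cst R d q * fine (mu (eball Rr)) `^ q'^-1.
pose N s := LpNorm mu q%:E (eball (3 * Rr)) (fun x => enorm (Dv s x)).
have c0 : 0 <= c by rewrite mulr_ge0 ?powR_ge0// lusin_cst_ge0.
have N_0 s : (0 <= N s)%E by exact: Lnorm_ge0.
have mN : measurable_fun I N by exact: measurable_LpNorm_slice.
have [finN intN] := @ae_fine _ _ R leb I N mI mN N_0 Doo.
pose K s := (c%:E * N s)%E.
have mK : measurable_fun I K by exact: measurable_funeM.
have K0 s : (0 <= K s)%E by rewrite mule_ge0.
have ctrl : {ae leb, forall s, a <= s <= b -> maximal_control (eball Rr) (v1 s) (K s)}.
  apply: ae_mono2 finN JDv => s fs Js sab; have Is := IP s sab.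
  have Noo : (N s < +oo)%E by rewrite -ge0_fin_numE//; exact: fs.
  have [M [P [mM M0 MK AP HM]]] := lusin_lipschitz d0 q1 Rr0 (Js Is) Noo.
  exists M, P; split => //; last by move=> x y xr yr Px Py; rewrite vE//; exact: HM.
  apply: (le_trans MK); rewrite /K -[X in (_ * X)%E](fineK (fs Is)) -EFinM lee_fin.
  by rewrite /c qq' mulrA.
have H := rlf_log_estimate ab L0 Lt0 lam0 (measurable_eball Rr) (measurable_eball r)
  mv mvt hZ hZt conf mK K0 ctrl.
apply: (le_trans H).
rewrite (field_error_finite Rr mI mv mvt iG iGt vG vtGt).
rewrite /K ge0_integralZl// intN -!EFinM -EFinD lee_fin.
have -> : field_error I Rr v1 vt1 = field_error I Rr v vt.
  by apply: eq_Rintegral => -[s x] /set_mem[Is _] /=; rewrite vE// vtE.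
rewrite lerD2r /gradient_term le_eqVlt; apply/orP; left; apply/eqP.
by rewrite /c /N; ring.
Qed.

(** Markov's inequality: by monotonicity the logarithm is at least [ln (1 + eta / lam)] on the bad
    set. *)
Lemma markov_log (r b eta lam K : R) (Z Zt : R -> E -> E) : 0 < eta -> 0 < lam ->
  measurable_fun setT (Z b) -> measurable_fun setT (Zt b) ->
  (\int[mu]_(x in eball r) (ln (1 + enorm (Z b x - Zt b x) / lam))%:E <= K%:E)%E ->
  (mu (bad_set r b eta Z Zt) <= ((ln (1 + eta / lam))^-1 * K)%:E)%E.
Proof.
move=> eta0 lam0 mZ mZt HK; set l := ln (1 + eta / lam).
have l0 : 0 < l by rewrite ln_gt0// ltrDl divr_gt0.
have mD : measurable_fun setT (fun x => enorm (Z b x - Zt b x)) by exact: measurable_enormB.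
have mbad : measurable (bad_set r b eta Z Zt).
  apply: measurableI; first exact: measurable_eball.
  rewrite (_ : [set x | _] = setT `&` (fun x => enorm (Z b x - Zt b x)) @^-1` `]eta, +oo[).
    exact: mD.
  by rewrite setTI; apply/seteqP; split => x /=; rewrite in_itv/= andbT.
have pi0 x : 0 <= enorm (Z b x - Zt b x) / lam by rewrite divr_ge0 ?enorm_ge0// ltW.
rewrite EFinM lee_pdivlMl//; apply: le_trans HK.
have -> : (l%:E * mu (bad_set r b eta Z Zt) =
    \int[mu]_(x in eball r) (l * \1_(bad_set r b eta Z Zt) x)%:E)%E.
  under eq_integral do rewrite EFinM.
  rewrite ge0_integralZl//; last 3 first.
  - exact: measurable_eball.
  - by apply/measurable_EFinP; apply: measurable_funTS; exact: measurable_indic.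
  - by rewrite lee_fin ltW.
  rewrite integral_indic//; last exact: measurable_eball.
  by congr (_ * mu _)%E; apply/seteqP; split => x; [move=> h; split=> //; case: h|case].
apply: ge0_le_integral => //.
- exact: measurable_eball.
- by move=> x _; rewrite lee_fin mulr_ge0// ltW.
- by apply/measurable_EFinP; apply: measurable_funM => //; apply: measurable_funTS; exact: measurable_indic.
- apply/measurable_EFinP; apply: measurable_funTS; apply: (measurableT_comp (@measurable_ln R)).
  by apply: measurable_funD => //; exact: measurable_funM.
move=> x _; rewrite lee_fin indicE; case: (boolP (x \in _)) => [/set_mem[_ /= h]|_].
  have h1 : 0 < 1 + eta / lam by rewrite addr_gt0// divr_gt0.
  have h2 : 1 + eta / lam <= 1 + enorm (Z b x - Zt b x) / lam.
    by rewrite lerD2l ler_pM2r ?invr_gt0// ltW.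
  by rewrite mulr1 ler_ln// posrE (lt_le_trans h1 h2).
by rewrite mulr0 ln_ge0// lerDl.
Qed.

End stability.

(** * Logarithmic rate of the bound *)

Section rates.
Context {R : realType}.
Implicit Types (C Lt eta : R).

Lemma ln_inv_dominates_at0 : (ln e^-1)^-1 @[e --> (0:R)^'+] --> (0:R).
Proof.
apply/cvgrPdist_lt => eps eps0; near=> e.
have e0 : 0 < e by near: e; exact: nbhs_right_gt.
have el : e < expR (- eps^-1) by near: e; apply: nbhs_right_lt; exact: expR_gt0.
have h : eps^-1 < ln e^-1.
  by rewrite lnV ?posrE// ltrNr -[ltRHS]expRK ltr_ln ?posrE// expR_gt0.
have l0 : 0 < ln e^-1 by rewrite (lt_trans _ h)// invr_gt0.
rewrite sub0r normrN gtr0_norm ?invr_gt0//.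
by rewrite -[ltRHS]invrK ltf_pV2// posrE// invr_gt0.
Unshelve. all: by end_near. Qed.

Lemma sqrt_cvg_at0 : Num.sqrt e @[e --> (0:R)^'+] --> (0:R).
Proof.
rewrite -[X in _ --> X]sqrtr0; apply: cvg_at_right_filter; exact: sqrt_continuous.
Qed.

Lemma powR_half_inv (e : R) : 0 < e -> e `^ (- 2^-1) = (Num.sqrt e)^-1.
Proof. by move=> e0; rewrite powRN powR12_sqrt// ltW. Qed.

(** [ln (1 + eta / sqrt e)] splits as [ln (sqrt e + eta) + ln (e^-1) / 2]. The first term stays
    bounded as [e] tends to [0], so the half explains the limit [2 * C]. *)
Lemma log_rate_split C Lt eta (e : R) : 0 < eta -> 0 < e -> e < 1 ->
  log_rate C Lt eta e * ln e^-1 =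
  (C + Lt * Num.sqrt e) / (2^-1 + ln (Num.sqrt e + eta) * (ln e^-1)^-1).
Proof.
move=> eta0 e0 e1; have s0 : 0 < Num.sqrt e by rewrite sqrtr_gt0.
have l0 : 0 < ln e^-1 by rewrite ln_gt0// invf_gt1.
rewrite /log_rate powR_half_inv//.
have -> : ln (1 + eta / Num.sqrt e) = ln (Num.sqrt e + eta) + 2^-1 * ln e^-1.
  have -> : 1 + eta / Num.sqrt e = (Num.sqrt e + eta) / Num.sqrt e.
    by rewrite mulrDl divff// gt_eqF.
  rewrite ln_div ?posrE ?addr_gt0//; congr (_ + _).
  by rewrite -[in LHS]powR12_sqrt ?ltW// ln_powR lnV ?posrE// mulrN.
have -> : 2^-1 + ln (Num.sqrt e + eta) / ln e^-1 =
    (ln (Num.sqrt e + eta) + 2^-1 * ln e^-1) / ln e^-1.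
  by rewrite mulrDl mulfK ?gt_eqF// addrC.
by rewrite invfM invrK mulrA.
Qed.

Lemma log_rate_cvg C Lt eta : 0 < eta ->
  log_rate C Lt eta e * ln e^-1 @[e --> (0:R)^'+] --> 2 * C.
Proof.
move=> eta0.
have h1 : (C + Lt * Num.sqrt e) / (2^-1 + ln (Num.sqrt e + eta) * (ln e^-1)^-1)
    @[e --> (0:R)^'+] --> (C + Lt * 0) / (2^-1 + ln (0 + eta) * 0).
  apply: cvgM.
    by apply: cvgD; [exact: cvg_cst|apply: cvgM; [exact: cvg_cst|exact: sqrt_cvg_at0]].
  apply: cvgV; first by rewrite mulr0 addr0 invr_eq0 pnatr_eq0.
  apply: cvgD; first exact: cvg_cst.
  apply: cvgM; last exact: ln_inv_dominates_at0.
  apply: continuous_cvg; first by apply: continuous_ln; rewrite add0r.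
  by apply: cvgD; [exact: sqrt_cvg_at0|exact: cvg_cst].
have -> : 2 * C = (C + Lt * 0) / (2^-1 + ln (0 + eta) * 0).
  by rewrite !mulr0 !addr0 invrK mulrC.
apply: cvg_trans h1; apply: near_eq_cvg; near=> e.
have e0 : 0 < e by near: e; exact: nbhs_right_gt.
have e1 : e < 1 by near: e; exact: nbhs_right_lt.
by rewrite log_rate_split.
Unshelve. all: by end_near. Qed.

Lemma log_rate_cvg0 C Lt eta : 0 < eta -> log_rate C Lt eta e @[e --> (0:R)^'+] --> (0:R).
Proof.
move=> eta0.
have h : (log_rate C Lt eta e * ln e^-1) * (ln e^-1)^-1 @[e --> (0:R)^'+] --> 2 * C * 0.
  by apply: cvgM; [exact: log_rate_cvg|exact: ln_inv_dominates_at0].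
rewrite mulr0 in h; apply: cvg_trans h; apply: near_eq_cvg; near=> e.
have e0 : 0 < e by near: e; exact: nbhs_right_gt.
have e1 : e < 1 by near: e; exact: nbhs_right_lt.
by rewrite /= mulfK// gt_eqF// ln_gt0// invf_gt1.
Unshelve. all: by end_near. Qed.

End rates.

Section gradient_finite.
Context {R : realType} {d : nat}.
Local Notation E := 'rV[R]_d.
Local Notation mu := (lebesgue_rV d).
Local Notation leb := (@lebesgue_measure R).

(** At a.e. time [Dv] is the Jacobian of [f] minus half of [sigma ^+ 2] times that of [u], by
    uniqueness; the scalar is at most half of [eps ^- 2]. *)
Lemma gradient_finite (I : set R) (q eps rho : R) (f u : R -> E -> E) (sigma : R -> R)
    (H Dv : R -> E -> 'M[R]_d) : measurable I -> 1 < q -> 0 < eps ->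
  {ae leb, forall s, I s -> eps <= sigma s <= eps^-1} ->
  L1W1q_loc I q f -> jacobian_field I u H ->
  L1Lq_loc I q%:E (fun t x => enorm (H t x)) ->
  jacobian_field I (drift f sigma u) Dv ->
  (\int[leb]_(s in I) LpNorm mu q%:E (eball rho) (fun x => enorm (Dv s x)) < +oo)%E.
Proof.
move=> mI q1 eps0 sE [_ _ [Df [mDf JDf] Dfoo]] [mH JH] Hoo [mDv JDv].
have q0 : 0 < q by rewrite (lt_trans _ q1).
pose k := 2^-1 * eps ^- 2; have k0 : 0 <= k by rewrite mulr_ge0// invr_ge0 exprn_ge0// ltW.
pose N (J : R -> E -> 'M[R]_d) s := LpNorm mu q%:E (eball rho) (fun x => enorm (J s x)).
have N0 J s : (0 <= N J s)%E by exact: Lnorm_ge0.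
have mN J : joint_measurable I J -> measurable_fun I (N J) by exact: measurable_LpNorm_slice.
apply: (@le_lt_trans _ _ (\int[leb]_(s in I) (N Df s + k%:E * N H s))%E); last first.
  rewrite ge0_integralD//; last 3 first.
  - exact: mN.
  - by move=> s _; rewrite mule_ge0.
  - by apply: measurable_funeM; exact: mN.
  rewrite ge0_integralZl//; last exact: mN.
  rewrite lte_add_pinfty//; first exact: Dfoo.
  by rewrite lte_mul_pinfty//; exact: Hoo.
have D1 : {ae leb, forall s, I s -> weak_jacobian (f s) (Df s) /\ weak_jacobian (u s) (H s)}.
  by move: JDf JH; apply: ae_mono2 => s h1 h2 Is; split; [exact: h1|exact: h2].
apply: ae_ge0_le_integral => //.
- by move=> s _; exact: N0.
- exact: mN.
- by move=> s _; rewrite adde_ge0// mule_ge0.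
- by apply: emeasurable_funD; [exact: mN|apply: measurable_funeM; exact: mN].
move: sE D1 JDv; apply: ae_mono3 => s sE D1 JDv Is.
have [Jf Ju] := D1 Is; have /andP[s1 s2] := sE Is.
have s0 : 0 <= sigma s by rewrite (le_trans (ltW eps0)).
apply: (LpNorm_combination rho (ltW q1) _ Jf Ju (JDv Is) (c := 2^-1 * sigma s ^+ 2)) => //.
rewrite mulr_ge0 ?exprn_ge0//= ler_wpM2l// -exprVn lerXn2r// nnegrE//.
exact: le_trans s2.
Qed.

End gradient_finite.

(** Serves the case of a vanishing field error, where the logarithm in the denominator may be made
    any [M]. Taking [M] as [|K| + 1] over [e] keeps it positive whatever [K] is. *)
Lemma measure_eq0_of_le_inv {R : realType} {d : nat} (A : set 'rV[R]_d) (K : R) :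
  (forall M : R, 0 < M -> (lebesgue_rV d A <= (M^-1 * K)%:E)%E) -> lebesgue_rV d A = 0%E.
Proof.
move=> H; apply/eqP; rewrite eq_le measure_ge0 andbT; apply/lee_addgt0Pr => e e0.
rewrite add0e; have K0 : 0 < (`|K| + 1) / e by rewrite divr_gt0// ltr_wpDl.
apply: le_trans (H _ K0) _; rewrite lee_fin invf_div mulrAC ler_pdivrMr ?ltr_wpDl//.
by rewrite ler_wpM2l ?(ltW e0)// (le_trans (ler_norm _))// lerDl.
Qed.
Theorem theorem7p1 (R : realType) (d : nat) (q q' : R)
  (hd : (1 <= d)%N) (hq : 1 < q) (hq' : q'^-1 = 1 - q^-1) :
  exists C : R,
  forall (T delta : R) (hT : 0 < T) (hdelta : 0 <= delta) (hdeltaT : delta < T)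
    (dO : measure_display) (Omega : measurableType dO)
    (P : probability Omega R) (F : R -> set (set Omega))
    (W X : R -> Omega -> 'rV[R]_d)
    (f : R -> 'rV[R]_d -> 'rV[R]_d) (sigma : R -> R) (p : R -> 'rV[R]_d -> R)
    (hF : filtration F) (hW : brownian_motion P T F W)
    (hX : sde_solution P T F W f sigma X) (hp : marginal_densities P T X p)
    (sc : R -> 'rV[R]_d -> 'rV[R]_d) (H : R -> 'rV[R]_d -> 'M[R]_d)
    (st : R -> 'rV[R]_d -> 'rV[R]_d) (divf divvt : R -> 'rV[R]_d -> R)
    (Dv : R -> 'rV[R]_d -> 'M[R]_d)
    (eps : R) (Cf A At Lambda : R -> R),
  let I := `[delta, T]%classic in
  let v := drift f sigma sc in
  let vt := drift f sigma st in
  forall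
    (E1 : diffusion_bounds T eps sigma)
    (D0 : L2_loc I f)
    (D2 : divergence_control I f divf)
    (D1q : L1W1q_loc I q f)
    (D4 : linear_growth I Cf f)
    (I0 : initial_density (p 0))
    (S1 : density_regularity I p)
    (S2 : score_regularity I p sc H)
    (S3 : laplacian_upper_bound I H Lambda)
    (S4 : score_growth I sc A)
    (S2q : L1Lq_loc I q%:E (fun t x => enorm (H t x)))
    (A1 : L1W1q_loc I q st)
    (hdivvt : divergence_field I vt divvt)
    (A2 : negpart_L1Linf I divvt)
    (A3 : linear_growth I At st)
    (hDv : jacobian_field I v Dv),
  let L := compressibility T I sigma divf Lambda in
  let Lt := compressibility_learned I divvt in
  forall (Z Zt : R -> 'rV[R]_d -> 'rV[R]_d)
    (hZ : regular_lagrangian_flow delta T v L Z)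
    (hZt : regular_lagrangian_flow delta T vt Lt Zt)
    (r : R) (hr : 0 < r),
  let Rr := flow_radius I r (growth_rate eps Cf A) (growth_rate eps Cf At) in
  let Ev := field_error I Rr v vt in
  let Cq := gradient_term C L Lt q q' I Rr Dv in
  [/\ forall lambda eta : R, 0 < lambda -> 0 < eta ->
        (lebesgue_rV d (bad_set r T eta Z Zt) <=
         ((ln (1 + eta / lambda))^-1 * (Cq + Lt / lambda * Ev))%:E)%E,
      forall eta : R, 0 < eta -> 0 < Ev -> Ev < eta ^+ 2 ->
        (lebesgue_rV d (bad_set r T eta Z Zt) <= (log_rate Cq Lt eta Ev)%:E)%E,
      (* the case Ev = 0, where the right-hand side reads Cq / log(+oo) *)
      forall eta : R, 0 < eta -> Ev = 0 ->
        lebesgue_rV d (bad_set r T eta Z Zt) = 0%E &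
      forall eta : R, 0 < eta ->
        log_rate Cq Lt eta e @[e --> 0^'+] --> 0 /\
        log_rate Cq Lt eta e * ln e^-1 @[e --> 0^'+] --> 2 * Cq].

Proof.
(* The constant is chosen before all the data and depends on [d] and [q] only. *)
exists (@lusin_cst R d q) => T delta hT hdelta hdeltaT dO Omega P F W X f sigma p _ _ _ _.
move=> sc H st divf divvt Dv eps Cf A At Lambda I v vt [msig _ eps0 sE] [mf _] _ D1q.
move=> [iCf fgr] _ _ [msc _ hH _ _] _ [iA scgr] S2q [mst _ _] _ _ [iAt stgr] hDv.
move=> L Lt Z Zt hZ hZt r hr Rr Ev Cq.
have mI : measurable I by exact: measurable_itv.
have IT : I `<=` `[0, T].
  by move=> s; rewrite /I /= !in_itv/= => /andP[ds ->]; rewrite (le_trans hdelta ds).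
have sEI : {ae lebesgue_measure, forall s, I s -> eps <= sigma s <= eps^-1}.
  by move: sE; apply: ae_mono => s h Is; apply: h; exact: IT.
have mT : measurable (`[0, T]%classic : set R) by [].
have mv : joint_measurable I v by exact: (joint_drift mI mT IT mf msc msig).
have mvt : joint_measurable I vt by exact: (joint_drift mI mT IT mf mst msig).
have igr B : lebesgue_measure.-integrable I (EFin \o B) ->
    lebesgue_measure.-integrable I (EFin \o growth_rate eps Cf B).
  by move=> iB; apply: integrable_addR => //; exact: integrable_scaleR.
have fgr' := ae_slice fgr; have stgr' := ae_slice stgr.
have fsl : {ae lebesgue_measure, forall s, I s ->
    {ae lebesgue_rV d, forall y, enorm (f s y) <= Cf s * (1 + enorm y)}}.
  move: fgr'; apply: ae_mono => s h Is; move: h; apply: ae_mono => y; exact.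
have stsl : {ae lebesgue_measure, forall s, I s ->
    {ae lebesgue_rV d, forall y, enorm (st s y) <= At s * (1 + enorm y)}}.
  move: stgr'; apply: ae_mono => s h Is; move: h; apply: ae_mono => y; exact.
have vgr := drift_growth eps0 sEI fsl scgr.
have vtgr := drift_growth eps0 sEI fsl stsl.
have L0 : 0 <= L by exact: expR_ge0.
have Lt0 : 0 <= Lt by exact: expR_ge0.
(* This guarantees that [fine] and the real integral in [Cq] do not hide an infinite value. *)
have Doo := gradient_finite (3 * Rr) mI hq eps0 sEI D1q hH S2q hDv.
have mZT : measurable_fun setT (Z T).
  by have [mZ _ _] := hZ; apply: mZ; rewrite /= in_itv/= lexx ltW.
have mZtT : measurable_fun setT (Zt T).
  by have [mZt _ _] := hZt; apply: mZt; rewrite /= in_itv/= lexx ltW.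
have main lambda eta : 0 < lambda -> 0 < eta ->
    (lebesgue_rV d (bad_set r T eta Z Zt) <=
     ((ln (1 + eta / lambda))^-1 * (Cq + Lt / lambda * Ev))%:E)%E.
  move=> lambda0 eta0; apply: markov_log => //.
  exact: (stability_log_integral hd hq hq' hdeltaT hr lambda0 L0 Lt0 mv mvt hZ hZt
    (igr _ iA) (igr _ iAt) vgr vtgr hDv Doo).
split => //.
(* With [lambda = sqrt Ev], the error term [Lt / lambda * Ev] is [Lt * sqrt Ev]. *)
- move=> eta eta0 Ev0 _; have s0 : 0 < Num.sqrt Ev by rewrite sqrtr_gt0.
  apply: le_trans (main _ _ s0 eta0) _; rewrite lee_fin /log_rate powR_half_inv// mulrC.
  rewrite -[X in Lt / _ * X](sqr_sqrtr (ltW Ev0)) expr2 mulrA divfK ?gt_eqF//.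
- move=> eta eta0 Ev0; apply: (@measure_eq0_of_le_inv _ _ _ Cq) => M M0.
  (* lambda = eta / (e^M - 1) makes the logarithm equal to M *)
  have e1 : 0 < expR M - 1 by rewrite subr_gt0 expR_gt1.
  have := main (eta / (expR M - 1)) eta (divr_gt0 eta0 e1) eta0.
  rewrite Ev0 mulr0 addr0 invf_div (mulrC eta) divfK ?gt_eqF//.
  by rewrite addrC subrK expRK.
- by move=> eta eta0; split; [exact: log_rate_cvg0|exact: log_rate_cvg].
Qed.
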